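(* Let $n\in\{2,3\}$ and assume that (A) $\mathcal{T}_h^\Gamma$ is quasi-uniform: there is a constant $\nu>0$ independent of $h_\Gamma$ with $h_\tau\ge\nu h_\Gamma$ for all $\tau\in\mathcal{T}_h^\Gamma$; and (B) $\mathcal{E}_h$ is a subgrid of $\mathcal{E}_H$, i.e. $\mathcal{E}_\cap=\mathcal{E}_h$. Then there exists a linear map $E_h:X_{h,H}\to X_{h,H}\cap H^1(D)$ such that, for all $v\in X_{h,H}$, \[ \sum_{\tau\in\mathcal{T}_{h,H}^\Gamma}h_\tau^{2m-2}|v-E_hv|_{m,\tau}^2\le C\sum_{e\in\mathcal{E}_\cap}h_e^{-1}\|[\![v]\!]\|_{0,e}^2\qquad\text{for all integers } 0\le m\le r, \] where the constant $C$ is independent of $h$, $H$ and $H/h$.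
   Context: $D\subset\mathbb{R}^n$ is a bounded domain, $K_1\subset D$, $K_2=D\setminus K_1$, $\Gamma=\partial K_1\setminus\partial D$. $|\cdot|_{m,\tau}$ is the $H^m(\tau)$ seminorm and $\|\cdot\|_{0,e}$ the $L^2(e)$ norm. $\mathcal{T}_h$, $\mathcal{T}_H$ are shape-regular (chunkiness parameter $\sigma$) simplicial triangulations of $K_1$, $K_2$ with maximal mesh sizes $h$, $H$; they need not match across $\Gamma$. $h_\tau$ is the diameter of $\tau$. $\mathcal{T}_h^\Gamma=\{\tau\in\mathcal{T}_h:\bar\tau\cap\Gamma\ne\emptyset\}$, $\mathcal{T}_H^\Gamma=\{\tau\in\mathcal{T}_H:\bar\tau\cap\Gamma\neq\emptyset\}$, $\mathcal{T}_{h,H}^\Gamma=\mathcal{T}_h^\Gamma\cup\mathcal{T}_H^\Gamma$, $h_\Gamma=\max\{h_\tau:\tau\in\mathcal{T}_h^\Gamma\}$. $\mathcal{E}_h,\mathcal{E}_H$ are the sets of edges (faces if $n=3$) on $\Gamma$ of $\mathcal{T}_h,\mathcal{T}_H$, and $\mathcal{E}_\cap=\{e\cap E:e\in\mathcal{E}_h,E\in\mathcal{E}_H\}$. For $e\in\mathcal{E}_\cap$ with $e=\bar\tau_1\cap\bar\tau_2$, $\tau_1\in\mathcal{T}_h^\Gamma$, $\tau_2\in\mathcal{T}_H^\Gamma$, put $h_e=h_{\tau_1}$. For $v=(v_1,v_2)$ ($v_i$ the restriction to $K_i$), $[\![v]\!]=v_1-v_2$ on $e$. $X_h$, $X_H$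 are the continuous Lagrange finite element spaces of piecewise polynomials of degree $r$ over $\mathcal{T}_h$, $\mathcal{T}_H$, and $X_{h,H}=X_h\times X_H$. The constant $C$ may depend on $n$, $r$, $\sigma$, $\nu$. *)

(* Defs.v *)
From HB Require Import structures.
From mathcomp Require Import all_boot all_order all_algebra.
From mathcomp Require Import all_classical all_reals all_analysis.

Set Implicit Arguments.
Unset Strict Implicit.
Unset Printing Implicit Defensive.

Import Order.TTheory GRing.Theory Num.Theory.
Import numFieldNormedType.Exports.

Local Open Scope classical_set_scope.
Local Open Scope ring_scope.

(* The product of the measure m1 on T and the measure mu on T^n, seen on T^(n+1). *)
Section cons_measure.
Context d (T : measurableType d) (R : realType) (n : nat).
Variable m1 : {sigma_finite_measure set T -> \bar R}.
Variable mu : {sigma_finite_measure set n.-tuple T -> \bar R}.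

Definition tcons (p : T * n.-tuple T) : n.+1.-tuple T := [tuple of p.1 :: p.2].

Lemma measurable_tcons : measurable_fun setT tcons.
Proof. by apply: measurable_cons; [exact: measurable_fst|exact: measurable_snd]. Qed.

Definition cons_measure : set (n.+1.-tuple T) -> \bar R :=
  pushforward (m1 \x mu)%E tcons.

Let cons0 : cons_measure set0 = 0%E.
Proof. by rewrite /cons_measure /pushforward preimage_set0 measure0. Qed.

Let cons_ge0 A : (0 <= cons_measure A)%E.
Proof. by rewrite /cons_measure /pushforward; exact: measure_ge0. Qed.

Let cons_additive : semi_sigma_additive cons_measure.
Proof.
move=> F mF tF mUF; rewrite /cons_measure /pushforward preimage_bigcup.
apply: measure_semi_sigma_additive.
- by move=> k; rewrite -[X in measurable X]setTI; exact: measurable_tcons.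
- apply/trivIsetP => /= i j _ _ ij; rewrite -preimage_setI.
  by move/trivIsetP : tF => /(_ _ _ _ _ ij) ->//; rewrite preimage_set0.
- by rewrite -preimage_bigcup -[X in measurable X]setTI; exact: measurable_tcons.
Qed.

HB.instance Definition _ := isMeasure.Build _ _ _ cons_measure
  cons0 cons_ge0 cons_additive.

Let cons_sigma_finite : sigma_finite setT cons_measure.
Proof.
have /sigma_finiteP[F [TF ndF Foo]] := sigma_finiteT m1.
have /sigma_finiteP[G [TG ndG Goo]] := sigma_finiteT mu.
pose un (t : n.+1.-tuple T) : T * n.-tuple T := (thead t, [tuple of behead t]).
have mun : measurable_fun setT un.
  apply/measurable_fun_pair => /=; first exact: measurable_tnth.
  exact: measurable_behead.
exists (fun k => un @^-1` (F k `*` G k)).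
  apply/seteqP; split => // t _; have [i _ Fi] : (\bigcup_i F i) (thead t).
    by rewrite -TF.
  have [j _ Gj] : (\bigcup_i G i) [tuple of behead t] by rewrite -TG.
  exists (maxn i j) => //; split => /=.
    by move: Fi; exact/subsetPset/ndF/leq_maxl.
  by move: Gj; exact/subsetPset/ndG/leq_maxr.
move=> k; have [mF Fk] := Foo k; have [mG Gk] := Goo k; split.
  by rewrite -[X in measurable X]setTI; apply: mun => //; exact: measurableX.
rewrite /cons_measure /pushforward -comp_preimage.
rewrite (_ : un \o tcons = idfun) ?preimage_id.
  by rewrite product_measure1E// lte_mul_pinfty// ge0_fin_numE.
by apply/funext => -[x t]; rewrite /un /tcons/=; congr pair; apply: val_inj.
Qed.

HB.instance Definition _ := Measure_isSigmaFinite.Build _ _ _ cons_measure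
  cons_sigma_finite.

End cons_measure.


Section power_measure.
Context d (T : measurableType d) (R : realType).
Variable m : {sigma_finite_measure set T -> \bar R}.

Fixpoint power_measure n : {sigma_finite_measure set n.-tuple T -> \bar R} :=
  if n is k.+1 then cons_measure m (power_measure k)
  else @dirac _ (0.-tuple T) [tuple] R.

End power_measure.
(* Lebesgue measure on R^n, carried by n-tuples, which the library equips with
   the product sigma-algebra; [vec] transports points to the row vectors on
   which the topology and the differential calculus live. *)
Definition lebesgue_Rn (R : realType) n :
    {measure set n.-tuple (measurableTypeR R) -> \bar R} :=
  power_measure (@lebesgue_measure R) n.

Definition vec (R : realType) n (t : n.-tuple (measurableTypeR R)) : 'rV[R]_n :=
  \row_i tnth t i.
Arguments vec {R n}.

Definition integral_Rn (R : realType) n (U : set 'rV[R]_n) (f : 'rV[R]_n -> R) :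
    \bar R :=
  (\int[lebesgue_Rn R n]_(t in vec @^-1` U) (f (vec t))%:E)%E.

Section metric.
Context (R : realType) (n : nat).
Implicit Types (A : set 'rV[R]_n) (x y c : 'rV[R]_n).

(* The library norm on 'rV[R]_n is the maximum norm. *)
Definition enorm x : R := Num.sqrt (\sum_i x 0 i ^+ 2).

Definition diam A : R :=
  sup [set d | exists x y, [/\ A x, A y & d = enorm (x - y)]].

Definition boundary A := closure A `\` interior A.

(* For every point x of A, the convex hull of x and of the ball B(c, rho) lies
   in A. *)
Definition star_shaped_wrt_ball A c (rho : R) :=
  forall x y (s : R), A x -> enorm (y - c) < rho -> 0 <= s <= 1 ->
    A (s *: x + (1 - s) *: y).

Definition chunkiness A : R :=
  diam A / sup [set rho | 0 < rho /\ exists c, star_shaped_wrt_ball A c rho].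

Definition domain (D : set 'rV[R]_n) := [/\ open D, connected D & D !=set0].

End metric.

Section sobolev.
Context (R : realType) (n : nat).
Implicit Types (U : set 'rV[R]_n) (u g phi : 'rV[R]_n -> R) (a : 'I_n -> nat).

Definition pderive (i : 'I_n) phi : 'rV[R]_n -> R :=
  fun x => 'D_(delta_mx 0 i) phi x.

Definition pderives (s : seq 'I_n) phi := foldr pderive phi s.

Definition morder a : nat := (\sum_i a i)%N.

Definition mderive a phi :=
  pderives (flatten [seq nseq (a i) i | i <- enum 'I_n]) phi.

Definition smooth phi := forall s : seq 'I_n,
  continuous (pderives s phi) /\
  forall i x, derivable (pderives s phi) x (delta_mx 0 i).

Definition test_fun U phi := smooth phi /\
  exists K, [/\ compact K, K `<=` U & forall x, ~ K x -> phi x = 0].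

Definition L2 U u :=
  measurable_fun (vec @^-1` U) (fun t => u (vec t)) /\
  (integral_Rn U (fun x => u x ^+ 2)%R < +oo)%E.

Definition weak_deriv U a u g := forall phi, test_fun U phi ->
  integral_Rn U (fun x => u x * mderive a phi x) =
  (((-1) ^+ morder a)%:E * integral_Rn U (fun x => g x * phi x)%R)%E.

Definition sobolev (m : nat) U u := L2 U u /\
  forall a, (morder a <= m)%N -> exists2 g, L2 U g & weak_deriv U a u g.

(* |u|_{m,U}^2. Weak derivatives are unique almost everywhere, so for u in
   H^m(U) the infimum is that of a singleton; it is +oo if u is not in H^m(U). *)
Definition sobolev_seminorm2 (m : nat) U u : \bar R :=
  ereal_inf [set s | exists g : {ffun 'I_n -> 'I_m.+1} -> 'rV[R]_n -> R,
    [/\ sobolev m U u,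
        forall b : {ffun 'I_n -> 'I_m.+1}, morder (fun i => b i) = m ->
          L2 U (g b) /\ weak_deriv U (fun i => b i) u (g b) &
        s = (\sum_(b : {ffun 'I_n -> 'I_m.+1} | morder (fun i => b i) == m)
               integral_Rn U (fun x => g b x ^+ 2)%R)%E]].

End sobolev.

Section simplices.
Context (R : realType) (n : nat).

(* The rows of A : 'M_(k, n) are the vertices of a (k-1)-simplex of R^n. *)
Definition simplex k (A : 'M[R]_(k, n)) : set 'rV[R]_n :=
  [set x | exists w : 'rV[R]_k,
    [/\ forall i, 0 <= w 0 i, \sum_i w 0 i = 1 & x = w *m A]].

Definition osimplex k (A : 'M[R]_(k, n)) : set 'rV[R]_n :=
  [set x | exists w : 'rV[R]_k,
    [/\ forall i, 0 < w 0 i, \sum_i w 0 i = 1 & x = w *m A]].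

Definition affinely_independent k (A : 'M[R]_(k, n)) :=
  row_free (row_mx A (const_mx 1 : 'cV[R]_k)).

(* the face of A spanned by the vertices it shares with B *)
Definition common_face k (A B : 'M[R]_(k, n)) : set 'rV[R]_n :=
  [set x | exists w : 'rV[R]_k,
    [/\ forall i, 0 <= w 0 i, \sum_i w 0 i = 1, x = w *m A &
        forall i, w 0 i != 0 -> exists j, row i A = row j B]].

(* Affine chart of the hyperplane through the k points of F, by the barycentric
   coordinates of all the points but the last one. *)
Definition chart k (F : 'M[R]_(k, n)) (t : k.-1.-tuple (measurableTypeR R)) :
    'rV[R]_n :=
  (\row_(i < k) nth (1 - \sum_(s <- t) (s : R)) t i) *m F.

Definition chart_jacobian k (F : 'M[R]_(k, n)) : 'M[R]_(k.-1, n) :=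
  \matrix_(i < k.-1) (chart F [tuple (i == j)%:R | j < k.-1] -
                      chart F [tuple 0 | j < k.-1]).

(* ||f||_{0,S}^2 for the surface measure, where S lies in the affine hull of the
   points of F *)
Definition surface_L2norm2 k (F : 'M[R]_(k, n)) (S : set 'rV[R]_n)
    (f : 'rV[R]_n -> R) : \bar R :=
  let J := chart_jacobian F in
  ((Num.sqrt (\det (J *m J^T)))%:E *
   \int[lebesgue_Rn R k.-1]_(t in chart F @^-1` S) ((f (chart F t)) ^+ 2)%:E)%E.

End simplices.

Record mesh (R : realType) (n : nat) := Mesh {
  mesh_size : nat ;
  mesh_elt :> 'I_mesh_size -> 'M[R]_(n.+1, n) ;
  mesh_nondegenerate : forall i, affinely_independent (mesh_elt i) ;
  mesh_disjoint : forall i j, i != j ->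
    osimplex (mesh_elt i) `&` osimplex (mesh_elt j) = set0 ;
  mesh_conforming : forall i j,
    simplex (mesh_elt i) `&` simplex (mesh_elt j) =
    common_face (mesh_elt i) (mesh_elt j) }.

Section meshes.
Context (R : realType) (n : nat).
Implicit Types (T : mesh R n) (Gamma : set 'rV[R]_n).

Definition mesh_cover T : set 'rV[R]_n := \bigcup_i simplex (T i).

(* The open elements are contained in K and the closed ones cover it: K is
   determined by T up to points of the boundaries of the elements, in
   particular K may be open or closed relative to D. *)
Definition triangulates T (K : set 'rV[R]_n) :=
  (forall i, osimplex (T i) `<=` K) /\ K `<=` mesh_cover T.

Definition elt_diam T (i : 'I_(mesh_size T)) : R := diam (simplex (T i)).

Definition shape_regular (sigma : R) T :=
  forall i, chunkiness (simplex (T i)) <= sigma.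

Definition touches T Gamma (i : 'I_(mesh_size T)) : Prop :=
  simplex (T i) `&` Gamma !=set0.

Definition iface_diam T Gamma : R :=
  \big[Num.max/0]_(i | `[< touches (T := T) Gamma i >]) elt_diam i.

Definition quasi_uniform_at (nu : R) T Gamma :=
  forall i : 'I_(mesh_size T), touches Gamma i ->
    nu * iface_diam T Gamma <= elt_diam i.

(* The face (i, j) is the facet of the i-th element opposite to its j-th
   vertex. *)
Definition face T : finType := ('I_(mesh_size T) * 'I_n.+1)%type.

Definition face_vert T (f : face T) : 'M[R]_(n, n) := row' f.2 (T f.1).

Definition oface T (f : face T) := osimplex (face_vert f).

(* A face is on Gamma if its relative interior meets Gamma; when the mesh
   resolves Gamma this amounts to its lying in the closure of Gamma. It is then
   a facet of a single element, so that no face is counted twice. *)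
Definition face_on T Gamma (f : face T) : Prop := oface f `&` Gamma !=set0.

Definition iface_grid T Gamma : set (set 'rV[R]_n) :=
  [set oface f | f in [set f : face T | face_on Gamma f]].

Section cap_grid.
Context (T1 T2 : mesh R n) (Gamma : set 'rV[R]_n).

Definition cap_face (p : face T1 * face T2) := oface p.1 `&` oface p.2.

(* As the faces are relatively open, e `&` E is nonempty precisely when the
   intersection of the closed faces is nondegenerate of dimension n - 1. *)
Definition cap_on (p : face T1 * face T2) : Prop :=
  [/\ face_on Gamma p.1, face_on Gamma p.2 & cap_face p !=set0].

Definition cap_grid : set (set 'rV[R]_n) := [set cap_face p | p in cap_on].

End cap_grid.

Definition poly_fun (r : nat) (p : 'rV[R]_n -> R) :=
  exists c : {ffun 'I_n -> 'I_r.+1} -> R, forall x,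
    p x = \sum_(b : {ffun 'I_n -> 'I_r.+1} | (morder (fun i => b i) <= r)%N)
            c b * \prod_i x 0 i ^+ b i.

(* The functions are extended by 0 outside the closure of the triangulated
   region, so that a finite element function has a single representative. *)
Definition lagrange_space (r : nat) T : set ('rV[R]_n -> R^o) :=
  [set v | [/\ {within mesh_cover T, continuous v},
    forall i, exists2 p, poly_fun r p & {in simplex (T i), v =1 p} &
    forall x, ~ mesh_cover T x -> v x = 0]].

Definition fe_pair : lmodType R :=
  (('rV[R]_n -> R^o) * ('rV[R]_n -> R^o))%type.

Definition fe_space (r : nat) (T1 T2 : mesh R n) : set fe_pair :=
  lagrange_space r T1 `*` lagrange_space r T2.

(* the function on D that the pair (v_1, v_2) stands for *)
Definition glue_fun (K1 : set 'rV[R]_n) (v : fe_pair) : 'rV[R]_n -> R :=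
  fun x => if x \in K1 then v.1 x else v.2 x.

Definition jump (v : fe_pair) : 'rV[R]_n -> R := fun x => v.1 x - v.2 x.

Definition weighted_seminorm2 T Gamma (m : nat) (f : 'rV[R]_n -> R) : \bar R :=
  (\sum_(i | `[< touches (T := T) Gamma i >])
     (@elt_diam T i ^ (2 * m%:Z - 2))%:E *
     sobolev_seminorm2 m (osimplex (T i)) f)%E.

(* h_e is the diameter of the adjacent element of T1 *)
Definition jump_energy (T1 T2 : mesh R n) Gamma (v : fe_pair) : \bar R :=
  (\sum_(p : face T1 * face T2 | `[< cap_on Gamma p >])
     (elt_diam p.1.1)^-1%:E *
     surface_L2norm2 (face_vert p.1) (cap_face p) (jump v))%E.

End meshes.

(* Main.v *)
(* E v keeps v_2 and replaces v_1 by the Lagrange interpolant, on the mesh of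
   K1, of the data v_2 at the nodes lying on a face on Gamma and v_1 at the other
   nodes. On a face on Gamma both traces are polynomials, since that face lies
   in a face of the coarse mesh, so they agree as soon as they agree at the
   nodes; hence E v is continuous and piecewise polynomial, so it is in H^1(D).
   On an element, v - E v is a combination of nodal basis functions weighted by
   the jumps at the nodes on Gamma. Scaling bounds its seminorms by these nodal
   values; equivalence of norms on polynomials over a face bounds the latter by
   the L^2 norm of the jump, with the same power of the mesh size by
   quasi-uniformity. Finally, quasi-uniformity and shape regularity bound the
   number of elements near Gamma that meet a given one. *)
Require Import Defs.
From HB Require Import structures.
From mathcomp Require Import all_boot all_order all_algebra.
From mathcomp Require Import all_classical all_reals all_analysis.
From mathcomp Require Import perm measurable_realfun.
From mathcomp Require Import ring lra zify.

Set Implicit Arguments.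
Unset Strict Implicit.
Unset Printing Implicit Defensive.

Import Order.TTheory GRing.Theory Num.Theory.
Import numFieldNormedType.Exports.

Local Open Scope classical_set_scope.
Local Open Scope ring_scope.

(** * Lagrange interpolation on the principal lattice *)

(** Only the fine side is changed, so the coarse elements contribute nothing to the left-hand side
    and the coarse mesh size cannot enter the constant. The interface is defined topologically and
    an element may touch it in a single vertex. Two obstacles follow: [E v] must agree with [v.2] at
    every point of the interface, which requires that the closed faces on it cover it; and a changed
    node of an element may lie on a face of another element, so jumps have to be charged to
    neighbours. All scaling is carried by the gradients of the barycentric coordinates, which an
    inscribed ball bounds: they control the derivatives of the nodal basis, and the surface Jacobian
    of a face is computed from them, the surface integral being by definition one over a fixed
    parameter domain. Interpolation rests on an identity of binomial coefficients valid for any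
    finite family of points, so that elements, faces and common faces of two elements are treated
    alike. Membership in $H^1(D)$ is obtained from difference quotients on all of $D$ at once, so
    that element boundaries produce no terms to cancel. *)

Section binomial_poly.
Context (R : realType).

(** The binomial coefficient at a real argument. Products of these, taken at [r] times the
    barycentric coordinates, are the Lagrange basis of the principal lattice. *)
Definition bin_poly (x : R) (k : nat) : R := \prod_(l < k) ((x - l%:R) / l.+1%:R).

Lemma bin_polyS x k : bin_poly x k.+1 = bin_poly x k * ((x - k%:R) / k.+1%:R).
Proof. by rewrite /bin_poly big_ord_recr. Qed.

(** The absorption identity: a factor equal to the lattice index is traded for a shift of the
    lattice. *)
Lemma mul_bin_poly x k : k.+1%:R * bin_poly x k.+1 = x * bin_poly (x - 1) k.
Proof.
elim: k => [|k IH]; first by rewrite /bin_poly big_ord1 big_ord0 subr0 divr1 mul1r mulr1.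
rewrite bin_polyS [in RHS]bin_polyS mulrA [RHS]mulrA -IH.
have k1 : k.+1%:R != 0 :> R by rewrite pnatr_eq0.
have k2 : k.+2%:R != 0 :> R by rewrite pnatr_eq0.
rewrite (_ : x - 1 - k%:R = x - k.+1%:R); last by rewrite -[k.+1]addn1 natrD; ring.
by move: (k.+1%:R) (k.+2%:R) k1 k2 => u v u0 v0; field; rewrite u0 v0.
Qed.

End binomial_poly.

Section polyd.
Context (R : realType) (J : finType).
Implicit Types (f g : (J -> R) -> R) (x : J -> R).

(** Polynomials of degree at most [r] in nested form, which exposes the factors [x j] that an
    induction on the degree removes. *)
Fixpoint polyd r f : Prop :=
  if r is r'.+1 then exists (c : R) (g : J -> (J -> R) -> R), (forall j, polyd r' (g j)) /\
    forall x, f x = c + \sum_j x j * g j x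
  else exists c : R, forall x, f x = c.

Lemma polyd_cst r c : polyd r (fun=> c).
Proof.
elim: r c => [|r IH] c /=; first by exists c.
exists c, (fun _ _ => 0); split => // x.
by rewrite big1 ?addr0// => j _; rewrite mulr0.
Qed.

Lemma polydW r f : polyd r f -> polyd r.+1 f.
Proof.
elim: r f => [|r IH] f /=.
  move=> [c fc]; exists c, (fun _ _ => 0); split => [_|x]; first by exists 0.
  by rewrite big1 ?addr0// => j _; rewrite mulr0.
move=> [c [g [gr fE]]]; exists c, g; split => // j; exact/IH/gr.
Qed.

Lemma polyd_le r s f : (r <= s)%N -> polyd r f -> polyd s f.
Proof.
move=> /subnK <-; elim: (s - r)%N => [//|k IH] fr.
by rewrite addSn; exact/polydW/IH.
Qed.

Lemma polydD r f g : polyd r f -> polyd r g -> polyd r (fun x => f x + g x).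
Proof.
elim: r f g => [|r IH] f g /=.
  by move=> [c fc] [d gd]; exists (c + d) => x; rewrite fc gd.
move=> [c [f' [fr fE]]] [d [g' [gr gE]]].
exists (c + d), (fun j x => f' j x + g' j x); split => [j|x]; first exact: IH.
rewrite fE gE addrACA -big_split/=; congr (_ + _).
by apply: eq_bigr => j _; rewrite mulrDr.
Qed.

Lemma polyd_sum r (I : Type) (s : seq I) (P : pred I) (F : I -> (J -> R) -> R) :
  (forall i, P i -> polyd r (F i)) -> polyd r (fun x => \sum_(i <- s | P i) F i x).
Proof.
move=> Fr; elim: s => [|i s IH].
  rewrite (_ : (fun _ => _) = fun=> 0); first exact: polyd_cst.
  by apply/funext => x; rewrite big_nil.
case: (boolP (P i)) => Pi.
  rewrite (_ : (fun _ => _) = fun x => F i x + \sum_(i <- s | P i) F i x).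
    exact/polydD/IH/Fr.
  by apply/funext => x; rewrite big_cons Pi.
rewrite (_ : (fun _ => _) = fun x => \sum_(i <- s | P i) F i x)//.
by apply/funext => x; rewrite big_cons (negbTE Pi).
Qed.

Lemma polydZ r k f : polyd r f -> polyd r (fun x => k * f x).
Proof.
elim: r f => [|r IH] f /=; first by move=> [c fc]; exists (k * c) => x; rewrite fc.
move=> [c [f' [fr fE]]].
exists (k * c), (fun j x => k * f' j x); split => [j|x]; first exact: IH.
rewrite fE mulrDr mulr_sumr; congr (_ + _); apply: eq_bigr => j _; ring.
Qed.

Lemma polyd_mul_linear r (c : J -> R) f : polyd r f ->
  polyd r.+1 (fun x => (\sum_j c j * x j) * f x).
Proof.
move=> fr; exists 0, (fun j x => c j * f x); split => [j|x]; first exact: polydZ.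
rewrite add0r mulr_suml; apply: eq_bigr => j _; ring.
Qed.

Lemma polyd_shift r (y : J -> R) f : polyd r f -> polyd r (fun x => f (fun j => x j + y j)).
Proof.
elim: r f => [|r IH] f; first by move=> [c fc]; exists c.
move=> [c [f' [fr fE]]].
rewrite (_ : (fun _ => _) = fun x => (c + \sum_j x j * f' j (fun j => x j + y j))
    + \sum_j y j * f' j (fun j => x j + y j)); last first.
  apply/funext => x; rewrite fE -addrA -big_split/=; congr (_ + _).
  by apply: eq_bigr => j _; rewrite mulrDl.
apply: polydD.
  exists c, (fun j x => f' j (fun j => x j + y j)); split => [j|x]; last by [].
  exact: IH (fr j).
by apply: polyd_sum => j _; apply: polydW; apply: polydZ; exact: IH (fr j).
Qed.

End polyd.

Section lattice.
Context (R : realType) (J : finType) (N : nat).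
Implicit Types (a : {ffun J -> 'I_N.+1}).

Definition msize a := (\sum_j a j)%N.

Lemma msize_ge a j : (a j <= msize a)%N.
Proof. by rewrite /msize (bigD1 j)//= leq_addr. Qed.

Definition mset a j (k : nat) : {ffun J -> 'I_N.+1} :=
  [ffun i => if i == j then inord k else a i].

Definition mbin (x : J -> R) a : R := \prod_j bin_poly (x j) (a j).

Lemma mset_id a j k : (a j = k :> nat) -> mset a j k = a.
Proof.
move=> ajk; apply/ffunP => i; rewrite ffunE; case: eqP => // ->.
by rewrite -ajk inord_val.
Qed.

Lemma mset_mset a j k l : mset (mset a j k) j l = mset a j l.
Proof. by apply/ffunP => i; rewrite !ffunE; case: eqP. Qed.

(** An overflowing [inord] falls back to [ord0], so a nonzero entry certifies that the increment
    stayed in range. *)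
Lemma mset_succ_neq0 a j : mset a j (a j).+1 j != ord0 -> (a j < N)%N.
Proof.
rewrite ffunE eqxx => a0; rewrite ltnNge; apply: contra a0 => Na.
by rewrite /inord /insubd insubF//; apply/negbTE; rewrite -leqNgt.
Qed.

Lemma mset_size a j k : (k <= N)%N -> (msize (mset a j k) + a j = msize a + k)%N.
Proof.
move=> kN; rewrite /msize (bigD1 j)//= [in RHS](bigD1 j)//= ffunE eqxx inordK//.
rewrite (eq_bigr (fun i => nat_of_ord (a i))); first by rewrite addnC -addnA [(k + _)%N]addnC.
by move=> i /negbTE ij; rewrite ffunE ij.
Qed.

(** Indices with [a j = 0] contribute nothing; the others are the successors in direction [j] of the
    indices of size [r], and the absorption identity extracts [x j]. The bound [N] on the entries is
    kept apart from the size, so that both sums range over the same type. *)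
Lemma sum_mbin_pred (g : {ffun J -> 'I_N.+1} -> R) (x : J -> R) j r : (r.+1 <= N)%N ->
  \sum_(a : {ffun J -> 'I_N.+1} | msize a == r.+1) ((a j : nat)%:R * g a) * mbin x a =
  x j * \sum_(a : {ffun J -> 'I_N.+1} | msize a == r)
          g (mset a j (a j).+1) * mbin (fun i => x i - (i == j)%:R) a.
Proof.
move=> rN.
rewrite (bigID (fun a : {ffun J -> 'I_N.+1} => a j == ord0))/= big1 ?add0r; last first.
  by move=> a /andP[_ /eqP ->]; rewrite !mul0r.
rewrite mulr_sumr.
rewrite (reindex_onto (fun a => mset a j (a j).+1) (fun a => mset a j (a j).-1))/=; last first.
  move=> a /andP[/eqP sa aj0].
  have ajN := ltn_ord (a j).
  have aj_gt0 : (0 < a j)%N by rewrite lt0n; apply: contra aj0 => /eqP H; apply/eqP/val_inj.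
  rewrite mset_mset ffunE eqxx inordK ?prednK ?mset_id//; lia.
apply: eq_big => [a|a].
  apply/idP/idP; last first.
    move=> /eqP sa; have := msize_ge a j => ajr.
    have ajN : ((a j).+1 <= N)%N by lia.
    have := mset_size a j ajN => /eqP; rewrite addnS -addSn eqn_add2r => /eqP E.
    rewrite E sa eqxx/= ffunE eqxx mset_mset inordK//= mset_id// eqxx andbT.
    by rewrite -(inj_eq val_inj)/= inordK.
  move=> /andP[/andP[/eqP sa aj0] /eqP aE].
  have ajN := mset_succ_neq0 aj0.
  have := mset_size a j ajN; rewrite sa addnS -addSn => /addIn[->]//.
move=> /andP[/andP[/eqP sa aj0] /eqP aE].
have ajr := msize_ge (mset a j (a j).+1) j.
have ajN := mset_succ_neq0 aj0.
rewrite ffunE eqxx inordK//= /mbin (bigD1 j)//= [in RHS](bigD1 j)//= ffunE eqxx inordK//=.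
rewrite (eq_bigr (fun i => bin_poly (x i - (i == j)%:R) (a i))); last first.
  by move=> i /negbTE ij; rewrite ffunE ij subr0.
by rewrite mulrAC !mulrA mul_bin_poly; ring.
Qed.

(* On the hyperplane where the coordinates sum to r, a polynomial of degree r is
   a combination of products x_j g_j with g_j of degree r - 1; multiplying the
   interpolant of g_j by x_j shifts the lattice by one step in direction j. *)
Lemma lattice_interp r (f : (J -> R) -> R) (x : J -> R) : (r <= N)%N ->
  polyd r f -> \sum_j x j = r%:R ->
  \sum_(a : {ffun J -> 'I_N.+1} | msize a == r) f (fun j => (a j : nat)%:R) * mbin x a = f x.
Proof.
elim: r f x => [|r IH] f x rN.
  move=> [c fc] _; rewrite (big_pred1 [ffun=> ord0])/=; last first.
    move=> a; apply/idP/eqP => [|->]; last by rewrite /msize big1// => j _; rewrite ffunE.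
    rewrite /msize sum_nat_eq0 => /forallP a0; apply/ffunP => j; rewrite ffunE.
    by apply/val_inj/eqP; exact: a0.
  by rewrite !fc /mbin big1 ?mulr1// => j _; rewrite ffunE /bin_poly big_ord0.
move=> [c [g [gr fE]]] sx.
(* Where the coordinates sum to [r.+1], the constant [c] is the sum of the [x j * (c / r.+1)], so
   the [g j] can absorb it. *)
pose G j y := c / r.+1%:R + g j y.
have fG y : \sum_j y j = r.+1%:R -> f y = \sum_j y j * G j y.
  move=> sy; rewrite fE /G; under [RHS]eq_bigr do rewrite mulrDr.
  by rewrite big_split/= -mulr_suml sy mulrC mulfVK ?pnatr_eq0.
rewrite fG// (eq_bigr (fun a => \sum_j ((a j : nat)%:R * G j (fun i => (a i : nat)%:R)) * mbin x a)).
  rewrite exchange_big/=; apply: eq_bigr => j _.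
  rewrite (sum_mbin_pred (fun a => G j (fun i => (a i : nat)%:R)))//; congr (_ * _).
  (* The shifted lattice has size [r]: the induction hypothesis is applied to the translate of [G j]
     at the point moved back by one unit, whose coordinates sum to [r]. *)
  pose G' y := G j (fun i => y i + (i == j)%:R).
  rewrite (_ : G j x = G' (fun i => x i - (i == j)%:R)); last first.
    by rewrite /G'; congr (G j _); apply/funext => i; rewrite subrK.
  rewrite -IH; last 3 first.
  - exact: ltnW.
  - apply: (polyd_shift (fun i => (i == j)%:R) (f := G j)).
    by apply: polydD; [exact: polyd_cst|exact: gr].
  - rewrite sumrB sx (bigD1 j)//= eqxx big1 ?addr0; last by move=> i /negbTE ->.
    by rewrite -[r.+1]addn1 natrD addrK.
  apply: eq_bigr => a /eqP sa; congr (_ * _); rewrite /G'; congr (G j _).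
  apply/funext => i; rewrite ffunE; case: eqP => [->|_]; last by rewrite addr0.
  have := msize_ge a j => aj.
  by rewrite inordK ?natr1// ltnS; apply: leq_ltn_trans rN; rewrite -sa.
by move=> a /eqP sa; rewrite fG ?mulr_suml// -sa -natr_sum.
Qed.

End lattice.

(** * Polynomials in the monomial basis *)

Section poly_fun.
Context (R : realType) (n : nat).
Implicit Types (p q : 'rV[R]_n -> R) (x : 'rV[R]_n).

Lemma poly_funD r p q : poly_fun r p -> poly_fun r q -> poly_fun r (fun x => p x + q x).
Proof.
move=> [c pc] [d qd]; exists (fun b => c b + d b) => x.
by rewrite pc qd -big_split/=; apply: eq_bigr => b _; rewrite mulrDl.
Qed.

Lemma poly_funZ r k p : poly_fun r p -> poly_fun r (fun x => k * p x).
Proof.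
move=> [c pc]; exists (fun b => k * c b) => x.
by rewrite pc mulr_sumr; apply: eq_bigr => b _; rewrite mulrA.
Qed.

Lemma poly_fun0 r : poly_fun r ((fun=> 0) : 'rV[R]_n -> R).
Proof. by exists (fun=> 0) => x; rewrite big1// => b _; rewrite mul0r. Qed.

Lemma poly_fun_sum r (I : Type) (s : seq I) (P : pred I) (F : I -> 'rV[R]_n -> R) :
  (forall i, P i -> poly_fun r (F i)) -> poly_fun r (fun x => \sum_(i <- s | P i) F i x).
Proof.
move=> Fr; elim: s => [|i s IH].
  rewrite (_ : (fun _ => _) = fun=> 0); first exact: poly_fun0.
  by apply/funext => x; rewrite big_nil.
case: (boolP (P i)) => Pi.
  rewrite (_ : (fun _ => _) = fun x => F i x + \sum_(i <- s | P i) F i x).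
    exact/poly_funD/IH/Fr.
  by apply/funext => x; rewrite big_cons Pi.
rewrite (_ : (fun _ => _) = fun x => \sum_(i <- s | P i) F i x)//.
by apply/funext => x; rewrite big_cons (negbTE Pi).
Qed.

Lemma poly_fun_monomial r (a : 'I_n -> nat) : (morder a <= r)%N ->
  poly_fun r (fun x : 'rV[R]_n => \prod_i x 0 i ^+ a i).
Proof.
move=> ar; pose b0 : {ffun 'I_n -> 'I_r.+1} := [ffun i => inord (a i)].
have b0E i : b0 i = a i :> nat.
  rewrite ffunE inordK// ltnS; apply: leq_trans ar.
  by rewrite /morder (bigD1 i)//= leq_addr.
have b0r : (morder (fun i => b0 i) <= r)%N.
  by rewrite (_ : (fun _ => _) = a)//; apply/funext => i; exact: b0E.
exists (fun b => (b == b0)%:R) => x.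
rewrite [RHS](bigD1 b0)//= eqxx mul1r [X in _ + X]big1 ?addr0; last first.
  by move=> b /andP[_ /negbTE ->]; rewrite mul0r.
by apply: eq_bigr => i _; rewrite b0E.
Qed.

Lemma poly_fun_mulX r k p : poly_fun r p -> poly_fun r.+1 (fun x => x 0 k * p x).
Proof.
move=> [c pc].
rewrite (_ : (fun _ => _) = fun x => \sum_(b : {ffun 'I_n -> 'I_r.+1} |
    (morder (fun i => b i) <= r)%N) c b * \prod_i x 0 i ^+ (b i + (i == k))); last first.
  apply/funext => x; rewrite pc mulr_sumr; apply: eq_bigr => b _.
  rewrite mulrCA; congr (_ * _); rewrite (bigD1 k)//= [RHS](bigD1 k)//= eqxx addn1 exprS.
  rewrite mulrA; congr (_ * _); apply: eq_bigr => i /negbTE ->.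
  by rewrite addn0.
apply: poly_fun_sum => b br; apply: poly_funZ.
apply: (@poly_fun_monomial _ (fun i => b i + (i == k))%N).
rewrite /morder big_split/= -[in leqRHS]addn1 leq_add//.
by rewrite (bigD1 k)//= eqxx big1// => i /negbTE ->.
Qed.

Lemma poly_funW r p : poly_fun r p -> poly_fun r.+1 p.
Proof.
move=> [c pc]; rewrite (_ : p = fun x => \sum_(b : {ffun 'I_n -> 'I_r.+1} |
    (morder (fun i => b i) <= r)%N) c b * \prod_i x 0 i ^+ b i); last exact/funext.
apply: poly_fun_sum => b br; apply: poly_funZ.
by apply: (@poly_fun_monomial _ (fun i => nat_of_ord (b i))); exact: leqW.
Qed.

Lemma poly_fun_le r s p : (r <= s)%N -> poly_fun r p -> poly_fun s p.
Proof.
move=> /subnK <-; elim: (s - r)%N => [//|k IH] pr.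
by rewrite addSn; exact/poly_funW/IH.
Qed.

End poly_fun.

(* Polynomials as linear combinations of products of affine functions: the
   derivatives stay within the affine factors of the original expression, which
   makes them easy to bound. *)
Section affine_product.
Context (R : realType) (n : nat).

Definition aff : Type := ('rV[R]_n * R)%type.
Implicit Types (l : aff) (t : seq aff) (P : seq (R * seq aff)) (x : 'rV[R]_n).

Definition aff_eval l x : R := \sum_k l.1 0 k * x 0 k + l.2.
Definition aff_prod t x : R := \prod_(l <- t) aff_eval l x.
Definition sp_eval P x : R := \sum_(q <- P) q.1 * aff_prod q.2 x.

Fixpoint prod_deriv i (c : R) t : seq (R * seq aff) :=
  if t is l :: t' then (c * l.1 0 i, t') :: [seq (q.1, l :: q.2) | q <- prod_deriv i c t']
  else [::].

Definition sp_deriv i P := flatten [seq prod_deriv i q.1 q.2 | q <- P].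

Definition sp_all (N : nat) (Q : aff -> Prop) P :=
  forall q, q \in P -> (size q.2 <= N)%N /\ forall l, l \in q.2 -> Q l.

Definition sp_norm P : R := \sum_(q <- P) `|q.1|.

Lemma sp_eval_cons q P x : sp_eval (q :: P) x = q.1 * aff_prod q.2 x + sp_eval P x.
Proof. by rewrite /sp_eval big_cons. Qed.

Lemma sp_eval_cat P P' x : sp_eval (P ++ P') x = sp_eval P x + sp_eval P' x.
Proof. by rewrite /sp_eval big_cat. Qed.

Lemma sp_allW N Q P q : sp_all N Q (q :: P) -> sp_all N Q P.
Proof. by move=> H q' q'P; apply: H; rewrite inE q'P orbT. Qed.

Lemma prod_deriv_all i c t q : q \in prod_deriv i c t ->
  (size q.2 <= size t)%N /\ {subset q.2 <= t}.
Proof.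
elim: t q => [//|l t IH] q /=; rewrite inE => /orP[/eqP ->/=|/mapP[q' /IH[s sub] -> /=]].
  by split => // l' l't; rewrite inE l't orbT.
split=> // l'; rewrite !inE => /orP[->//|/sub ->]; by rewrite orbT.
Qed.

Lemma sp_deriv_all N Q i P : sp_all N Q P -> sp_all N Q (sp_deriv i P).
Proof.
move=> PQ q /flattenP[s /mapP[q' q'P ->]] /prod_deriv_all[sq subq].
have [sN Ql] := PQ _ q'P; split; first exact: leq_trans sN.
by move=> l /subq /Ql.
Qed.

Lemma prod_deriv_norm i (G c : R) t : 0 <= G -> (forall l, l \in t -> `|l.1 0 i| <= G) ->
  sp_norm (prod_deriv i c t) <= (size t)%:R * G * `|c|.
Proof.
move=> G0; elim: t => [|l t IH] tG; first by rewrite /sp_norm big_nil !mul0r.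
rewrite /sp_norm /= big_cons big_map/= -natr1 !mulrDl mul1r [leRHS]addrC lerD//.
  by rewrite normrM mulrC ler_wpM2r// tG// inE eqxx.
by apply: IH => l' l't; apply: tG; rewrite inE l't orbT.
Qed.

Lemma sp_deriv_norm N (Q : aff -> Prop) i (G : R) P : 0 <= G ->
  (forall l, Q l -> `|l.1 0 i| <= G) -> sp_all N Q P ->
  sp_norm (sp_deriv i P) <= N%:R * G * sp_norm P.
Proof.
move=> G0 QG; elim: P => [|q P IH] PQ; first by rewrite /sp_norm !big_nil mulr0.
rewrite /sp_norm /= big_cat/= big_cons mulrDr lerD//; last exact/IH/sp_allW/PQ.
have [sN Ql] := PQ q (mem_head _ _).
apply: le_trans (prod_deriv_norm _ G0 _) _; first by move=> l /Ql; exact: QG.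
by rewrite ler_wpM2r// ler_wpM2r// ler_nat.
Qed.

Lemma sp_eval_le N (Q : aff -> Prop) (B : R) P x : 1 <= B ->
  (forall l, Q l -> `|aff_eval l x| <= B) -> sp_all N Q P ->
  `|sp_eval P x| <= sp_norm P * B ^+ N.
Proof.
move=> B1 QB; elim: P => [|q P IH] PQ; first by rewrite /sp_eval /sp_norm !big_nil mul0r normr0.
rewrite sp_eval_cons /sp_norm big_cons mulrDl.
apply: le_trans (ler_normD _ _) _; rewrite lerD//; last exact/IH/sp_allW/PQ.
have [sN Ql] := PQ q (mem_head _ _).
rewrite normrM ler_wpM2l//; apply: (@le_trans _ _ (B ^+ size q.2)); last exact: ler_weXn2l.
elim: q.2 Ql => [|l t IHt] Ql; first by rewrite /aff_prod big_nil normr1.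
rewrite /aff_prod big_cons normrM exprS ler_pM//.
  by apply: QB; apply: Ql; rewrite inE eqxx.
by apply: IHt => l' l't; apply: Ql; rewrite inE l't orbT.
Qed.

Lemma aff_eval_lip (G : R) l x y : (forall i, `|l.1 0 i| <= G) ->
  `|aff_eval l x - aff_eval l y| <= G * \sum_i `|x 0 i - y 0 i|.
Proof.
move=> lG; rewrite /aff_eval opprD addrACA subrr addr0 -sumrB mulr_sumr.
apply: le_trans (ler_norm_sum _ _ _) _; apply: ler_sum => i _.
by rewrite -mulrBr normrM ler_wpM2r.
Qed.

Lemma aff_prod_lip (B G : R) t x y : 1 <= B -> 0 <= G ->
  (forall l, l \in t -> [/\ forall i, `|l.1 0 i| <= G, `|aff_eval l x| <= B & `|aff_eval l y| <= B]) ->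
  `|aff_prod t x - aff_prod t y| <= (size t)%:R * G * B ^+ size t * \sum_i `|x 0 i - y 0 i|.
Proof.
move=> B1 G0; set d := \sum_i _; have d0 : 0 <= d by exact: sumr_ge0.
have B0 : 0 <= B by exact: le_trans B1.
elim: t => [|l t IH] tB; first by rewrite /aff_prod !big_nil subrr normr0 !mul0r.
have tB' l' : l' \in t -> [/\ forall i, `|l'.1 0 i| <= G, `|aff_eval l' x| <= B & `|aff_eval l' y| <= B].
  by move=> l't; apply: tB; rewrite inE l't orbT.
have [lG lx ly] := tB l (mem_head _ _).
have tx : `|aff_prod t x| <= B ^+ size t.
  have := @sp_eval_le (size t) (fun l => l \in t) B [:: (1, t)] x B1.
  rewrite /sp_eval /sp_norm !big_seq1/= normr1 !mul1r; apply.
    by move=> l' /tB'[].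
  by move=> q; rewrite inE => /eqP ->.
rewrite /aff_prod !big_cons -!/(aff_prod _ _)/=.
rewrite (_ : _ - _ = (aff_eval l x - aff_eval l y) * aff_prod t x +
   aff_eval l y * (aff_prod t x - aff_prod t y)); last by ring.
apply: le_trans (ler_normD _ _) _; rewrite !normrM.
rewrite -natr1 exprS.
apply: (@le_trans _ _ (G * d * B ^+ size t + B * ((size t)%:R * G * B ^+ size t * d))).
  apply: lerD; first by rewrite ler_pM// aff_eval_lip.
  by rewrite ler_pM// IH.
rewrite !mulrDl mul1r addrC lerD//; first by rewrite le_eqVlt; apply/orP; left; apply/eqP; ring.
rewrite [leRHS]mulrAC ler_wpM2l//; first by rewrite mulr_ge0.
by rewrite ler_peMl// exprn_ge0.
Qed.

Lemma poly_fun_aff_prod t : poly_fun (size t) (aff_prod t).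
Proof.
elim: t => [|l t IH].
  rewrite (_ : aff_prod _ = fun x => \prod_i x 0 i ^+ 0%N).
    by apply: (@poly_fun_monomial _ _ _ (fun=> 0%N)); rewrite /morder big1.
  by apply/funext => x; rewrite /aff_prod big_nil big1// => i _; rewrite expr0.
rewrite (_ : aff_prod _ = fun x => \sum_k l.1 0 k * (x 0 k * aff_prod t x) + l.2 * aff_prod t x).
  apply: poly_funD; last exact/poly_funW/poly_funZ/IH.
  by apply: poly_fun_sum => k _; exact/poly_funZ/poly_fun_mulX/IH.
apply/funext => x; rewrite /aff_prod big_cons mulrDl mulr_suml; congr (_ + _).
by apply: eq_bigr => k _; rewrite mulrA.
Qed.

Lemma poly_fun_sp_eval N Q P : sp_all N Q P -> poly_fun N (sp_eval P).
Proof.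
elim: P => [|q P IH] PQ.
  rewrite (_ : sp_eval _ = fun=> 0); first exact: poly_fun0.
  by apply/funext => x; rewrite /sp_eval big_nil.
rewrite (_ : sp_eval _ = fun x => q.1 * aff_prod q.2 x + sp_eval P x); last first.
  by apply/funext => x; rewrite sp_eval_cons.
apply: poly_funD; last exact/IH/sp_allW/PQ.
have [sN _] := PQ q (mem_head _ _).
exact/poly_funZ/(poly_fun_le sN)/poly_fun_aff_prod.
Qed.

Lemma poly_fun_sp r p : poly_fun r p ->
  exists2 P, p =1 sp_eval P & sp_all r (fun=> True) P.
Proof.
move=> [c pc]; pose t (b : {ffun 'I_n -> 'I_r.+1}) : seq aff :=
  flatten [seq nseq (b i) (delta_mx 0 i, 0) | i <- enum 'I_n].
exists [seq (c b, t b) | b <- enum [pred b : {ffun 'I_n -> 'I_r.+1} | (morder (fun i => b i) <= r)%N]].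
  move=> x; rewrite pc /sp_eval big_map big_enum/=; apply: eq_bigr => b _; congr (_ * _).
  rewrite /aff_prod /t big_flatten/= big_map big_enum/=; apply: eq_bigr => i _.
  rewrite big_nseq; elim: (b i : nat) => [|k IH]; first by rewrite expr0.
  rewrite exprS iterS -IH; congr (_ * _).
  rewrite /aff_eval addr0 (bigD1 i)//= mxE !eqxx/= mul1r big1 ?addr0// => j /negbTE ji.
  by rewrite mxE ji andbF mul0r.
move=> q /mapP[b]; rewrite mem_enum inE => br ->; split => //=.
apply: leq_trans br; rewrite /t size_flatten /shape -map_comp sumnE big_map big_enum/=.
by rewrite /morder; apply/eq_leq/eq_bigr => i _; rewrite size_nseq.
Qed.

Lemma poly_fun_polyd (J : finType) (a : J -> 'rV[R]_n) r p : poly_fun r p ->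
  polyd r (fun w : J -> R => p (\sum_j w j *: a j)).
Proof.
move=> [c pc]; rewrite (_ : (fun _ => _) = fun w => \sum_(b : {ffun 'I_n -> 'I_r.+1} |
    (morder (fun i => b i) <= r)%N) c b * \prod_i (\sum_j a j 0 i * w j) ^+ b i); last first.
  apply/funext => w; rewrite pc; apply: eq_bigr => b _; congr (_ * _); apply: eq_bigr => i _.
  by congr (_ ^+ _); rewrite summxE; apply: eq_bigr => j _; rewrite mxE mulrC.
apply: polyd_sum => b br; apply: polydZ; apply: polyd_le br _.
rewrite /morder; elim: (index_enum _) => [|i s IH].
  rewrite (_ : (fun _ => _) = fun=> 1); first exact: polyd_cst.
  by apply/funext => w; rewrite big_nil.
rewrite big_cons (_ : (fun _ => _) = fun w => (\sum_j a j 0 i * w j) ^+ b i *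
   \prod_(i <- s) (\sum_j a j 0 i * w j) ^+ b i); last first.
  by apply/funext => w; rewrite big_cons.
elim: (b i : nat) => [|k IHk].
  rewrite add0n (_ : (fun _ => _) = fun w => \prod_(i <- s) (\sum_j a j 0 i * w j) ^+ b i)//.
  by apply/funext => w; rewrite expr0 mul1r.
rewrite addSn (_ : (fun _ => _) = fun w => (\sum_j a j 0 i * w j) *
  ((\sum_j a j 0 i * w j) ^+ k * \prod_(i <- s) (\sum_j a j 0 i * w j) ^+ b i)).
  exact: polyd_mul_linear.
by apply/funext => w; rewrite exprS mulrA.
Qed.

(* [node a r al] is the point of the principal lattice of order r of the simplex
   with vertices a whose barycentric coordinates are al / r. *)
Definition node (J : finType) (a : J -> 'rV[R]_n) r (al : {ffun J -> 'I_r.+1}) : 'rV[R]_n :=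
  \sum_j ((al j : nat)%:R / r%:R) *: a j.

(** Scaled by [r], weights of sum 1 lie on the hyperplane where [lattice_interp] applies. The points
    [a] may be the vertices of an element, of a face or of an intersection of elements. *)
Lemma lagrange_interp (J : finType) (a : J -> 'rV[R]_n) r p (w : J -> R) : (0 < r)%N ->
  poly_fun r p -> \sum_j w j = 1 ->
  p (\sum_j w j *: a j) = \sum_(al : {ffun J -> 'I_r.+1} | msize al == r)
    p (node a al) * mbin (fun j => r%:R * w j) al.
Proof.
move=> r0 pr w1; have r0' : r%:R != 0 :> R by rewrite pnatr_eq0 -lt0n.
have := @lattice_interp R J r r (fun w => p (\sum_j w j *: (r%:R^-1 *: a j)))
  (fun j => r%:R * w j) (leqnn r) (poly_fun_polyd _ pr).
rewrite -mulr_sumr w1 mulr1 => /(_ erefl).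
rewrite (_ : \sum_j _ = \sum_j w j *: a j); last first.
  by apply: eq_bigr => j _; rewrite scalerA mulrAC divff// mul1r.
move=> <-; apply: eq_bigr => al _; congr (p _ * _).
by apply: eq_bigr => j _; rewrite scalerA.
Qed.

Definition is_node (J : finType) (a : J -> 'rV[R]_n) (r : nat) (z : 'rV[R]_n) : Prop :=
  exists2 al : {ffun J -> 'I_r.+1}, msize al = r & z = node a al.

(** The index at a vertex of [b] is the total of the indices over the fibre of [s]. This passes from
    the nodes of a face to those of an element that contains its vertices. *)
Lemma is_node_sub (I J : finType) (a : I -> 'rV[R]_n) (b : J -> 'rV[R]_n) (s : I -> J) r z :
  (forall i, a i = b (s i)) -> is_node a r z -> is_node b r z.
Proof.
move=> ab [al alr ->].
pose be (j : J) : nat := (\sum_(i | s i == j) al i)%N.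
have ber j : (be j < r.+1)%N.
  rewrite ltnS -alr /msize [leqRHS](bigID (fun i => s i == j))/=; exact: leq_addr.
exists [ffun j => Ordinal (ber j)].
  transitivity (msize al); last exact: alr.
  rewrite /msize; under eq_bigr do rewrite ffunE/=.
  by rewrite /be [RHS](partition_big s predT).
rewrite /node [LHS](partition_big s predT)//=; apply: eq_bigr => j _.
rewrite ffunE/= /be natr_sum mulr_suml scaler_suml.
by apply: eq_bigr => i /eqP <-; rewrite ab.
Qed.

(** Unisolvence on the affine hull of [a]. It gives both the continuity of the interpolant between
    elements and its agreement with the coarse trace on a face. *)
Lemma eq_poly_fun_on_nodes (J : finType) (a : J -> 'rV[R]_n) r p q (w : J -> R) : (0 < r)%N ->
  poly_fun r p -> poly_fun r q -> \sum_j w j = 1 ->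
  (forall z, is_node a r z -> p z = q z) ->
  p (\sum_j w j *: a j) = q (\sum_j w j *: a j).
Proof.
move=> r0 pr qr w1 pq; rewrite !(@lagrange_interp _ _ r)//.
by apply: eq_bigr => al /eqP alr; rewrite pq//; exists al.
Qed.

End affine_product.

(** * Continuity, derivatives and measurability of sums of affine products *)

Section real_continuous.
Context (R : realType) (T : topologicalType).
Implicit Types f g : T -> R.

Lemma continuous_addr f g : continuous f -> continuous g -> continuous (fun x => f x + g x).
Proof. by move=> cf cg x; exact: (@continuousD _ R^o T f g x (cf x) (cg x)). Qed.

Lemma continuous_mulr f g : continuous f -> continuous g -> continuous (fun x => f x * g x).
Proof. by move=> cf cg x; exact: (@continuousM _ T f g x (cf x) (cg x)). Qed.

Lemma continuous_cstr (c : R) : continuous (fun _ : T => c).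
Proof. by move=> x; exact: cvg_cst. Qed.

Lemma continuous_sumr (I : Type) (s : seq I) (F : I -> T -> R) :
  (forall i, continuous (F i)) -> continuous (fun x => \sum_(i <- s) F i x).
Proof.
move=> cF; elim: s => [|i s IH].
  rewrite (_ : (fun _ => _) = fun=> 0); first exact: continuous_cstr.
  by apply/funext => y; rewrite big_nil.
rewrite (_ : (fun _ => _) = fun x => F i x + \sum_(i <- s) F i x); last first.
  by apply/funext => y; rewrite big_cons.
exact: continuous_addr.
Qed.

End real_continuous.

Section affine_product_analysis.
Context (R : realType) (n : nat).
Implicit Types (l : aff R n) (t : seq (aff R n)) (P : seq (R * seq (aff R n))) (x : 'rV[R]_n).

Lemma aff_eval_line l x (i : 'I_n) (h : R) :
  aff_eval l (h *: delta_mx 0 i + x) = h * l.1 0 i + aff_eval l x.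
Proof.
rewrite /aff_eval addrA; congr (_ + _).
rewrite (eq_bigr (fun k => l.1 0 k * x 0 k + h * (l.1 0 k * (k == i)%:R))).
  rewrite big_split/= addrC -mulr_sumr; congr (_ * _ + _).
  rewrite (bigD1 i)//= eqxx mulr1 big1 ?addr0// => k /negbTE ->.
  by rewrite mulr0.
by move=> k _; rewrite !mxE eqxx/= mulrDr addrC; congr (_ + _); rewrite mulrCA.
Qed.

Lemma aff_eval_continuous l : continuous (aff_eval l).
Proof.
apply: continuous_addr; last exact: continuous_cstr.
apply: continuous_sumr => k; apply: continuous_mulr; first exact: continuous_cstr.
exact: coord_continuous.
Qed.

Lemma is_derive_aff_eval l x i : is_derive x (delta_mx 0 i) (aff_eval l) (l.1 0 i).
Proof.
have H : (fun h => h^-1 *: ((aff_eval l) (h *: delta_mx 0 i + x) - aff_eval l x)) @ 0^' --> l.1 0 i.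
  apply: cvg_near_cst; near=> h.
  have h0 : h != 0 by near: h; exact: nbhs_dnbhs_neq.
  by rewrite aff_eval_line addrK /GRing.scale/= mulrA mulVf ?mul1r.
split; first by apply/cvg_ex; eexists; exact: H.
exact/cvg_lim/H.
Unshelve. all: by end_near. Qed.

Lemma sp_eval_continuous P : continuous (sp_eval P).
Proof.
elim: P => [|q P IH].
  rewrite (_ : sp_eval _ = fun=> 0); first exact: continuous_cstr.
  by apply/funext => y; rewrite /sp_eval big_nil.
rewrite (_ : sp_eval _ = fun x => q.1 * aff_prod q.2 x + sp_eval P x); last first.
  by apply/funext => y; rewrite sp_eval_cons.
apply: continuous_addr; last exact: IH.
apply: continuous_mulr; first exact: continuous_cstr.
elim: q.2 => [|l t IHt].
  rewrite (_ : aff_prod _ = fun=> 1); first exact: continuous_cstr.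
  by apply/funext => y; rewrite /aff_prod big_nil.
rewrite (_ : aff_prod _ = fun x => aff_eval l x * aff_prod t x); last first.
  by apply/funext => y; rewrite /aff_prod big_cons.
apply: continuous_mulr => //; exact: aff_eval_continuous.
Qed.

Lemma is_derive_aff_prod c t x i : is_derive x (delta_mx 0 i) (fun y => c * aff_prod t y)
  (sp_eval (prod_deriv i c t) x).
Proof.
elim: t c => [|l t IH] c.
  rewrite (_ : (fun _ => _) = cst c) /sp_eval ?big_nil; first exact: is_derive_cst.
  by apply/funext => y; rewrite /aff_prod big_nil mulr1.
rewrite (_ : (fun _ => _) = (aff_eval l * (fun y => c * aff_prod t y))); last first.
  by apply/funext => y; rewrite /aff_prod big_cons mulrCA.
have := is_deriveM (is_derive_aff_eval l x i) (IH c).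
rewrite /= sp_eval_cons/= (_ : _ + _ = c * l.1 0 i * aff_prod t x +
  sp_eval [seq (q.1, l :: q.2) | q <- prod_deriv i c t] x)//.
rewrite addrC; congr (_ + _); first by rewrite /GRing.scale/=; ring.
rewrite /GRing.scale/= /sp_eval big_map mulr_sumr; apply: eq_bigr => q _ /=.
by rewrite /aff_prod big_cons mulrCA.
Qed.

Lemma is_derive_sp_eval P x i :
  is_derive x (delta_mx 0 i) (sp_eval P) (sp_eval (sp_deriv i P) x).
Proof.
elim: P => [|q P IH].
  rewrite (_ : sp_eval _ = cst 0) /sp_eval ?big_nil; first exact: is_derive_cst.
  by apply/funext => y; rewrite /sp_eval big_nil.
rewrite (_ : sp_eval _ = (fun x => q.1 * aff_prod q.2 x) + sp_eval P); last first.
  by apply/funext => y; rewrite sp_eval_cons.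
by rewrite /= sp_eval_cat; apply: is_deriveD; exact: is_derive_aff_prod.
Qed.

Lemma measurable_sp_eval_comp d (T : measurableType d) (D : set T) P (f : T -> 'rV[R]_n) :
  (forall k, measurable_fun D (fun s => f s 0 k)) ->
  measurable_fun D (fun s => sp_eval P (f s)).
Proof.
move=> mf.
have ml l : measurable_fun D (fun s => aff_eval l (f s)).
  apply: measurable_funD => //; apply: measurable_sum => k; exact: measurable_funM.
have mt (t : seq (aff R n)) : measurable_fun D (fun s => aff_prod t (f s)).
  by apply: measurable_prod => l _; exact: ml.
by apply: measurable_sum => q; apply: measurable_funM.
Qed.

Lemma measurable_sp_eval P (D : set (n.-tuple (measurableTypeR R))) :
  measurable_fun D (fun s => sp_eval P (vec s)).
Proof.
apply: measurable_sp_eval_comp => k.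
rewrite (_ : (fun _ => _) = fun s => tnth s k); last by apply/funext => s; rewrite mxE.
by apply: measurable_funTS; exact: measurable_tnth.
Qed.

End affine_product_analysis.

Lemma natSinv_lt (R : archiRealFieldType) (e : R) : 0 < e -> exists k : nat, k.+1%:R^-1 < e.
Proof.
move=> e0; exists (Num.truncn e^-1).
by rewrite invf_plt ?posrE ?ltr0n// truncnS_gt.
Qed.

(** * Lebesgue measure of boxes and its invariance by translation *)

Section open_measurable.
Context (R : realType) (n : nat).
Implicit Types (U : set 'rV[R]_n).

(** The sigma-algebra lives on tuples and the topology on row vectors; the countable base of cubes
    with rational centres connects them. *)
Lemma open_measurable_vec U : open U -> measurable (@vec R n @^-1` U).
Proof.
move=> oU.
pose box (p : {ffun 'I_n -> rat} * nat) : set 'rV[R]_n :=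
  [set x | forall i, `|x 0 i - ratr (p.1 i)| < p.2.+1%:R^-1].
(* With the inclusion kept as a clause, the union is indexed by a whole countable type, and cubes
   that stick out of [U] contribute the empty set. *)
pose F p : set (n.-tuple (measurableTypeR R)) :=
  [set t | box p `<=` U /\ box p (vec t)].
rewrite (_ : _ @^-1` _ = \bigcup_p F p); last first.
  apply/seteqP; split => [t Ut|t [p _ [pU pt]]]; last exact: pU.
  have /nbhs_ballP[e /= e0 eU] : nbhs (vec t) U by exact: open_nbhs_nbhs.
  have [k ke] : exists k : nat, k.+1%:R^-1 < e / 2 by apply: natSinv_lt; rewrite divr_gt0.
  have k0 : 0 < k.+1%:R^-1 :> R by rewrite invr_gt0 ltr0n.
  have H i : exists q : rat, `|tnth t i - ratr q| < k.+1%:R^-1.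
    have [q] : exists q : rat, ratr q \in `]tnth t i - k.+1%:R^-1, tnth t i + k.+1%:R^-1[.
      by apply: rat_in_itvoo; rewrite ltrBlDr -addrA ltrDl addr_gt0.
    rewrite in_itv/= => /andP[q1 q2]; exists q.
    by rewrite ltr_distlC q2 andbT.
  exists ([ffun i => projT1 (cid (H i))], k) => //; split; last first.
    by move=> i; rewrite ffunE mxE/=; case: cid.
  move=> y yb; apply: eU; split => // i j; rewrite ord1.
  have := yb j; rewrite ffunE/=; case: cid => q /= qt yq.
  rewrite /ball/= mxE -(subrKA (ratr q)) -[_ - y 0 j]opprB.
  apply: le_lt_trans (ler_normD _ _) _; rewrite normrN.
  by rewrite (splitr e) ltrD// ?(lt_trans qt)// (lt_trans yq).
apply: countable_bigcupT_measurable; first exact: countableP.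
move=> p; have [pU|pU] := pselect (box p `<=` U); last first.
  rewrite (_ : F p = set0); first exact: measurable0.
  by apply/seteqP; split => // t [].
rewrite (_ : F p = \bigcap_(i in [set: 'I_n])
    [set t | `|tnth t i - ratr (p.1 i)| < p.2.+1%:R^-1]); last first.
  apply/seteqP; split => [t [_ pt] i _|t pt]; first by have := pt i; rewrite mxE.
  by split => // i; rewrite mxE; exact: pt.
apply: fin_bigcap_measurable => [|i _].
  exact: finite_finset.
rewrite (_ : [set t | _] = (fun t => `|tnth t i - ratr (p.1 i)|) @^-1` `]-oo, p.2.+1%:R^-1[); last first.
  by apply/seteqP; split => t /=; rewrite in_itv.
rewrite -[X in measurable X]setTI; apply: (_ : measurable_fun setT _) => //.
apply: measurableT_comp => //; apply: measurable_funB => //; exact: measurable_tnth.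
Qed.

Lemma closed_measurable_vec U : closed U -> measurable (@vec R n @^-1` U).
Proof.
move=> cU; rewrite -[U]setCK preimage_setC; apply: measurableC.
by apply: (@open_measurable_vec (~` U)); rewrite openC.
Qed.

Lemma continuous_measurable_vec (f : 'rV[R]_n -> R) D : continuous f ->
  measurable_fun D (fun t => f (vec t)).
Proof.
move=> cf; apply: measurable_funTS.
apply: (measurability _ (@RGenOpens.measurableE R)) => _ [_ [a [b ->]] <-].
rewrite setTI; apply: (@open_measurable_vec (f @^-1` `]a, b[)).
by apply: open_comp => // x _; exact: cf.
Qed.

End open_measurable.

Section translation.
Context (R : realType).
Local Open Scope ereal_scope.

Lemma lebesgue_measure_translation (v : R) (A : set R) : measurable A ->
  pushforward (@lebesgue_measure R) (fun x => x + v)%R A = lebesgue_measure A.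
Proof.
have mv : measurable_fun setT (fun x : measurableTypeR R => (x + v)%R : measurableTypeR R).
  by apply: measurable_funD.
move=> mA; apply/esym.
pose mvM := isMeasurableFun.Build _ _ _ _ _ mv.
pose f : {mfun measurableTypeR R >-> measurableTypeR R} := HB.pack (fun x : R => x + v)%R mvM.
apply: (@lebesgue_measure_unique R (pushforward (@lebesgue_measure R) f)) => // _ [[a b]] _ <-.
transitivity (@lebesgue_measure R `](a - v)%R, (b - v)%R]%classic).
  rewrite !lebesgue_measure_itv/= !lte_fin ltrD2r.
  by case: ifP => // _; rewrite -!EFinB; congr (_%:E); rewrite opprB addrA subrK.
by congr lebesgue_measure; apply/seteqP; split => x /=; rewrite !in_itv/= ltrBlDr lerBrDr.
Qed.

Lemma ge0_integral_translation1 (v : R) (f : measurableTypeR R -> \bar R) :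
  measurable_fun setT f -> (forall x, 0 <= f x) ->
  \int[@lebesgue_measure R]_x f (x + v)%R = \int[@lebesgue_measure R]_x f x.
Proof.
move=> mf f0.
have mv : measurable_fun setT (fun x : measurableTypeR R => (x + v)%R : measurableTypeR R).
  by apply: measurable_funD.
have := @ge0_integral_pushforward _ _ _ _ R _ mv (@lebesgue_measure R) setT f measurableT mf.
rewrite preimage_setT => <-; last by move=> x _; exact: f0.
by apply: eq_measure_integral => A mA _; exact/lebesgue_measure_translation.
Qed.

Lemma integral_lebesgue_RnS n (f : n.+1.-tuple (measurableTypeR R) -> \bar R) :
  measurable_fun setT f -> (forall x, 0 <= f x) ->
  \int[lebesgue_Rn R n.+1]_t f t =
  \int[@lebesgue_measure R]_x \int[lebesgue_Rn R n]_t f (tcons (x, t)).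
Proof.
move=> mf f0.
have := @ge0_integral_pushforward _ _ _ _ R _ (@measurable_tcons _ (measurableTypeR R) n)
  (@lebesgue_measure R \x lebesgue_Rn R n) setT f measurableT mf.
rewrite preimage_setT => H; rewrite [LHS]H; last by move=> x _; exact: f0.
rewrite fubini_tonelli1//; last by move=> x; exact: f0.
exact: measurableT_comp mf (@measurable_tcons _ _ n).
Qed.

Definition ttrans n (v : n.-tuple R) (t : n.-tuple (measurableTypeR R)) :
    n.-tuple (measurableTypeR R) := [tuple (tnth t i + tnth v i)%R | i < n].

Lemma measurable_ttrans n v : measurable_fun setT (@ttrans n v).
Proof.
apply/measurable_fun_tnthP => i; rewrite (_ : _ \o _ = fun t => (tnth t i + tnth v i)%R).
  by apply: measurable_funD => //; exact: measurable_tnth.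
by apply/funext => t; rewrite /= tnth_mktuple.
Qed.

(** Induction on the dimension by Tonelli, translating one coordinate at a time. *)
Lemma ge0_integral_translation n (v : n.-tuple R) f :
  measurable_fun setT f -> (forall x, 0 <= f x) ->
  \int[lebesgue_Rn R n]_t f (ttrans v t) = \int[lebesgue_Rn R n]_t f t.
Proof.
elim: n v f => [|n IH] v f mf f0.
  by apply: eq_integral => t _; rewrite [ttrans v t]tuple0 [t in RHS]tuple0.
have f0' t : 0 <= f (ttrans v t) by exact: f0.
apply: etrans (integral_lebesgue_RnS (measurableT_comp mf (measurable_ttrans v)) f0') _.
apply: etrans _ (esym (integral_lebesgue_RnS mf f0)).
pose v' : n.-tuple R := [tuple of behead v].
pose G x := \int[lebesgue_Rn R n]_t f (tcons (x, t)).
have mfc : measurable_fun setT (f \o @tcons _ (measurableTypeR R) n).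
  exact: measurableT_comp mf (@measurable_tcons _ _ n).
transitivity (\int[@lebesgue_measure R]_x G (x + thead v)%R).
  apply: eq_integral => x _; rewrite /G.
  rewrite -(IH v' (fun t => f (tcons ((x + thead v)%R, t)))); last 2 first.
  - exact: (measurableT_comp mfc (pair1_measurable _)).
  - by move=> t; exact: f0.
  apply: eq_integral => t _; congr f; apply/eq_from_tnth => i; rewrite tnth_mktuple.
  case: (unliftP ord0 i) => [j ->|->]; last by rewrite !tnth0.
  rewrite !tnthS tnth_mktuple; congr (_ + _)%R.
  by rewrite /v' tnth_behead; congr tnth; apply/val_inj; rewrite /= inordK// ltnS.
apply: (ge0_integral_translation1 _ (f := G)).
  have f0c x : 0 <= (f \o @tcons _ (measurableTypeR R) n) x by exact: f0.
  exact: (@measurable_fun_fubini_tonelli_F _ _ _ _ R (power_measure (@lebesgue_measure R) n) _ mfc f0c).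
by move=> x; exact: integral_ge0.
Qed.

Lemma integral_translation n (v : n.-tuple R) f : measurable_fun setT f ->
  \int[lebesgue_Rn R n]_t f (ttrans v t) = \int[lebesgue_Rn R n]_t f t.
Proof.
move=> mf; rewrite integralE [RHS]integralE; congr (_ - _).
  have f0 x : 0 <= f^\+ x by [].
  apply: etrans (ge0_integral_translation v (measurable_funepos mf) f0).
  by apply: eq_integral => t _; rewrite (funepos_comp f (ttrans v)).
have f0 x : 0 <= f^\- x by [].
apply: etrans (ge0_integral_translation v (measurable_funeneg mf) f0).
by apply: eq_integral => t _; rewrite (funeneg_comp f (ttrans v)).
Qed.

Lemma lebesgue_Rn_box n (A : nat -> set R) : (forall i, measurable (A i)) ->
  lebesgue_Rn R n [set t | forall i : 'I_n, A i (tnth t i)] =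
  \prod_(i < n) @lebesgue_measure R (A i).
Proof.
elim: n A => [|n IH] A mA.
  rewrite big_ord0 /lebesgue_Rn/= diracE mem_set//= => -[]//.
rewrite big_ord_recl -(IH (fun i => A i.+1))//.
rewrite {1}/lebesgue_Rn/= /cons_measure /pushforward.
rewrite (_ : _ @^-1` _ = A 0%N `*` [set t : n.-tuple R | forall i : 'I_n, A i.+1 (tnth t i)]); last first.
  apply/seteqP; split => [[x t] /= H|[x t] [/= H0 H] i].
    split => [|i]; first by have := H ord0; rewrite tnth0.
    by have := H (lift ord0 i); rewrite tnthS.
  by case: (unliftP ord0 i) => [j ->|->]; rewrite ?tnthS ?tnth0//; exact: H.
apply: product_measure1E; first exact: mA.
rewrite (_ : [set t | _] = \bigcap_(i in [set: 'I_n]) [set t | A i.+1 (tnth t i)]); last first.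
  by apply/seteqP; split => [t H i _|t H i]; exact: H.
apply: fin_bigcap_measurable => [|i _]; first exact: finite_finset.
by rewrite -[X in measurable X]setTI; exact: (measurable_tnth i measurableT (mA i.+1)).
Qed.

Lemma lebesgue_Rn_cube n (c : 'rV[R]_n) (e : R) : (0 <= e)%R ->
  lebesgue_Rn R n [set t | forall i, (`|tnth t i - c ord0 i| <= e)%R] = ((2 * e) ^+ n)%:E.
Proof.
move=> e0; case: n c => [|n] c.
  by rewrite expr0 /lebesgue_Rn/= diracE mem_set//= => -[].
pose A (i : nat) := `[(c ord0 (inord i) - e)%R, (c ord0 (inord i) + e)%R]%classic.
rewrite (_ : [set t | _] = [set t | forall i : 'I_n.+1, A i (tnth t i)]).
  rewrite lebesgue_Rn_box; last by move=> i; exact: measurable_itv.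
  rewrite (eq_bigr (fun=> (2 * e)%:E)) => [|i _].
    by rewrite prodEFin prodr_const card_ord.
  rewrite lebesgue_measure_itv/= lte_fin -EFinB.
  rewrite (_ : (_ + e - _)%R = (2 * e)%R); last by ring.
  case: ifPn => // /negP H; suff -> : e = 0%R by rewrite mulr0.
  apply/eqP; rewrite eq_le e0 andbT leNgt; apply/negP => e1; apply: H.
  by rewrite ltrD2l gtrN.
by apply/seteqP; split => t H i; have := H i; rewrite /A/= in_itv/= inord_val ler_distl.
Qed.

End translation.

(** * Weak derivatives of piecewise polynomials *)

Section bounded_sets.
Context (R : realType) (n : nat).
Implicit Types (U : set 'rV[R]_n).

Lemma rv_norm_ltP (x : 'rV[R]_n) (e : R) : `|x| < e -> forall i, `|x 0 i| < e.
Proof.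
move=> xe i.
have : ball (0 : 'rV[R]_n) e x by rewrite -ball_normE/= sub0r normrN.
by move=> [_ /(_ 0 i)]; rewrite /ball/= mxE sub0r normrN.
Qed.

Lemma bounded_set_coord U : bounded_set U ->
  exists2 M : R, 0 < M & forall x, U x -> forall i, `|x 0 i| <= M.
Proof.
move=> [N [_ NU]]; exists (`|N| + 2) => [|x Ux i]; first by rewrite ltr_wpDl.
apply/ltW/rv_norm_ltP; apply: (@le_lt_trans _ _ (`|N| + 1)); last by rewrite ltrD2l ltrDl.
by apply: NU => //; rewrite (le_lt_trans (ler_norm N))// ltrDl.
Qed.

Lemma bounded_set_measure_le U (c : 'rV[R]_n) (M : R) : 0 <= M -> measurable (@vec R n @^-1` U) ->
  (forall x, U x -> forall i, `|x 0 i - c 0 i| <= M) ->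
  (lebesgue_Rn R n (vec @^-1` U) <= ((2 * M) ^+ n)%:E)%E.
Proof.
move=> M0 mU UM; rewrite -(@lebesgue_Rn_cube R n c M M0); apply: le_measure; rewrite ?inE//.
  rewrite (_ : [set t | _] = \bigcap_(i in [set: 'I_n]) [set t | `|tnth t i - c 0 i| <= M]); last first.
    by apply/seteqP; split => [t H i _|t H i]; exact: H.
  apply: fin_bigcap_measurable => [|i _]; first exact: finite_finset.
  rewrite (_ : [set t | _] = (fun t => `|tnth t i - c 0 i|) @^-1` `]-oo, M]); last first.
    by apply/seteqP; split => t /=; rewrite in_itv.
  rewrite -[X in measurable X]setTI; apply: (_ : measurable_fun setT _) => //.
  apply: measurableT_comp => //; apply: measurable_funB => //; exact: measurable_tnth.
by move=> t /UM H i; have := H i; rewrite mxE.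
Qed.

Lemma bounded_set_measure_lty U : bounded_set U -> measurable (@vec R n @^-1` U) ->
  (lebesgue_Rn R n (vec @^-1` U) < +oo)%E.
Proof.
move=> /bounded_set_coord[M M0 UM] mU.
apply: le_lt_trans (bounded_set_measure_le (c := 0) (ltW M0) mU _) _ => [x Ux i|].
  by rewrite mxE subr0; exact: UM.
by rewrite ltry.
Qed.

End bounded_sets.

Section derivatives.
Context (R : realType) (n : nat).
Implicit Types (U : set 'rV[R]_n) (f : 'rV[R]_n -> R) (x : 'rV[R]_n) (i : 'I_n).

Lemma derivable_quotient f x i (u : R^nat) : derivable f x (delta_mx 0 i) ->
  (forall k, u k != 0) -> u @ \oo --> 0 ->
  (fun k => (u k)^-1 * (f (x + u k *: delta_mx 0 i) - f x)) @ \oo --> pderive i f x.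
Proof.
move=> dfx u0 cu; rewrite /pderive /derive.
have := (cvgr_dnbhsP (fun h => h^-1 * (f (h *: delta_mx 0 i + x) - f x)) 0 _).1 dfx.
move=> /(_ u); rewrite (_ : (fun k => (u k)^-1 * (f (x + _) - _)) =
   (fun k => (u k)^-1 * (f (u k *: delta_mx 0 i + x) - f x))).
  by apply; split.
by apply/funext => k; rewrite [x + _]addrC.
Qed.

Lemma is_derive_line f x i (s : R) : derivable f (x + s *: delta_mx 0 i) (delta_mx 0 i) ->
  is_derive s 1 (fun s => f (x + s *: delta_mx 0 i)) (pderive i f (x + s *: delta_mx 0 i)).
Proof.
set y := x + s *: _ => df.
have H : (fun h => h^-1 *: (((fun s => f (x + s *: delta_mx 0 i)) \o shift s) (h *: 1) -
    f (x + s *: delta_mx 0 i))) = (fun h => h^-1 *: ((f \o shift y) (h *: delta_mx 0 i) - f y)).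
  apply/funext => h; rewrite /y /shift/=; congr (_ *: (f _ - _)).
  have -> : h%:A = h by rewrite /GRing.scale/= mulr1.
  by rewrite scalerDl addrCA.
split; first by rewrite /derivable H.
by rewrite /derive H.
Qed.

Lemma pderive_lip f i (S : R) : (forall x, derivable f x (delta_mx 0 i)) ->
  (forall x, `|pderive i f x| <= S) ->
  forall x h, 0 <= h -> `|f (x + h *: delta_mx 0 i) - f x| <= S * h.
Proof.
move=> df dfS x h h0.
pose g s := f (x + s *: delta_mx 0 i).
have dg (s : R) : is_derive s 1 g (pderive i f (x + s *: delta_mx 0 i)) by exact: is_derive_line.
have cg : {within `[0, h], continuous g}.
  by apply: derivable_within_continuous => s _; case: (dg s).
have [c _ E] := @MVT_segment R g (fun s => pderive i f (x + s *: delta_mx 0 i)) 0 h h0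
  (fun s _ => dg s) cg.
move: E; rewrite /g scale0r addr0 subr0 => ->.
by rewrite normrM (ger0_norm h0) ler_wpM2r.
Qed.

Lemma pderives_rcons (s : seq 'I_n) i f : pderives (rcons s i) f = pderives s (pderive i f).
Proof. by rewrite -cats1 /pderives foldr_cat. Qed.

Lemma test_fun_pderive U i f : test_fun U f -> test_fun U (pderive i f).
Proof.
move=> [sf [K [cK KU K0]]]; split.
  by move=> s; rewrite -pderives_rcons; exact: sf.
exists K; split => // x Kx; rewrite /pderive /derive.
have oK : open (~` K) by apply: closed_openC; apply: compact_closed => //; exact: norm_hausdorff.
apply/cvg_lim => //; apply: cvg_near_cst.
have /nbhs_ballP[e /= e0 eK] : nbhs x (~` K) by exact: open_nbhs_nbhs.
apply/nbhs_ballP; exists e => //= h; rewrite /ball/= sub0r normrN => he h0.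
rewrite [f x]K0// [f _]K0 ?subrr ?scaler0//.
apply: eK; split => // a j; rewrite /ball/= !mxE opprD addrCA subrr addr0 normrN normrM.
apply: le_lt_trans he; rewrite ler_piMr//.
by case: (_ && _); rewrite ?normr1 ?normr0.
Qed.

Lemma test_fun_bounded U f : test_fun U f -> exists2 S, 0 < S & forall x, `|f x| <= S.
Proof.
move=> [sf [K [cK KU K0]]]; have [cf _] := sf [::].
have /compact_bounded[N [_ NK]] := @continuous_compact _ _ f K (continuous_subspaceT cf) cK.
exists (`|N| + 1) => [|x]; first by rewrite ltr_wpDl.
have [Kx|Kx] := pselect (K x); last by rewrite K0// normr0 addr_ge0.
by apply: NK; [rewrite (le_lt_trans (ler_norm N))// ltrDl|exists x].
Qed.

(** With [K] the support of a test function, backward steps from it stay in [U] from some index on,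
    uniformly; the Lipschitz bound on [u] is available there. *)
Lemma compact_shrink U K i : compact K -> open U -> K `<=` U ->
  \forall k \near \oo, forall x, K x -> forall s, 0 <= s <= k.+1%:R^-1 -> U (x - s *: delta_mx 0 i).
Proof.
move=> /compact_near_coveringP cK oU KU.
pose P (k : nat) x := forall s, 0 <= s <= k.+1%:R^-1 -> U (x - s *: delta_mx 0 i).
have := cK nat \oo P _; apply => x Kx.
have /nbhs_ballP[e /= e0 eU] : nbhs x U by apply: open_nbhs_nbhs; split => //; exact: KU.
have e20 : 0 < e / 2 by rewrite divr_gt0.
exists (ball x (e / 2), [set k | k.+1%:R^-1 < e / 2]).
  split; first exact: nbhsx_ballx.
  have [k0 k0e] := natSinv_lt e20; exists k0 => // k /= k0k.
  by rewrite (le_lt_trans _ k0e)// lef_pV2 ?posrE// ler_nat.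
move=> [y k] [/= xy ke] s /andP[s0 sk]; apply: eU; split => // a j.
have := xy.2 a j; rewrite /ball/= !mxE => xyj.
rewrite opprB addrA addrAC; apply: le_lt_trans (ler_normD _ _) _.
rewrite (splitr e) ltrD//; apply: le_lt_trans ke; apply: le_trans sk.
rewrite normrM ger0_norm// ler_piMr//.
by case: (_ && _); rewrite ?normr1 ?normr0.
Qed.

End derivatives.

Section weak_derivative.
Context (R : realType) (n : nat).
Implicit Types (U : set 'rV[R]_n) (f u g phi : 'rV[R]_n -> R) (x : 'rV[R]_n) (i : 'I_n).
Local Notation mu := (lebesgue_Rn R n).

Lemma vec_ttrans (c : 'rV[R]_n) t : vec (ttrans [tuple c 0 j | j < n] t) = vec t + c.
Proof. by apply/rowP => j; rewrite !mxE !tnth_mktuple. Qed.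

Lemma measurable_patch U f : measurable (@vec R n @^-1` U) ->
  measurable_fun (vec @^-1` U) (fun t => f (vec t)) ->
  measurable_fun setT (fun t => (f \_ U) (vec t)).
Proof.
move=> mU mf; rewrite (_ : (fun _ => _) = (fun t => f (vec t)) \_ (vec @^-1` U)).
  exact: (iffLR (measurable_restrictT _ mU)).
by apply/funext => t; rewrite /patch.
Qed.

Lemma measurable_shift f (c : 'rV[R]_n) : measurable_fun setT (fun t => f (vec t)) ->
  measurable_fun setT (fun t => f (vec t + c)).
Proof.
move=> mf; rewrite (_ : (fun _ => _) =
    (fun t => f (vec t)) \o ttrans [tuple c 0 j | j < n]).
  exact: measurableT_comp mf (measurable_ttrans _).
by apply/funext => t /=; rewrite vec_ttrans.
Qed.

Lemma integral_Rn_patch U f :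
  integral_Rn U f = (\int[mu]_t ((f \_ U) (vec t))%:E)%E.
Proof.
rewrite /integral_Rn integral_mkcond; apply: eq_integral => t _.
rewrite !patchE (_ : (t \in vec @^-1` U) = (vec t \in U)).
  by case: ifP.
by apply/idP/idP; rewrite !inE.
Qed.

Lemma integral_shift f (c : 'rV[R]_n) : measurable_fun setT (fun t => f (vec t)) ->
  (\int[mu]_t (f (vec t + c))%:E = \int[mu]_t (f (vec t))%:E)%E.
Proof.
move=> mf; have mf' := iffRL (measurable_EFinP _ _) mf.
apply: etrans (integral_translation [tuple c 0 j | j < n] mf').
by apply: eq_integral => t _; rewrite /= vec_ttrans.
Qed.

Lemma integrable_indic_bound U (C : R) : bounded_set U -> measurable (@vec R n @^-1` U) ->
  mu.-integrable setT (fun t => (C * \1_U (vec t))%:E).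
Proof.
move=> bU mU; apply/integrableP; split.
  apply/measurable_EFinP; apply: measurable_funM => //.
  exact: (@measurable_indic _ _ R setT (vec @^-1` U)).
rewrite (eq_integral (fun t => `|C|%:E * (\1_(vec @^-1` U) t)%:E)%E).
  rewrite integralZl//.
    rewrite integral_indic// setIT.
    apply: lte_mul_pinfty => //.
    exact: bounded_set_measure_lty.
  apply/integrableP; split; first exact/measurable_EFinP/measurable_indic.
  rewrite (eq_integral (fun t => (\1_(vec @^-1` U) t)%:E)).
    by rewrite integral_indic// setIT; exact: bounded_set_measure_lty.
  by move=> t _; rewrite gee0_abs.
move=> t _ /=; rewrite normrM EFinM; congr (_ * _)%E.
by rewrite ger0_norm.
Qed.

Lemma integrable_le U f (C : R) : bounded_set U -> measurable (@vec R n @^-1` U) ->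
  measurable_fun setT (fun t => f (vec t)) -> (forall x, `|f x| <= C * \1_U x) ->
  mu.-integrable setT (fun t => (f (vec t))%:E).
Proof.
move=> bU mU mf fC; apply: le_integrable (integrable_indic_bound C bU mU) => //.
  exact/measurable_EFinP.
by move=> t _ /=; rewrite lee_fin (le_trans (fC _))// ler_norm.
Qed.

Lemma integral_dominated U (F : nat -> 'rV[R]_n -> R) f (C : R) :
  bounded_set U -> measurable (@vec R n @^-1` U) ->
  (forall k, measurable_fun setT (fun t => F k (vec t))) ->
  (forall x, F ^~ x @ \oo --> f x) ->
  (\forall k \near \oo, forall x, `|F k x| <= C * \1_U x) ->
  (fun k => \int[mu]_t (F k (vec t))%:E)%E @ \oo --> (\int[mu]_t (f (vec t))%:E)%E.
Proof.
move=> bU mU mF Ff [k0 _ FC]; rewrite -(cvg_shiftn k0).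
have mf : measurable_fun setT (fun t => f (vec t)).
  by apply: (measurable_fun_cvg mF) => t _; exact: Ff.
have [] := @dominated_convergence _ _ _ mu setT measurableT
  (fun k t => (F (k + k0)%N (vec t))%:E) (fun t => (f (vec t))%:E)
  (fun t => (C * \1_U (vec t))%:E).
- by move=> k; exact/measurable_EFinP.
- exact/measurable_EFinP.
- apply: aeW => t _; apply: cvg_EFin; first by apply: nearW => k.
  by have := Ff (vec t); rewrite -(cvg_shiftn k0); exact.
- exact: integrable_indic_bound.
- by apply: aeW => t k _ /=; rewrite lee_fin; apply: FC => /=; rewrite leq_addl.
by [].
Qed.

(* A translation moves the difference quotient from the test function to u,
   where the quotients are bounded by L; dominated convergence then makes their
   pointwise limit g the weak derivative. *)
Section quotient.
Variables (U : set 'rV[R]_n) (u g : 'rV[R]_n -> R) (i : 'I_n) (M L : R).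
Hypotheses (oU : open U) (bU : bounded_set U).
Hypothesis mu_ : measurable_fun (vec @^-1` U) (fun t => u (vec t)).
Hypothesis uM : forall x, U x -> `|u x| <= M.
(** Asked only along axis segments contained in [U]: the set need not be convex, and [u] may take
    very different values at close points on the two sides of a slit. *)
Hypothesis uL : forall x h, 0 <= h -> (forall s, 0 <= s <= h -> U (x - s *: delta_mx 0 i)) ->
  `|u x - u (x - h *: delta_mx 0 i)| <= L * h.
Hypothesis ug : forall x, U x ->
  (fun k => k.+1%:R * (u x - u (x - k.+1%:R^-1 *: delta_mx 0 i))) @ \oo --> g x.

Let mU : measurable (@vec R n @^-1` U) := open_measurable_vec oU.
Let e : 'rV[R]_n := delta_mx 0 i.
Let a (k : nat) : R := k.+1%:R^-1.

Let a_gt0 k : 0 < a k. Proof. by rewrite invr_gt0. Qed.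

Let x_shrink x : U x -> \forall k \near \oo, forall s, 0 <= s <= a k -> U (x - s *: e).
Proof.
move=> Ux; have := compact_shrink i (@compact_set1 _ x) oU.
have xU : [set x] `<=` U by move=> _ ->.
by move=> /(_ xU) [k0 _ H]; exists k0 => // k kk0; apply: H.
Qed.

Let cvg_patch x : U x ->
  (fun k => k.+1%:R * ((u \_ U) x - (u \_ U) (x - a k *: e))) @ \oo --> g x.
Proof.
move=> Ux; have [k0 _ H] := x_shrink Ux.
apply: cvg_trans (ug Ux); apply: near_eq_cvg; exists k0 => // k /H kU /=.
rewrite /patch mem_set// mem_set//.
by have := kU (a k); rewrite lexx ltW//; exact.
Qed.

Let g_le x : U x -> `|g x| <= L.
Proof.
move=> Ux; have [k0 _ H] := x_shrink Ux.
have cg : (fun k => `|k.+1%:R * (u x - u (x - k.+1%:R^-1 *: delta_mx 0 i))|) @ \oo --> `|g x|.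
  exact: (cvg_norm (ug Ux)).
rewrite -(cvg_lim _ cg)//; apply: limr_le; first by apply/cvg_ex; eexists; exact: cg.
exists k0 => // k /H kU /=; rewrite normrM ger0_norm//.
have := uL (ltW (a_gt0 k)) kU => H'.
by rewrite -ler_pdivlMl// mulrC.
Qed.

Lemma measurable_quotient_limit : measurable_fun (vec @^-1` U) (fun t => g (vec t)).
Proof.
apply: (@measurable_fun_cvg _ _ R _ (fun k t => k.+1%:R * ((u \_ U) (vec t) - (u \_ U) (vec t - a k *: e)))).
  move=> k; apply: measurable_funTS; apply: measurable_funM => //; apply: measurable_funB.
    exact: measurable_patch.
  exact: (@measurable_shift (u \_ U) (- (a k *: e)) (measurable_patch mU mu_)).
by move=> t Ut; exact: cvg_patch.
Qed.

Lemma L2_quotient_limit : L2 U g.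
Proof.
split; first exact: measurable_quotient_limit.
rewrite integral_Rn_patch.
have mg := measurable_patch mU measurable_quotient_limit.
have H : mu.-integrable setT (fun t => (((fun x => g x ^+ 2) \_ U) (vec t))%:E).
  apply: (@integrable_le U _ (L ^+ 2)) => //.
    rewrite (_ : (fun _ => _) = (fun t => (g \_ U) (vec t) ^+ 2)); first exact: measurable_funX.
    by apply/funext => t; rewrite /patch; case: ifP => //; rewrite expr0n.
  move=> x; rewrite /patch indicE; case: ifPn => Ux; last by rewrite normr0 mulr0.
  rewrite mulr1 normrX; have := g_le (set_mem Ux) => gL.
  by rewrite lerXn2r// nnegrE// (le_trans _ gL).
move/integrableP : H => [_]; apply: le_lt_trans; apply: ge0_le_integral => //.
- by move=> t _; rewrite lee_fin /patch; case: ifP => // _; exact: sqr_ge0.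
- apply/measurable_EFinP.
  rewrite (_ : (fun _ => _) = (fun t => (g \_ U) (vec t) ^+ 2)); first exact: measurable_funX.
  by apply/funext => t; rewrite /patch; case: ifP => //; rewrite expr0n.
- apply/measurable_EFinP; apply: measurableT_comp => //.
  rewrite (_ : (fun _ => _) = (fun t => (g \_ U) (vec t) ^+ 2)); first exact: measurable_funX.
  by apply/funext => t; rewrite /patch; case: ifP => //; rewrite expr0n.
- by move=> t _; rewrite lee_fin ler_norm.
Qed.

Lemma integral_by_parts_quotient phi : test_fun U phi ->
  integral_Rn U (fun x => u x * pderive i phi x) =
  ((-1)%:E * integral_Rn U (fun x => g x * phi x)%R)%E.
Proof.
move=> tphi; have [sphi [K [cK KU K0]]] := tphi.
have [S S0 phiS] := test_fun_bounded tphi.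
have [S' S'0 dphiS] := test_fun_bounded (test_fun_pderive i tphi).
have [cphi dphi] := sphi [::].
have mphi : measurable_fun setT (fun t => phi (vec t)) by exact: continuous_measurable_vec.
have mu' := measurable_patch mU mu_.
have M0 : forall x, U x -> 0 <= M by move=> x Ux; exact: le_trans (uM Ux).
have uM' x : `|(u \_ U) x| <= `|M|.
  rewrite /patch; case: ifPn => [/set_mem Ux|_]; last by rewrite normr0.
  by rewrite (le_trans (uM Ux))// ler_norm.
pose A k x := (u \_ U) x * (k.+1%:R * (phi (x + a k *: e) - phi x)).
pose B k x := (k.+1%:R * ((u \_ U) (x - a k *: e) - (u \_ U) x)) * phi x.
have mphia k : measurable_fun setT (fun t => phi (vec t + a k *: e)) by exact: measurable_shift.
have mua k : measurable_fun setT (fun t => (u \_ U) (vec t - a k *: e)).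
  exact: (@measurable_shift (u \_ U) (- (a k *: e))).
have A_cvg : (fun k => \int[mu]_t (A k (vec t))%:E)%E @ \oo -->
    integral_Rn U (fun x => u x * pderive i phi x).
  rewrite integral_Rn_patch; apply: (@integral_dominated U _ _ (`|M| * S')) => //.
  - by move=> k; apply: measurable_funM => //; apply: measurable_funM => //; exact: measurable_funB.
  - move=> x; rewrite /A /patch; case: ifPn => Ux; last first.
      by under eq_fun do rewrite mul0r; exact: cvg_cst.
    apply: cvgM; first exact: cvg_cst.
    rewrite (_ : (fun k => _) = fun k => (a k)^-1 * (phi (x + a k *: e) - phi x)).
      apply: derivable_quotient; first exact: dphi.
        by move=> k; rewrite gt_eqF.
      exact: cvg_harmonic.
    by apply/funext => k; rewrite /a invrK.
  - apply: nearW => k x; rewrite /A /patch indicE; case: ifPn => Ux; last first.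
      by rewrite mul0r normr0 mulr0.
    rewrite mulr1 normrM ler_pM//.
      by apply: (le_trans (uM (set_mem Ux))); exact: ler_norm.
    rewrite normrM ger0_norm// -ler_pdivlMl// mulrC.
    by apply: pderive_lip => //; exact: ltW.
have B_cvg : (fun k => \int[mu]_t (B k (vec t))%:E)%E @ \oo -->
    integral_Rn U (fun x => - 1 * (g x * phi x)).
  rewrite integral_Rn_patch; apply: (@integral_dominated U _ _ (L * S)) => //.
  - by move=> k; apply: measurable_funM => //; apply: measurable_funM => //; exact: measurable_funB.
  - move=> x; rewrite /B [X in _ --> X]/patch; case: ifPn => Ux; last first.
      rewrite (K0 x); last by move=> /KU /mem_set; exact/negP.
      by under eq_fun do rewrite mulr0; exact: cvg_cst.
    rewrite mulrA; apply: cvgM; last exact: cvg_cst.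
    rewrite mulN1r (_ : (fun k => _) = fun k => - (k.+1%:R * ((u \_ U) x - (u \_ U) (x - a k *: e)))).
      by apply: cvgN; exact: cvg_patch (set_mem Ux).
    by apply/funext => k; rewrite -mulrN opprB.
  - have [k0 _ kU] := compact_shrink i cK oU KU; exists k0 => // k /kU kU' x.
    have [Kx|Kx] := pselect (K x); last first.
      rewrite /B K0// mulr0 normr0 indicE; have [Ux|Ux] := boolP (x \in U); last by rewrite mulr0.
      have L0 : 0 <= L by exact: le_trans (g_le (set_mem Ux)).
      by rewrite mulr1 mulr_ge0 // ltW.
    have Ux := KU _ Kx; rewrite indicE mem_set// mulr1 /B normrM ler_pM//.
    have Uxk : U (x - a k *: e) by apply: kU' => //; rewrite lexx ltW.
    rewrite /patch !mem_set// normrM ger0_norm// -ler_pdivlMl// mulrC distrC.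
    by apply: uL; [exact: ltW|exact: kU'].
have AB k : (\int[mu]_t (A k (vec t))%:E = \int[mu]_t (B k (vec t))%:E)%E.
  (* [A k] is [H - P], and [B k] is the translate of [H] minus [P]. Translation invariance equates
     the integrals once the three pieces are separately integrable. *)
  pose H x := k.+1%:R * (u \_ U) x * phi (x + a k *: e).
  pose P x := k.+1%:R * (u \_ U) x * phi x.
  have mH : measurable_fun setT (fun t => H (vec t)).
    by apply: measurable_funM => //; exact: measurable_funM.
  have mP : measurable_fun setT (fun t => P (vec t)).
    by apply: measurable_funM => //; exact: measurable_funM.
  have Hshift x : H (x - a k *: e) = k.+1%:R * (u \_ U) (x - a k *: e) * phi x.
    by rewrite /H subrK.
  have iH : mu.-integrable setT (fun t => (H (vec t))%:E).
    apply: (@integrable_le U _ (k.+1%:R * `|M| * S)) => // x.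
    rewrite /H indicE; have [Ux|Ux] := boolP (x \in U); last first.
      by rewrite /patch (negbTE Ux) mulr0 mul0r normr0 mulr0.
    by rewrite mulr1 !normrM ler_pM// ler_pM// ger0_norm.
  have iP : mu.-integrable setT (fun t => (P (vec t))%:E).
    apply: (@integrable_le U _ (k.+1%:R * `|M| * S)) => // x.
    rewrite /P indicE; have [Ux|Ux] := boolP (x \in U); last first.
      by rewrite /patch (negbTE Ux) mulr0 mul0r normr0 mulr0.
    by rewrite mulr1 !normrM ler_pM// ler_pM// ger0_norm.
  have iHs : mu.-integrable setT (fun t => (H (vec t - a k *: e))%:E).
    apply: (@integrable_le U (fun x => H (x - a k *: e)) (k.+1%:R * `|M| * S)) => //.
      exact: (@measurable_shift H (- (a k *: e))).
    move=> x; rewrite Hshift indicE; have [Ux|Ux] := boolP (x \in U); last first.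
      rewrite K0; last by move=> /KU /mem_set; exact/negP.
      by rewrite mulr0 normr0 mulr0.
    by rewrite mulr1 !normrM ler_pM// ler_pM// ger0_norm.
  transitivity (\int[mu]_t (H (vec t))%:E - \int[mu]_t (P (vec t))%:E)%E.
    rewrite -integralB//; apply: eq_integral => t _.
    by rewrite -EFinB /A /H /P; congr (_%:E); ring.
  rewrite -(@integral_shift H (- (a k *: e)))// -integralB//; apply: eq_integral => t _.
  by rewrite -EFinB Hshift /B /P; congr (_%:E); ring.
have -> : integral_Rn U (fun x => u x * pderive i phi x) =
    integral_Rn U (fun x => - 1 * (g x * phi x)).
  move: A_cvg; rewrite (eq_cvg _ _ AB) => A_cvg.
  exact: (cvg_unique (@ereal_hausdorff R) A_cvg B_cvg).
rewrite !integral_Rn_patch -integralZl//.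
  apply: eq_integral => t _; rewrite -EFinM; congr (_%:E).
  by rewrite /patch; case: ifP => // _; rewrite mulr0.
have mg := measurable_patch mU measurable_quotient_limit.
apply: (@integrable_le U _ (L * S)) => //.
  rewrite (_ : (fun _ => _) = (fun t => (g \_ U) (vec t) * phi (vec t))).
    exact: measurable_funM.
  by apply/funext => t; rewrite /patch; case: ifP => // _; rewrite mul0r.
move=> x; rewrite /patch indicE; case: ifPn => Ux; last by rewrite normr0 mulr0.
by rewrite mulr1 normrM ler_pM// g_le//; exact: set_mem.
Qed.

End quotient.

End weak_derivative.

(** * Lipschitz bounds across a finite closed cover of an interval *)

Section chain.
Context (R : realType).

Lemma closed_approx (V : pseudoMetricType R) (C : set V) t : closed C ->
  (forall e : R, 0 < e -> exists2 x, C x & ball t e x) -> C t.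
Proof.
move=> cC H; apply: cC => B /nbhs_ballP[e /= e0 eB].
by have [x Cx tx] := H e e0; exists x; split => //; apply: eB.
Qed.

Lemma closed_inf (B : set R) : closed B -> has_inf B -> B (inf B).
Proof.
move=> cB iB; apply: (closed_approx cB) => e e0.
have [x Bx xe] := inf_adherent e0 iB; exists x => //.
have := ge_inf iB.2 Bx => ix.
by rewrite /ball/= ltr_distlC; apply/andP; split; lra.
Qed.

Lemma closed_sup (B : set R) : closed B -> has_sup B -> B (sup B).
Proof.
move=> cB iB; apply: (closed_approx cB) => e e0.
have [x Bx xe] := sup_adherent e0 iB; exists x => //.
have := ub_le_sup iB.2 Bx => ix.
by rewrite /ball/= ltr_distlC; apply/andP; split; lra.
Qed.

(** Induction on the cover. Between the first and the last point of [A i] in the interval a single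
    use of the bound suffices, whatever gaps [A i] has. On either side the other sets cover, up to
    and including the endpoints because their union is closed. *)
Lemma chain_lip (I : choiceType) (s : seq I) (A : I -> set R) (F : R -> R) (L a b : R) :
  (forall i, closed (A i)) -> a <= b ->
  (forall x, a <= x <= b -> exists2 i, i \in s & A i x) ->
  (forall i x y, A i x -> A i y -> a <= x <= b -> a <= y <= b -> `|F x - F y| <= L * `|x - y|) ->
  `|F b - F a| <= L * (b - a).
Proof.
move=> cA; elim: s a b => [|i s IH] a b ab cov FL.
  by have [] := cov a; rewrite ?lexx.
pose B := A i `&` `[a, b]%classic.
have [B0|/set0P[x0 Bx0]] := eqVneq B set0.
  apply: IH => // x xab; have [j] := cov _ xab.
  rewrite inE => /orP[/eqP -> Ax|js Ajx]; last by exists j.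
  suff : B x by rewrite B0.
  by split => //=; rewrite in_itv.
have cB : closed B by apply: closedI => //; exact: interval_closed.
have iB : has_inf B.
  by split; [exists x0|exists a => x [_ /=]; rewrite in_itv/= => /andP[]].
have sB : has_sup B.
  by split; [exists x0|exists b => x [_ /=]; rewrite in_itv/= => /andP[]].
have := closed_inf cB iB; have := closed_sup cB sB.
set u := sup B; set t := inf B => Bu Bt.
have [Au /=] := Bu; rewrite in_itv/= => /andP[au ub].
have [At /=] := Bt; rewrite in_itv/= => /andP[at_ tb].
have tu : t <= u by apply: ub_le_sup => //; exact: sB.2.
pose C := \big[setU/set0]_(j <- s) A j.
have cC : closed C by apply: closed_bigsetU.
have CP x : C x <-> exists2 j, j \in s & A j x by rewrite /C -bigcup_seq; split=> -[j]; exists j.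
have outB x : a <= x <= b -> x < t \/ u < x -> C x.
  move=> xab xtu; have [j] := cov _ xab; rewrite inE => /orP[/eqP -> Ax|js Ajx].
    have Bx : B x by split => //=; rewrite in_itv.
    have := ge_inf iB.2 Bx; have := ub_le_sup sB.2 Bx; rewrite -/u -/t.
    by case: xtu => ? ? ?; lra.
  by apply/CP; exists j.
have H1 : `|F t - F a| <= L * (t - a).
  have [<-|at'] := eqVneq a t; first by rewrite !subrr normr0 mulr0.
  have at1 : a < t by rewrite lt_neqAle at' at_.
  apply: IH => // [x /andP[ax xt]|j x y Ajx Ajy /andP[ax xt] /andP[ay yt]]; last first.
    by apply: (FL j) => //; apply/andP; split => //; lra.
  apply/CP; have [->|xt'] := eqVneq x t; last first.
    by apply: outB; [apply/andP; split; lra|left; rewrite lt_neqAle xt' xt].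
  apply: (closed_approx cC) => e e0.
  pose y := Num.max a (t - e / 2).
  have y1 : a <= y by rewrite le_max lexx.
  have y2 : t - e / 2 <= y by rewrite le_max lexx orbT.
  have y3 : y < t by rewrite gt_max at1/=; lra.
  exists y; first by apply: outB; [apply/andP; split; lra|left].
  by rewrite /ball/= ltr_distlC; apply/andP; split; lra.
have H2 : `|F u - F t| <= L * (u - t).
  have := FL i u t Au At; rewrite (ger0_norm (x := u - t)) ?subr_ge0//; apply.
    by rewrite au ub.
  by rewrite at_ tb.
have H3 : `|F b - F u| <= L * (b - u).
  have [<-|ub'] := eqVneq u b; first by rewrite !subrr normr0 mulr0.
  have ub1 : u < b by rewrite lt_neqAle ub' ub.
  apply: IH => // [x /andP[ux xb]|j x y Ajx Ajy /andP[ux xb] /andP[uy yb]]; last first.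
    by apply: (FL j) => //; apply/andP; split => //; lra.
  apply/CP; have [->|xu'] := eqVneq x u; last first.
    by apply: outB; [apply/andP; split; lra|right; rewrite lt_neqAle eq_sym xu' ux].
  apply: (closed_approx cC) => e e0.
  pose y := Num.min b (u + e / 2).
  have y1 : y <= b by rewrite ge_min lexx.
  have y2 : y <= u + e / 2 by rewrite ge_min lexx orbT.
  have y3 : u < y by rewrite lt_min ub1/=; lra.
  exists y; first by apply: outB; [apply/andP; split; lra|right].
  by rewrite /ball/= ltr_distlC; apply/andP; split; lra.
rewrite (_ : F b - F a = (F b - F u) + ((F u - F t) + (F t - F a))); last by ring.
apply: le_trans (ler_normD _ _) _; have := ler_normD (F u - F t) (F t - F a).
rewrite (_ : L * (b - a) = L * (b - u) + (L * (u - t) + L * (t - a))); last by ring.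
by move=> H; rewrite lerD// (le_trans H)// lerD.
Qed.

End chain.

Section polynomial_bounds.
Context (R : realType) (n : nat).
Implicit Types (U : set 'rV[R]_n) (P : seq (R * seq (aff R n))) (x y : 'rV[R]_n).

Definition bounded_lip U (f : 'rV[R]_n -> R) :=
  exists M L : R, [/\ 0 <= M, 0 <= L, forall x, U x -> `|f x| <= M &
    forall x y, U x -> U y -> `|f x - f y| <= L * \sum_i `|x 0 i - y 0 i|].

Lemma bounded_lipD U f g : bounded_lip U f -> bounded_lip U g ->
  bounded_lip U (fun x => f x + g x).
Proof.
move=> [M [L [M0 L0 fM fL]]] [M' [L' [M0' L0' gM gL]]].
exists (M + M'), (L + L'); split; rewrite ?addr_ge0//.
  by move=> x Ux; rewrite (le_trans (ler_normD _ _))// lerD ?fM ?gM.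
move=> x y Ux Uy; rewrite opprD addrACA mulrDl (le_trans (ler_normD _ _))// lerD//.
  exact: fL.
exact: gL.
Qed.

Lemma bounded_lipM U f g : bounded_lip U f -> bounded_lip U g ->
  bounded_lip U (fun x => f x * g x).
Proof.
move=> [M [L [M0 L0 fM fL]]] [M' [L' [M0' L0' gM gL]]].
exists (M * M'), (L * M' + M * L'); split; rewrite ?addr_ge0 ?mulr_ge0//.
  by move=> x Ux; rewrite normrM ler_pM// ?fM ?gM.
move=> x y Ux Uy.
rewrite (_ : _ - _ = (f x - f y) * g x + f y * (g x - g y)); last by ring.
apply: le_trans (ler_normD _ _) _; rewrite !normrM mulrDl lerD//.
  by rewrite mulrAC ler_pM// ?fL ?gM.
by rewrite -mulrA ler_pM// ?gL ?fM.
Qed.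

Lemma bounded_lip_cst U c : bounded_lip U (fun=> c).
Proof.
exists `|c|, 0; split => // x y _ _.
by rewrite subrr normr0 mul0r.
Qed.

Lemma bounded_lip_aff U (l : aff R n) : bounded_set U -> bounded_lip U (aff_eval l).
Proof.
move=> /bounded_set_coord[X X0 UX].
exists (\sum_k `|l.1 0 k| * X + `|l.2|), (\sum_k `|l.1 0 k|); split.
- by rewrite addr_ge0// sumr_ge0// => k _; rewrite mulr_ge0// ltW.
- exact: sumr_ge0.
- move=> x Ux; rewrite (le_trans (ler_normD _ _))// lerD//.
  apply: le_trans (ler_norm_sum _ _ _) _; apply: ler_sum => k _.
  by rewrite normrM ler_wpM2l// UX.
- move=> x y Ux Uy; apply: aff_eval_lip => i.
  by rewrite (bigD1 i)//= lerDl sumr_ge0.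
Qed.

Lemma bounded_lip_sp U P : bounded_set U -> bounded_lip U (sp_eval P).
Proof.
move=> bU; elim: P => [|q P IH].
  rewrite (_ : sp_eval _ = fun=> 0); first exact: bounded_lip_cst.
  by apply/funext => y; rewrite /sp_eval big_nil.
rewrite (_ : sp_eval _ = fun x => q.1 * aff_prod q.2 x + sp_eval P x); last first.
  by apply/funext => y; rewrite sp_eval_cons.
apply: bounded_lipD IH; apply: bounded_lipM; first exact: bounded_lip_cst.
elim: q.2 => [|l t IHt].
  rewrite (_ : aff_prod _ = fun=> 1); first exact: bounded_lip_cst.
  by apply/funext => y; rewrite /aff_prod big_nil.
rewrite (_ : aff_prod _ = fun x => aff_eval l x * aff_prod t x); last first.
  by apply/funext => y; rewrite /aff_prod big_cons.
by apply: bounded_lipM => //; exact: bounded_lip_aff.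
Qed.

Lemma sum_dist_line x (s t : R) (i : 'I_n) :
  \sum_j `|(x - s *: delta_mx 0 i) 0 j - (x - t *: delta_mx 0 i) 0 j| = `|s - t|.
Proof.
rewrite (bigD1 i)//= big1 ?addr0 => [|j /negbTE ji]; rewrite !mxE ?eqxx ?ji ?andbF/=.
  by rewrite !mulr1 (_ : _ - _ - _ = t - s) 1?distrC//; ring.
by rewrite !mulr0 subrr normr0.
Qed.

Lemma sp_quotient P x (i : 'I_n) :
  (fun k => k.+1%:R * (sp_eval P x - sp_eval P (x - k.+1%:R^-1 *: delta_mx 0 i))) @ \oo -->
  sp_eval (sp_deriv i P) x.
Proof.
have [d <-] := is_derive_sp_eval P x i.
have := @derivable_quotient R n (sp_eval P) x i (fun k => - k.+1%:R^-1) d.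
rewrite (_ : (fun k => _ * (_ - _)) = (fun k =>
  k.+1%:R * (sp_eval P x - sp_eval P (x - k.+1%:R^-1 *: delta_mx 0 i)))); last first.
  by apply/funext => k; rewrite invrN invrK scaleNr mulNr -mulrN opprB.
apply=> [k|]; first by rewrite oppr_eq0 invr_eq0 pnatr_eq0.
rewrite -oppr0; apply: cvgN; exact: cvg_harmonic.
Qed.

End polynomial_bounds.

Section sobolev_functions.
Context (R : realType) (n : nat).
Implicit Types (U : set 'rV[R]_n) (f u g phi : 'rV[R]_n -> R) (x y : 'rV[R]_n).
Implicit Types (P : seq (R * seq (aff R n))).

Lemma eq_integral_Rn U f g : (forall x, U x -> f x = g x) -> integral_Rn U f = integral_Rn U g.
Proof.
move=> fg; apply: eq_integral => t /set_mem Ut; congr (_%:E); exact: fg.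
Qed.

Lemma measurable_fun_sqr U f : measurable_fun (@vec R n @^-1` U) (fun t => f (vec t)) ->
  measurable_fun (@vec R n @^-1` U) (fun t => ((f (vec t)) ^+ 2)%:E).
Proof. by move=> mf; apply/measurable_EFinP; exact: measurable_funX. Qed.

Lemma integral_Rn_sqr_le U f (M V : R) : measurable (@vec R n @^-1` U) ->
  measurable_fun (vec @^-1` U) (fun t => f (vec t)) -> (forall x, U x -> `|f x| <= M) ->
  (lebesgue_Rn R n (vec @^-1` U) <= V%:E)%E ->
  (integral_Rn U (fun x => f x ^+ 2)%R <= (M ^+ 2 * V)%:E)%E.
Proof.
move=> mU mf fM muV.
apply: (@le_trans _ _ (\int[lebesgue_Rn R n]_(t in vec @^-1` U) (M ^+ 2)%:E)%E).
  apply: ge0_le_integral => //.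
  - by move=> t _; rewrite lee_fin sqr_ge0.
  - exact: measurable_fun_sqr.
  - move=> t Ut; rewrite lee_fin -[leLHS]ger0_norm ?sqr_ge0// normrX.
    have fMt := fM _ Ut; rewrite lerXn2r// nnegrE//.
    exact: le_trans fMt.
rewrite integral_cst// [leRHS]EFinM; apply: lee_wpmul2l => //.
by rewrite lee_fin sqr_ge0.
Qed.

Lemma L2_bounded U f (M : R) : measurable (@vec R n @^-1` U) -> bounded_set U ->
  measurable_fun (vec @^-1` U) (fun t => f (vec t)) -> (forall x, U x -> `|f x| <= M) -> L2 U f.
Proof.
move=> mU bU mf fM; split => //.
have muU := bounded_set_measure_lty bU mU.
apply: le_lt_trans (@integral_Rn_sqr_le U f M (fine (lebesgue_Rn R n (vec @^-1` U))) mU mf fM _) _.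
  by rewrite fineK// ge0_fin_numE.
by rewrite ltry.
Qed.

Lemma mderiveE (a : 'I_n -> nat) : exists2 s : seq 'I_n, size s = morder a &
  forall f, mderive a f = pderives s f.
Proof.
exists (flatten [seq nseq (a i) i | i <- enum 'I_n]) => //.
rewrite size_flatten /shape -map_comp sumnE big_map big_enum/=.
by apply: eq_bigr => i _; rewrite size_nseq.
Qed.

(** A left fold, whereas [pderives] is a right fold: each integration by parts moves the outermost
    derivative of the test function onto the polynomial. *)
Definition sp_derivs (s : seq 'I_n) P := foldl (fun Q i => sp_deriv i Q) P s.

Lemma sp_parts U P s phi : open U -> bounded_set U -> test_fun U phi ->
  integral_Rn U (fun x => sp_eval P x * pderives s phi x) =
  (((-1) ^+ size s)%:E * integral_Rn U (fun x => sp_eval (sp_derivs s P) x * phi x)%R)%E.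
Proof.
move=> oU bU tphi; elim: s P => [|i s IH] P; first by rewrite /= expr0 mul1e.
have tsphi : test_fun U (pderives s phi).
  by elim: (s) => [//|j s' IHs]; exact: test_fun_pderive.
have [M [L [M0 L0 PM PL]]] := @bounded_lip_sp R n U P bU.
rewrite (@integral_by_parts_quotient _ _ U _ (sp_eval (sp_deriv i P)) i M L)//.
- by rewrite IH/= exprS EFinM muleA.
- exact: measurable_sp_eval.
- move=> x h h0 Ux; rewrite (le_trans (PL _ _ _ _))//.
  + by have := Ux 0; rewrite scale0r subr0 lexx h0; exact.
  + by apply: Ux; rewrite h0 lexx.
  + have := sum_dist_line x 0 h i; rewrite scale0r subr0 => ->.
    by rewrite sub0r normrN ger0_norm.
- by move=> x _; exact: sp_quotient.
Qed.

Lemma weak_deriv_sp U u P (a : 'I_n -> nat) s : open U -> bounded_set U ->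
  (forall x, U x -> u x = sp_eval P x) -> size s = morder a ->
  (forall f, mderive a f = pderives s f) -> weak_deriv U a u (sp_eval (sp_derivs s P)).
Proof.
move=> oU bU uP ss as_ phi tphi; rewrite -ss -sp_parts//.
by apply: eq_integral_Rn => x Ux; rewrite uP// as_.
Qed.

Lemma L2_sp U u P : open U -> bounded_set U -> (forall x, U x -> u x = sp_eval P x) -> L2 U u.
Proof.
move=> oU bU uP; have [M [L [M0 L0 PM PL]]] := @bounded_lip_sp R n U P bU.
apply: (@L2_bounded _ _ M) => //; first exact: open_measurable_vec.
  apply: (eq_measurable_fun (fun t => sp_eval P (vec t))); last exact: measurable_sp_eval.
  by move=> t /set_mem Ut; rewrite uP.
by move=> x Ux; rewrite uP//; exact: PM.
Qed.

Lemma sobolev_sp m U u P : open U -> bounded_set U ->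
  (forall x, U x -> u x = sp_eval P x) -> sobolev m U u.
Proof.
move=> oU bU uP; split; first exact: L2_sp uP.
move=> a _; have [s ss as_] := mderiveE a.
exists (sp_eval (sp_derivs s P)); first exact: (@L2_sp U _ (sp_derivs s P)).
exact: weak_deriv_sp.
Qed.

(** The seminorm is an infimum over choices of weak derivatives, so exhibiting the classical ones
    bounds it from above; [m.+1 ^ n] bounds the number of multi-indices. *)
Lemma sobolev_seminorm2_le m U u P (M V : R) : open U -> bounded_set U ->
  (forall x, U x -> u x = sp_eval P x) ->
  (forall s x, size s = m -> U x -> `|sp_eval (sp_derivs s P) x| <= M) ->
  (lebesgue_Rn R n (vec @^-1` U) <= V%:E)%E ->
  (sobolev_seminorm2 m U u <= ((m.+1 ^ n)%:R * (M ^+ 2 * V))%:E)%E.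
Proof.
move=> oU bU uP PM muV; have mU := open_measurable_vec oU.
have V0 : 0 <= V by rewrite -lee_fin; apply: le_trans muV.
have /(_ _)/cid2 sH (b : {ffun 'I_n -> 'I_m.+1}) := mderiveE (fun i => b i).
pose s b := s2val (sH b); have ss b : size (s b) = morder (fun i => b i) := s2valP (sH b).
apply: (@le_trans _ _ (\sum_(b : {ffun 'I_n -> 'I_m.+1} | morder (fun i => b i) == m)
               integral_Rn U (fun x => sp_eval (sp_derivs (s b) P) x ^+ 2)%R)%E).
  apply: ereal_inf_lbound => /=; exists (fun b => sp_eval (sp_derivs (s b) P)); split => //.
    exact: sobolev_sp uP.
  move=> b bm; split; first exact: (@L2_sp U _ (sp_derivs (s b) P)).
  by apply: weak_deriv_sp => //; exact: s2valP' (sH b).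
apply: (@le_trans _ _ (\sum_(b : {ffun 'I_n -> 'I_m.+1} | morder (fun i => b i) == m)
    (M ^+ 2 * V)%:E)%E).
  apply: lee_sum => b /eqP bm; apply: integral_Rn_sqr_le => //.
    exact: measurable_sp_eval.
  by move=> x Ux; apply: PM => //; rewrite ss.
rewrite sumEFin lee_fin big_const iter_addr addr0 -[leLHS]mulr_natl; apply: ler_wpM2r.
  by rewrite mulr_ge0// sqr_ge0.
rewrite ler_nat; apply: leq_trans (max_card _) _.
by rewrite card_ffun !card_ord.
Qed.

Lemma sobolev_seminorm2_0 m U u : open U -> bounded_set U -> (forall x, U x -> u x = 0) ->
  (sobolev_seminorm2 m U u <= 0)%E.
Proof.
move=> oU bU u0; have muU := bounded_set_measure_lty bU (open_measurable_vec oU).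
have := @sobolev_seminorm2_le m U u [::] 0 (fine (lebesgue_Rn R n (vec @^-1` U))) oU bU.
rewrite expr2 !mul0r mulr0; apply.
- by move=> x /u0 ->; rewrite /sp_eval big_nil.
- move=> s x _ _; rewrite (_ : sp_derivs s [::] = [::]); last by elim: s.
  by rewrite /sp_eval big_nil normr0.
- by rewrite fineK// ge0_fin_numE.
Qed.

End sobolev_functions.

(** * Continuous piecewise polynomials are in $H^1$ *)

Section glue.
Context (R : realType) (n : nat) (I : finType).
Variables (D : set 'rV[R]_n) (u : 'rV[R]_n -> R) (S : I -> set 'rV[R]_n).
Variable P : I -> seq (R * seq (aff R n)).
Hypotheses (oD : open D) (bD : bounded_set D).
Hypothesis cS : forall k, closed (S k).
Hypothesis convexS : forall k x y (s : R), S k x -> S k y -> 0 <= s <= 1 ->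
  S k (s *: x + (1 - s) *: y).
Hypothesis DS : forall x, D x -> exists k, S k x.
Hypothesis uP : forall k x, D x -> S k x -> u x = sp_eval (P k) x.

Let mD : measurable (@vec R n @^-1` D) := open_measurable_vec oD.

Let measurable_glue : measurable_fun (vec @^-1` D) (fun t => u (vec t)).
Proof.
move=> _ Y mY; rewrite (_ : _ `&` _ = \bigcup_(k in [set: I])
    (vec @^-1` (D `&` S k) `&` (fun t => sp_eval (P k) (vec t)) @^-1` Y)); last first.
  apply/seteqP; split => [t [Dt Yt]|t [k _ [[Dt St] Yt]]].
    have [k Sk] := DS Dt; exists k => //; split => //=.
    by rewrite -(uP Dt Sk).
  by split => //=; rewrite (uP Dt St).
apply: fin_bigcup_measurable => [|k _]; first exact: finite_finset.
apply: measurable_sp_eval => //; rewrite preimage_setI; apply: measurableI => //.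
exact: closed_measurable_vec.
Qed.

Let glue_bounds : exists M L : R, forall k,
  (forall x, D x -> `|sp_eval (P k) x| <= M) /\
  (forall x y, D x -> D y -> `|sp_eval (P k) x - sp_eval (P k) y| <= L * \sum_i `|x 0 i - y 0 i|).
Proof.
have /(_ _)/cid H k := @bounded_lip_sp R n D (P k) bD.
have /(_ _)/cid H' k := projT2 (H k).
exists (\sum_k projT1 (H k)), (\sum_k projT1 (H' k)) => k.
have [M0 L0 PM PL] := projT2 (H' k).
have Mk j : 0 <= projT1 (H j) by have [] := projT2 (H' j).
have Lk j : 0 <= projT1 (H' j) by have [] := projT2 (H' j).
split => [x Dx|x y Dx Dy].
  by rewrite (le_trans (PM _ Dx))// (bigD1 k)//= lerDl sumr_ge0// => j _; exact: Mk.
rewrite (le_trans (PL _ _ Dx Dy))// ler_wpM2r//; first exact: sumr_ge0.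
by rewrite (bigD1 k)//= lerDl sumr_ge0// => j _; exact: Lk.
Qed.

(** By pigeonhole some piece contains [z k] for infinitely many [k]. Being closed it contains [x],
    and being convex it then contains all later [z k], so the quotient is eventually that of one
    polynomial. As the quotient is one-sided, this works even where pieces meet. *)
Let glue_quotient x (i : 'I_n) : D x ->
  exists l : R, (fun k => k.+1%:R * (u x - u (x - k.+1%:R^-1 *: delta_mx 0 i))) @ \oo --> l.
Proof.
move=> Dx; pose z (k : nat) : 'rV[R]_n := x - k.+1%:R^-1 *: delta_mx 0 i.
have xD : [set x] `<=` D by move=> _ ->.
have [k0 _ kD] := compact_shrink i (@compact_set1 _ x) oD xD.
have Dz k : (k0 <= k)%N -> D (z k).
  by move=> k0k; apply: (kD k) => //; rewrite lexx invr_ge0 ler0n.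
have [j Sj] : exists j, forall m : nat, exists2 k, (m <= k)%N & S j (z k).
  apply: contrapT => /forallNP H.
  have /(_ _)/cid H' j : exists m : nat, forall k, (m <= k)%N -> ~ S j (z k).
    have /existsNP[m Hm] := H j; exists m => k mk Sk; apply: Hm; by exists k.
  pose m := (k0 + \sum_j projT1 (H' j))%N.
  have [j Sj] := DS (Dz m (leq_addr _ _)).
  apply: (projT2 (H' j) m) => //.
  by rewrite /m (bigD1 j)//= addnCA leq_addr.
have Sx : S j x.
  apply: (@closed_approx R 'rV[R]_n (S j) x (@cS j)) => e e0.
  have [k0' k0e] := natSinv_lt e0.
  have [k k0k Sk] := Sj k0'; exists (z k) => //.
  split => // a b; rewrite /ball/= /z !mxE opprB addrCA subrr addr0; apply: le_lt_trans k0e.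
  rewrite normrM ger0_norm ?invr_ge0 ?ler0n//.
  apply: (@le_trans _ _ (k.+1%:R^-1 * 1)); last by rewrite mulr1 lef_pV2 ?posrE// ler_nat.
  rewrite ler_wpM2l ?invr_ge0 ?ler0n//.
  by case: (_ && _); rewrite ?normr1 ?normr0.
have [k1 k01 Sk1] := Sj k0.
exists (sp_eval (sp_deriv i (P j)) x).
have H := @sp_quotient R n (P j) x i; apply: cvg_trans H; apply: near_eq_cvg.
exists k1 => // k /= k1k; rewrite (uP Dx Sx) (@uP j)//.
  by apply: Dz; rewrite (leq_trans k01).
have -> : x - k.+1%:R^-1 *: delta_mx 0 i =
   (k1.+1%:R / k.+1%:R) *: z k1 + (1 - k1.+1%:R / k.+1%:R) *: x.
  rewrite /z scalerBr scalerA -mulrA mulrCA divff ?pnatr_eq0// mulr1.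
  by rewrite addrAC -scalerDl subrKC scale1r.
apply: convexS => //.
by rewrite divr_ge0//= ler_pdivrMr ?ltr0n// mul1r ler_nat ltnS.
Qed.

(** Agreement with a polynomial on each closed piece forces agreement of the polynomials on
    overlaps. Hence [chain_lip] makes [u] Lipschitz along axis segments, and the pointwise limits of
    its quotients are weak derivatives. *)
Lemma sobolev_glue : sobolev 1 D u.
Proof.
have [M [L ML]] := glue_bounds.
have uM x : D x -> `|u x| <= M.
  by move=> Dx; have [k Sk] := DS Dx; rewrite (uP Dx Sk); exact: (ML k).1.
have L2u : L2 D u by exact: L2_bounded uM.
have uL i x h : 0 <= h -> (forall s, 0 <= s <= h -> D (x - s *: delta_mx 0 i)) ->
    `|u x - u (x - h *: delta_mx 0 i)| <= L * h.
  move=> h0 Dxh; pose F s := u (x - s *: delta_mx 0 i).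
  have := @chain_lip R I (enum I) (fun k => [set s | S k (x - s *: delta_mx 0 i)]) F L 0 h.
  rewrite /F scale0r !subr0 distrC; apply => //.
  - move=> k; apply: closed_comp (@cS k) => s _.
    by apply: cvgB; [exact: cvg_cst|apply: cvgZr_tmp; exact: cvg_id].
  - move=> s /Dxh /DS [k Sk]; exists k => //; exact: mem_enum.
  - move=> k s t Sks Skt sh th; rewrite (uP _ Sks) ?(uP _ Skt); try exact: Dxh.
    rewrite -(sum_dist_line x s t i); apply: (ML k).2; exact: Dxh.
split => // a; rewrite leq_eqVlt ltnS leqn0 => /orP[|/eqP a0]; last first.
  exists u => // phi tphi; rewrite a0 expr0 mul1e; apply: eq_integral_Rn => x _.
  by have [s] := mderiveE R a; rewrite a0 => /size0nil -> ->.
move=> /eqP a1; have [s] := mderiveE R a; rewrite a1.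
case: s => [//|i [|//]] _ as_.
pose g x := lim ((fun k => k.+1%:R * (u x - u (x - k.+1%:R^-1 *: delta_mx 0 i))) @ \oo).
have gE x : D x -> (fun k => k.+1%:R * (u x - u (x - k.+1%:R^-1 *: delta_mx 0 i))) @ \oo --> g x.
  by move=> /(glue_quotient i)[l ul]; rewrite /g (cvg_lim _ ul).
exists g; first by apply: (@L2_quotient_limit _ _ D u g i L) => //; exact: (uL i).
move=> phi tphi; rewrite a1 expr1 -(@integral_by_parts_quotient _ _ D u g i M L)//; last exact: (uL i).
by apply: eq_integral_Rn => x _; rewrite as_.
Qed.

End glue.

(** * Geometry of simplices *)

Section barycentric.
Context (R : realType) (n k : nat).
Implicit Types (A : 'M[R]_(k, n)) (x y : 'rV[R]_n).

(** The generalised inverse solves for weights that combine to [x] and sum to 1. Storing the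
    solution as an [aff] lets it serve as a factor in [aff_prod], with its gradient readable as
    [.1]. *)
Definition bary A (j : 'I_k) : aff R n :=
  let G := pinvmx (row_mx A (const_mx 1 : 'cV[R]_k)) in
  (\row_i G (lshift 1 i) j, G (rshift n 0) j).

Lemma baryE A j x :
  aff_eval (bary A j) x = (row_mx x (1%:M : 'M[R]_1) *m pinvmx (row_mx A (const_mx 1 : 'cV[R]_k))) 0 j.
Proof.
rewrite mxE big_split_ord/= big_ord1 /aff_eval/=; congr (_ + _).
  by apply: eq_bigr => i _; rewrite row_mxEl mxE mulrC.
by rewrite row_mxEr [1%:M _ _]mxE eqxx mulr1n mul1r.
Qed.

Lemma bary_comb A (w : 'rV[R]_k) j : affinely_independent A -> \sum_i w 0 i = 1 ->
  aff_eval (bary A j) (w *m A) = w 0 j.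
Proof.
move=> fA w1; rewrite baryE (_ : row_mx _ _ = w *m row_mx A (const_mx 1)).
  by rewrite -mulmxA mulmxVp// mulmx1.
rewrite mul_mx_row; congr row_mx; apply/matrixP => a b; rewrite !ord1 !mxE eqxx mulr1n.
transitivity (\sum_i w 0 i); first by rewrite w1.
by apply: eq_bigr => i _; rewrite mxE mulr1.
Qed.

Lemma simplex_row A j : simplex A (row j A).
Proof.
exists (delta_mx 0 j); split; last exact: rowE.
  by move=> i; rewrite mxE ler0n.
rewrite (bigD1 j)//= mxE !eqxx big1 ?addr0// => i /negbTE ij.
by rewrite mxE ij andbF.
Qed.

Lemma bary_row A i j : affinely_independent A -> aff_eval (bary A j) (row i A) = (i == j)%:R.
Proof.
move=> fA; rewrite rowE bary_comb// ?mxE ?eqxx/=; first by rewrite eq_sym.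
rewrite (bigD1 i)//= mxE !eqxx big1 ?addr0// => l /negbTE ij.
by rewrite mxE ij andbF.
Qed.

Lemma osimplex_simplex A : osimplex A `<=` simplex A.
Proof. by move=> x [w [w0 w1 ->]]; exists w; split => // i; exact: ltW. Qed.

Lemma simplex_convex A x y (s : R) : simplex A x -> simplex A y -> 0 <= s <= 1 ->
  simplex A (s *: x + (1 - s) *: y).
Proof.
move=> [w [w0 w1 ->]] [v [v0 v1 ->]] /andP[s0 s1]; exists (s *: w + (1 - s) *: v); split.
- by move=> i; rewrite !mxE addr_ge0// mulr_ge0// subr_ge0.
- under eq_bigr do rewrite !mxE; rewrite big_split/= -!mulr_sumr w1 v1.
  by rewrite !mulr1 addrC subrK.
- by rewrite mulmxDl -!scalemxAl.
Qed.

Lemma aff_eval_conv (l : aff R n) x y (s : R) :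
  aff_eval l (s *: x + (1 - s) *: y) = s * aff_eval l x + (1 - s) * aff_eval l y.
Proof.
rewrite /aff_eval !mulrDr !mulr_sumr addrACA -big_split/= -mulrDl subrKC mul1r.
congr (_ + _); apply: eq_bigr => i _; rewrite !mxE; ring.
Qed.

Lemma aff_evalB (l : aff R n) x y :
  aff_eval l x - aff_eval l y = \sum_i l.1 0 i * (x 0 i - y 0 i).
Proof.
rewrite /aff_eval opprD addrACA subrr addr0 -sumrB.
by apply: eq_bigr => i _; rewrite mulrBr.
Qed.

Lemma simplex_bounded A : bounded_set (simplex A).
Proof.
exists (\sum_j \sum_i `|A j i|); split; first exact: num_real.
move=> M MA x [w [w0 w1 xE]]; have M0 : 0 < M by apply: le_lt_trans MA; apply: sumr_ge0 => j _; exact: sumr_ge0.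
apply/ltW; suff : ball (0 : 'rV[R]_n) M x by rewrite -ball_normE/= sub0r normrN.
split => // a i; rewrite /ball/= ord1 mxE sub0r normrN xE mxE.
apply: le_lt_trans MA; apply: le_trans (ler_norm_sum _ _ _) _; apply: ler_sum => j _.
rewrite normrM (bigD1 i)//=; apply: (@le_trans _ _ `|A j i|); last by rewrite lerDl sumr_ge0.
rewrite ler_piMl// ger0_norm// -w1 (bigD1 j)//= lerDl sumr_ge0// => l _; exact: w0.
Qed.

End barycentric.

Section full_simplex.
Context (R : realType) (n : nat).
Implicit Types (A : 'M[R]_(n.+1, n)) (x y : 'rV[R]_n).
Variable A : 'M[R]_(n.+1, n).
Hypothesis fA : affinely_independent A.

Local Notation lam j := (aff_eval (bary A j)).

Lemma bary_sub x : row_mx x (1%:M : 'M[R]_1) = (\row_j lam j x) *m row_mx A (const_mx 1 : 'cV[R]_n.+1).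
Proof.
rewrite (_ : \row_j _ = row_mx x (1%:M : 'M[R]_1) *m pinvmx (row_mx A (const_mx 1 : 'cV[R]_n.+1))).
  rewrite mulmxKpV//; apply: submx_full; rewrite /row_full.
  by apply/eqP; rewrite (eqP fA) addn1.
by apply/rowP => j; rewrite [LHS]mxE baryE.
Qed.

Lemma bary_sum x : \sum_j lam j x = 1.
Proof.
have /(congr1 (fun M : 'M[R]_(1, n + 1) => M 0 (rshift n 0))) := bary_sub x.
rewrite row_mxEr [1%:M _ _]mxE eqxx mulr1n => ->.
by rewrite [RHS]mxE; apply: eq_bigr => j _; rewrite row_mxEr !mxE mulr1.
Qed.

Lemma bary_combE x : (\row_j lam j x) *m A = x.
Proof.
by have := bary_sub x; rewrite mul_mx_row => /eq_row_mx[<-].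
Qed.

Lemma simplexP x : simplex A x <-> forall j, 0 <= lam j x.
Proof.
split => [[w [w0 w1 ->]] j|H]; first by rewrite bary_comb.
exists (\row_j lam j x); split; last by rewrite bary_combE.
  by move=> i; rewrite mxE.
by under eq_bigr do rewrite mxE; exact: bary_sum.
Qed.

Lemma osimplexP x : osimplex A x <-> forall j, 0 < lam j x.
Proof.
split => [[w [w0 w1 ->]] j|H]; first by rewrite bary_comb.
exists (\row_j lam j x); split; last by rewrite bary_combE.
  by move=> i; rewrite mxE.
by under eq_bigr do rewrite mxE; exact: bary_sum.
Qed.

Lemma bary_le1 x j : simplex A x -> lam j x <= 1.
Proof.
by move=> /simplexP x0; rewrite -(bary_sum x) (bigD1 j)//= lerDl sumr_ge0.
Qed.

Lemma row_face_sum j (w : 'rV[R]_n) : w *m row' j A =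
  (\row_i (if unlift j i is Some i' then w 0 i' else 0)) *m A.
Proof.
rewrite !mulmx_sum_row [RHS](bigD1_ord j)//= mxE unlift_none scale0r add0r.
apply: eq_bigr => i _; rewrite mxE liftK; congr (_ *: _).
by apply/rowP => l; rewrite !mxE.
Qed.

Lemma sum_face (j : 'I_n.+1) (w : 'rV[R]_n) :
  \sum_i (\row_(i < n.+1) (if unlift j i is Some i' then w 0 i' else 0)) 0 i = \sum_i w 0 i.
Proof.
rewrite (bigD1_ord j)//= mxE unlift_none add0r.
by apply: eq_bigr => i _; rewrite mxE liftK.
Qed.

Lemma face_comb j x : lam j x = 0 ->
  (\row_i lam (lift j i) x) *m row' j A = x /\ \sum_i (\row_i lam (lift j i) x) 0 i = 1.
Proof.
move=> xj; split.
  rewrite row_face_sum -[RHS]bary_combE; congr (_ *m _); apply/rowP => i; rewrite !mxE.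
  by case: unliftP => [i' ->|->]; rewrite ?mxE.
rewrite -(bary_sum x) [RHS](bigD1_ord j)//= xj add0r.
by apply: eq_bigr => i _; rewrite mxE.
Qed.

Lemma bary_face j (w : 'rV[R]_n) : \sum_i w 0 i = 1 ->
  lam j (w *m row' j A) = 0 /\ forall i, lam (lift j i) (w *m row' j A) = w 0 i.
Proof.
move=> w1; rewrite row_face_sum; split=> [|i]; rewrite bary_comb ?sum_face// mxE.
  by rewrite unlift_none.
by rewrite liftK.
Qed.

Lemma simplex_faceP j x : simplex (row' j A) x <-> lam j x = 0 /\ simplex A x.
Proof.
split => [[w [w0 w1 ->]]|[xj /simplexP x0]].
  have [E0 E] := bary_face j w1; split => //; apply/simplexP => i.
  by have [i' ->|->] := unliftP j i; rewrite ?E ?E0.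
have [E1 E2] := face_comb xj; exists (\row_i lam (lift j i) x); split => // i.
by rewrite mxE.
Qed.

Lemma osimplex_faceP j x : osimplex (row' j A) x <->
  lam j x = 0 /\ forall i, i != j -> 0 < lam i x.
Proof.
split => [[w [w0 w1 ->]]|[xj x0]].
  have [E0 E] := bary_face j w1; split => // i.
  by have [i' -> _|->] := unliftP j i; rewrite ?eqxx ?E.
have [E1 E2] := face_comb xj; exists (\row_i lam (lift j i) x); split => // i.
by rewrite mxE x0// eq_sym neq_lift.
Qed.

Lemma osimplex_open : open (osimplex A).
Proof.
rewrite (_ : osimplex A = ~` \bigcup_(j in [set: 'I_n.+1]) [set x | lam j x <= 0]); last first.
  apply/seteqP; split => [x /osimplexP H [j _ /=]|x H]; first by rewrite leNgt H.
  by apply/osimplexP => j; rewrite ltNge; apply/negP => jx; apply: H; exists j.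
rewrite openC; apply: closed_bigcup => [|j _]; first exact: finite_finset.
apply: (@closed_comp _ _ (lam j) [set x | x <= 0]); last exact: closed_le.
by move=> x _; exact: aff_eval_continuous.
Qed.

Lemma simplex_closed : closed (simplex A).
Proof.
rewrite (_ : simplex A = \bigcap_(j in [set: 'I_n.+1]) [set x | 0 <= lam j x]); last first.
  apply/seteqP; split => [x /simplexP H j _|x H]; first exact: H.
  by apply/simplexP => j; exact: H.
apply: closed_bigI => j _; apply: (@closed_comp _ _ (lam j) [set x | 0 <= x]); last exact: closed_ge.
by move=> x _; exact: aff_eval_continuous.
Qed.

Definition centroid : 'rV[R]_n := const_mx n.+1%:R^-1 *m A.

Lemma bary_centroid j : lam j centroid = n.+1%:R^-1.
Proof.
rewrite /centroid bary_comb ?mxE//; under eq_bigr do rewrite mxE.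
by rewrite sumr_const card_ord -[LHS]mulr_natl mulfV// pnatr_eq0.
Qed.

Lemma osimplex_toward x (s : R) : simplex A x -> 0 < s <= 1 ->
  osimplex A (s *: centroid + (1 - s) *: x).
Proof.
move=> /simplexP x0 /andP[s0 s1]; apply/osimplexP => j; rewrite aff_eval_conv bary_centroid.
rewrite ltr_pwDl// ?mulr_gt0 ?invr_gt0 ?ltr0n//.
by rewrite mulr_ge0// ?x0// subr_ge0.
Qed.

Lemma simplex_approx x (e : R) : simplex A x -> 0 < e ->
  exists2 y, osimplex A y & ball x e y.
Proof.
move=> Sx e0; have [M M0 SM] := bounded_set_coord (simplex_bounded A).
have Sc : simplex A centroid.
  by apply/simplexP => j; rewrite bary_centroid invr_ge0 ler0n.
pose s := Num.min 1 (e / (4 * M)).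
have M4 : 0 < 4 * M by rewrite mulr_gt0.
have s0 : 0 < s by rewrite lt_min ltr01 divr_gt0.
have s1 : s <= 1 by rewrite ge_min lexx.
have sM : s * (4 * M) <= e by rewrite -ler_pdivlMr// ge_min lexx orbT.
exists (s *: centroid + (1 - s) *: x); first by apply: osimplex_toward => //; rewrite s0.
split => // a i; rewrite /ball/= ord1 !mxE.
rewrite (_ : _ - _ = s * (x 0 i - centroid 0 i)); last by rewrite mxE; ring.
rewrite normrM gtr0_norm//; apply: (@le_lt_trans _ _ (s * (M + M))); last by nra.
apply: ler_wpM2l; first exact: ltW.
by apply: le_trans (ler_normB _ _) _; rewrite lerD// SM.
Qed.

End full_simplex.

Section euclidean_norm.
Context (R : realType) (n : nat).
Implicit Types (x y : 'rV[R]_n).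

Lemma enorm_ge0 x : 0 <= enorm x. Proof. exact: sqrtr_ge0. Qed.

Lemma coord_enorm x i : `|x 0 i| <= enorm x.
Proof.
rewrite /enorm -sqrtr_sqr ler_wsqrtr// (bigD1 i)//= lerDl sumr_ge0// => j _.
exact: sqr_ge0.
Qed.

Lemma enorm_le_sum x : enorm x <= \sum_i `|x 0 i|.
Proof.
have H0 : 0 <= \sum_i `|x 0 i| by exact: sumr_ge0.
rewrite /enorm -[leRHS]ger0_norm// -sqrtr_sqr ler_wsqrtr//.
rewrite expr2 mulr_suml; apply: ler_sum => i _.
rewrite -real_normK ?num_real// expr2 ler_wpM2l//.
by rewrite (bigD1 i)//= lerDl sumr_ge0.
Qed.

Lemma enorm_delta (t : R) (i : 'I_n) : enorm (t *: delta_mx 0 i) = `|t|.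
Proof.
rewrite /enorm (bigD1 i)//= big1 ?addr0 ?mxE ?eqxx ?mulr1 ?sqrtr_sqr// => j /negbTE ji.
by rewrite !mxE ji andbF mulr0 expr0n.
Qed.

Lemma diam_ub (A : set 'rV[R]_n) x y : bounded_set A -> A x -> A y -> enorm (x - y) <= diam A.
Proof.
move=> /bounded_set_coord[M M0 AM] Ax Ay; apply: ub_le_sup; last by exists x, y.
exists (\sum_(i < n) (M + M)) => _ [a [b [Aa Ab ->]]].
apply: le_trans (enorm_le_sum _) _; apply: ler_sum => i _; rewrite !mxE.
by apply: le_trans (ler_normB _ _) _; rewrite lerD// AM.
Qed.

End euclidean_norm.

(** * Inscribed balls and bounds on barycentric gradients *)

Section shape.
Context (R : realType) (n : nat) (A : 'M[R]_(n.+1, n)).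
Hypotheses (fA : affinely_independent A) (n0 : (0 < n)%N).

Local Notation lam j := (aff_eval (bary A j)).

Let S := [set rho : R | 0 < rho /\ exists c, star_shaped_wrt_ball (simplex A) c rho].

Let star_ball c rho : star_shaped_wrt_ball (simplex A) c rho ->
  forall y, enorm (y - c) < rho -> simplex A y.
Proof.
move=> H y yc; have := H (row ord0 A) y 0 (simplex_row _ _) yc.
by rewrite scale0r add0r subr0 scale1r lexx ler01; exact.
Qed.

(** With [S_nonempty], this makes [sup S] a genuine supremum. Otherwise [sup] would default to 0,
    the chunkiness to 0 as a division by 0, and shape regularity would say nothing. *)
Let S_ub rho : S rho -> rho <= 2 * diam (simplex A).
Proof.
move=> [r0 [c /star_ball cr]]; pose i := Ordinal n0.
have H1 : simplex A c.
  by apply: cr; rewrite subrr -(scale0r (delta_mx 0 i)) enorm_delta normr0.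
have H2 : simplex A (c + (rho / 2) *: delta_mx 0 i).
  apply: cr; rewrite addrAC subrr add0r enorm_delta ger0_norm ?divr_ge0 ?ltW//; lra.
have := diam_ub (simplex_bounded A) H2 H1.
rewrite addrAC subrr add0r enorm_delta gtr0_norm ?divr_gt0// => H; lra.
Qed.

Let S_nonempty : S !=set0.
Proof.
(* At the centroid all barycentric coordinates equal [n.+1%:R^-1] and [G] bounds their variation, so
   they stay nonnegative within [rho]; the [+ 1] keeps the denominator positive. *)
pose G : R := \sum_j \sum_i `|(bary A j).1 0 i|.
have G0 : 0 <= G by apply: sumr_ge0 => j _; exact: sumr_ge0.
pose rho : R := n.+1%:R^-1 / (G + 1).
have r0 : 0 < rho by rewrite divr_gt0 ?invr_gt0 ?ltr0n// ltr_wpDl.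
exists rho; split => //; exists (centroid A) => x y s Ax yc s01.
apply: simplex_convex => //; apply/simplexP => // j.
have := aff_evalB (bary A j) y (centroid A); rewrite bary_centroid// => E.
suff : `|lam j y - n.+1%:R^-1| <= n.+1%:R^-1 by rewrite ler_norml => /andP[+ _]; rewrite lerBrDr addNr.
rewrite E; apply: le_trans (ler_norm_sum _ _ _) _.
apply: (@le_trans _ _ (\sum_i `|(bary A j).1 0 i| * rho)).
  apply: ler_sum => i _; rewrite normrM ler_wpM2l//.
  by apply: le_trans (ltW yc); have := coord_enorm (y - centroid A) i; rewrite !mxE.
rewrite -mulr_suml /rho mulrCA ler_piMr ?invr_ge0 ?ler0n// ler_pdivrMr ?ltr_wpDl// mul1r.
apply: (@le_trans _ _ G); last by rewrite lerDl.
by rewrite /G (bigD1 j)//= lerDl sumr_ge0// => l _; exact: sumr_ge0.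
Qed.

Lemma diam_simplex_gt0 : 0 < diam (simplex A).
Proof. by have [rho Sr] := S_nonempty; have := S_ub Sr; have := Sr.1; lra. Qed.

Lemma inscribed_ball (sigma : R) : 0 < sigma -> chunkiness (simplex A) <= sigma ->
  exists c rho, [/\ 0 < rho, diam (simplex A) <= 2 * sigma * rho &
    forall y, enorm (y - c) < rho -> simplex A y].
Proof.
move=> s0; rewrite /chunkiness -/S => dS.
have supS : has_sup S.
  by split; [exact: S_nonempty|exists (2 * diam (simplex A)) => rho; exact: S_ub].
have [rho0 Sr0] := S_nonempty.
have S0 : 0 < sup S by apply: lt_le_trans Sr0.1 _; exact: ub_le_sup supS.2 _ Sr0.
(* The supremum need not be attained; accepting more than half of it costs the factor 2 in the
   bound. *)
have [|rho Srho rhoS] := @sup_adherent _ _ (sup S / 2) _ supS; first by rewrite divr_gt0.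
have [r0 [c cr]] := Srho; exists c, rho; split => //; last exact: star_ball.
move: dS; rewrite ler_pdivrMr//; nra.
Qed.

Section ball.
Variables (c : 'rV[R]_n) (rho : R).
Hypotheses (r0 : 0 < rho) (cr : forall y, enorm (y - c) < rho -> simplex A y).

Let bary_line j i (s : R) : `|s| < rho ->
  simplex A (c + s *: delta_mx 0 i) /\
  lam j (c + s *: delta_mx 0 i) - lam j c = (bary A j).1 0 i * s.
Proof.
move=> sr; split; first by apply: cr; rewrite addrAC subrr add0r enorm_delta.
rewrite aff_evalB (bigD1 i)//= big1 ?addr0 => [|l /negbTE li]; rewrite !mxE ?eqxx ?li ?andbF/=.
  by rewrite mulr1 addrAC subrr add0r.
by rewrite mulr0 addr0 subrr mulr0.
Qed.

(** A barycentric coordinate stays in [0, 1] on the simplex, so it varies by at most 1 along an axis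
    segment of length [rho / 2] from the centre. *)
Lemma bary_gradient_le j i : `|(bary A j).1 0 i| <= 2 / rho.
Proof.
have H1 : simplex A c.
  by apply: cr; rewrite subrr -(scale0r (delta_mx 0 i)) enorm_delta normr0.
have [|H2 E] := @bary_line j i (rho / 2); first by rewrite gtr0_norm ?divr_gt0 //; move: r0; lra.
have := bary_le1 fA j H1; have := bary_le1 fA j H2.
have /(simplexP fA)/(_ j) := H1; have /(simplexP fA)/(_ j) := H2.
move=> p1 p2 p3 p4; rewrite ler_pdivlMr//.
have : `|(bary A j).1 0 i * (rho / 2)| <= 1 by rewrite -E ler_norml; apply/andP; split; lra.
by rewrite normrM (gtr0_norm (x := rho / 2)) ?divr_gt0//; lra.
Qed.

(** A coordinate that vanished at [c] would have a minimum inside the ball, hence a zero gradient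
    and the value 0 everywhere, whereas it is 1 at its own vertex. *)
Lemma osimplex_center : osimplex A c.
Proof.
apply/osimplexP => // j; rewrite lt0r; apply/andP; split; last first.
  apply: (simplexP fA c).1; apply: cr.
  by rewrite subrr -(scale0r (delta_mx 0 (Ordinal n0))) enorm_delta normr0.
apply/negP => /eqP c_0.
have g0 i : (bary A j).1 0 i = 0.
  have [|/(simplexP fA)/(_ j) H1 E1] := @bary_line j i (rho / 2); first by rewrite gtr0_norm ?divr_gt0 //; move: r0; lra.
  have [|/(simplexP fA)/(_ j) H2 E2] := @bary_line j i (- (rho / 2)).
    by rewrite normrN gtr0_norm ?divr_gt0 //; move: r0; lra.
  move: E1 E2; rewrite c_0 !subr0 mulrN => E1 E2.
  have /eqP : (bary A j).1 0 i * (rho / 2) = 0 by apply/eqP; rewrite eq_le; apply/andP; split; lra.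
  by rewrite mulf_eq0 mulf_eq0 invr_eq0 pnatr_eq0 (gt_eqF r0) !orbF => /eqP.
have := aff_evalB (bary A j) (row j A) c; rewrite c_0 bary_row// eqxx subr0 big1.
  by move/eqP; rewrite oner_eq0.
by move=> i _; rewrite g0 mul0r.
Qed.

End ball.

End shape.

(** * The surface Jacobian of a face *)

Lemma det_norm_le (R : realType) n (N : 'M[R]_n) (G : R) : (forall i j, `|N i j| <= G) ->
  `|\det N| <= n`!%:R * G ^+ n.
Proof.
move=> NG; apply: le_trans (ler_norm_sum _ _ _) _.
apply: (@le_trans _ _ (\sum_(s : 'S_n) G ^+ n)).
  apply: ler_sum => s _; rewrite normrMsign normr_prod.
  have -> : G ^+ n = \prod_(i < n) G by rewrite prodr_const card_ord.
  by apply: ler_prod => i _; rewrite normr_ge0 NG.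
by rewrite sumr_const -[leLHS]mulr_natl (card_Sn n).
Qed.

Section chart_weights.
Context (R : realType) (n : nat).

Definition chart_weight (t : n.-tuple (measurableTypeR R)) : 'rV[R]_n.+1 :=
  \row_(i < n.+1) nth (1 - \sum_(s <- t) (s : R)) t i.

Lemma chart_weight_max t : chart_weight t 0 ord_max = 1 - \sum_(l < n) tnth t l.
Proof.
rewrite mxE nth_default ?size_tuple//=; congr (1 - _).
by rewrite big_tuple.
Qed.

Lemma chart_weight_widen t (l : 'I_n) : chart_weight t 0 (widen_ord (leqnSn n) l) = tnth t l.
Proof. by rewrite mxE/= (tnth_nth (1 - \sum_(s <- t) (s : R))). Qed.

Lemma chart_weight_sum t : \sum_i chart_weight t 0 i = 1.
Proof.
rewrite big_ord_recr/= chart_weight_max.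
rewrite [X in X + _](eq_bigr (fun l => tnth t l)); first by rewrite addrC subrK.
by move=> l _; exact: chart_weight_widen.
Qed.

Lemma chartE (F : 'M[R]_n.+1) t : chart F t = chart_weight t *m F.
Proof. by []. Qed.

End chart_weights.

Section jacobian.
Context (R : realType) (n : nat) (A : 'M[R]_(n.+2, n.+1)) (j : 'I_n.+2).
Hypothesis fA : affinely_independent A.
Variables (c : 'rV[R]_n.+1) (rho : R).
Hypotheses (r0 : 0 < rho) (cr : forall y, enorm (y - c) < rho -> simplex A y).

Let J : 'M[R]_(n, n.+1) := chart_jacobian (row' j A).
Let g m : 'rV[R]_n.+1 := (bary A m).1.

Let J_g i m : (J *m (g m)^T) i 0 =
  aff_eval (bary A m) (chart (row' j A) [tuple (i == l)%:R | l < n]) -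
  aff_eval (bary A m) (chart (row' j A) [tuple 0 | l < n]).
Proof. by rewrite aff_evalB mxE; apply: eq_bigr => k _; rewrite !mxE mulrC. Qed.

Let J_gj : J *m (g j)^T = 0.
Proof.
apply/colP => i; rewrite J_g mxE !chartE.
have [-> _] := bary_face fA j (chart_weight_sum [tuple (i == l)%:R | l < n]).
by have [-> _] := bary_face fA j (chart_weight_sum [tuple 0 | l < n]); rewrite subrr.
Qed.

Let N : 'M[R]_(1 + n) := col_mx (g j) (\matrix_(l < n) g (lift j (widen_ord (leqnSn n) l))).
Let M : 'M[R]_(1 + n) := col_mx (g j) J.
Let gg : R := \sum_i g j 0 i ^+ 2.

Let ggE : g j *m (g j)^T = gg%:M.
Proof.
apply/matrixP => a b; rewrite !ord1 !mxE eqxx mulr1n.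
by apply: eq_bigr => i _; rewrite [_^T _ _]mxE expr2.
Qed.

(** The rows of [J] are edges of the face from its last vertex. They are orthogonal to [g j] and
    dual to the gradients of the other coordinates but the last, so the product of [M] with the
    transpose of [N] is block triangular with an identity block. *)
Let det_MN : \det M * \det N = gg.
Proof.
rewrite -[\det N]det_tr -det_mulmx tr_col_mx mul_col_row ggE J_gj.
rewrite (_ : J *m _ = 1%:M); first by rewrite det_ublock det_scalar1 det1 mulr1.
apply/matrixP => i l.
have -> : (J *m (\matrix_(l < n) g (lift j (widen_ord (leqnSn n) l)))^T) i l =
    (J *m (g (lift j (widen_ord (leqnSn n) l)))^T) i 0.
  by rewrite mxE [RHS]mxE; apply: eq_bigr => k _; rewrite !mxE.
rewrite J_g !chartE.
have [_ ->] := bary_face fA j (chart_weight_sum [tuple (i == l)%:R | l < n]).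
have [_ ->] := bary_face fA j (chart_weight_sum [tuple 0 | l < n]).
by rewrite !chart_weight_widen !tnth_mktuple subr0 mxE.
Qed.

Let det_MM : \det M ^+ 2 = gg * \det (J *m J^T).
Proof.
rewrite expr2 -{2}det_tr -det_mulmx tr_col_mx mul_col_row ggE J_gj det_ublock det_scalar1//.
Qed.

(** The coordinate drops from 1 to 0 between two vertices no further apart than the diameter;
    Cauchy-Schwarz turns this into a lower bound on its gradient. *)
Let gg_ge : 1 <= gg * diam (simplex A) ^+ 2.
Proof.
pose p := lift j ord0.
have E := aff_evalB (bary A j) (row j A) (row p A).
move: E; rewrite !bary_row// eqxx (_ : (p == j) = false) ?subr0; last first.
  by rewrite eq_sym; apply/negbTE; exact: neq_lift.
move=> E.
have dd : \sum_i (row j A 0 i - row p A 0 i) ^+ 2 <= diam (simplex A) ^+ 2.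
  have := diam_ub (simplex_bounded A) (simplex_row A j) (simplex_row A p).
  move=> H; have : enorm (row j A - row p A) ^+ 2 <= diam (simplex A) ^+ 2.
    by rewrite lerXn2r// nnegrE ?enorm_ge0// (le_trans _ H)// enorm_ge0.
  rewrite /enorm sqr_sqrtr; last by apply: sumr_ge0 => i _; exact: sqr_ge0.
  apply: le_trans; apply/ler_sum => i _; rewrite !mxE//.
have gg0 : 0 <= gg by apply: sumr_ge0 => i _; exact: sqr_ge0.
apply: (@le_trans _ _ (gg * \sum_i (row j A 0 i - row p A 0 i) ^+ 2)); last exact: ler_wpM2l.
set d := fun i => row j A 0 i - row p A 0 i.
have {}E : \sum_i g j 0 i * d i = 1 by rewrite -E.
have d0 : 0 <= \sum_i d i ^+ 2 by apply: sumr_ge0 => i _; exact: sqr_ge0.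
(* Once [E] has evaluated the cross term to 1, the expansion of this sum is [D * (D * gg - 1)]. *)
have : 0 <= \sum_i ((\sum_i d i ^+ 2) * g j 0 i - d i) ^+ 2.
  by apply: sumr_ge0 => i _; exact: sqr_ge0.
rewrite -/(\sum_i d i ^+ 2); move: d0; set D := \sum_i d i ^+ 2 => d0.
rewrite (eq_bigr (fun i => D ^+ 2 * g j 0 i ^+ 2 - 2 * D * (g j 0 i * d i) + d i ^+ 2)); last first.
  by move=> i _; ring.
rewrite big_split/= sumrB -!mulr_sumr E -/gg -/D mulr1 => H.
have [D0|D0] := eqVneq D 0; last first.
  have D1 : 0 < D by rewrite lt_neqAle eq_sym D0.
  by rewrite -(ler_pM2l D1); nra.
move: D0 => /eqP; rewrite psumr_eq0 => [|i _]; last exact: sqr_ge0.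
move=> /allP D0; move: E; rewrite big1 => [/esym/eqP|i _]; first by rewrite oner_eq0.
have := D0 i (mem_index_enum _); rewrite /= sqrf_eq0 => /eqP ->.
by rewrite mulr0.
Qed.

(** By [det_MN] and [det_MM], the Gram determinant is [gg / \det N ^+ 2]. A lower bound thus follows
    from [gg_ge] and an upper bound on the entries of [N], which are gradients controlled by the
    inscribed ball. *)
Lemma jacobian_ge : (rho / 2) ^+ n.+1 / (n.+1`!%:R * diam (simplex A)) <=
  Num.sqrt (\det (J *m J^T)).
Proof.
have d0 := diam_simplex_gt0 fA (ltn0Sn n).
have f0 : 0 < n.+1`!%:R :> R by rewrite ltr0n fact_gt0.
have gg_gt0 : 0 < gg.
  have := gg_ge; have : 0 <= gg by apply: sumr_ge0 => i _; exact: sqr_ge0.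
  rewrite le_eqVlt => /orP[/eqP <-|//]; rewrite mul0r; lra.
have Nle : `|\det N| <= n.+1`!%:R * (2 / rho) ^+ n.+1.
  have gle m b : `|g m 0 b| <= 2 / rho by exact: (bary_gradient_le fA r0 cr).
  have Nle (a b : 'I_(1 + n)) : `|N a b| <= 2 / rho.
    rewrite mxE; case: (fintype.split a) => i; first by rewrite ord1.
    by rewrite [(\matrix_(_ < _) _) _ _]mxE.
  exact: (@det_norm_le R n.+1 N).
have M0 : \det M != 0.
  apply/eqP => M0; have := det_MN; rewrite M0 mul0r => E; move: gg_gt0; rewrite -E; lra.
have N0 : \det N != 0.
  apply/eqP => N0; have := det_MN; rewrite N0 mulr0 => E; move: gg_gt0; rewrite -E; lra.
have detE : \det (J *m J^T) = gg / \det N ^+ 2.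
  apply: (mulfI (lt0r_neq0 gg_gt0)); rewrite -det_MM mulrA -expr2 -[in RHS]det_MN exprMn mulfK//.
  by rewrite expf_eq0.
have N2 : 0 < \det N ^+ 2 by rewrite exprn_even_gt0.
set X := _ / _.
have X0 : 0 <= X by rewrite divr_ge0 ?mulr_ge0 ?exprn_ge0 ?divr_ge0// ltW.
have XN : X * `|\det N| <= (diam (simplex A))^-1.
  apply: le_trans (ler_wpM2l X0 Nle) _.
  rewrite /X -[2 / rho]invf_div exprVn le_eqVlt; apply/orP; left; apply/eqP.
  have : (rho / 2) ^+ n.+1 != 0 by rewrite expf_neq0// gt_eqF// divr_gt0.
  move: ((rho / 2) ^+ n.+1) (n.+1`!%:R : R) (diam (simplex A)) f0 d0 => u v w v0 w0 u0.
  by field; rewrite u0 !gt_eqF.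
rewrite -(ger0_norm X0) -sqrtr_sqr ler_wsqrtr// detE ler_pdivlMr//.
rewrite -(real_normK (num_real (\det N))) -exprMn.
apply: (@le_trans _ _ ((diam (simplex A))^-1 ^+ 2)).
  have XN0 : 0 <= X * `|\det N| by rewrite mulr_ge0.
  by rewrite lerXn2r// nnegrE// (le_trans XN0).
by rewrite exprVn -[leLHS]mul1r ler_pdivrMr// exprn_gt0.
Qed.

End jacobian.

(** * Scaling estimates on an element and on a face *)

Section lagrange_basis.
Context (R : realType) (n : nat) (J : finType) (r : nat) (lam : J -> aff R n).
Hypothesis r0 : (0 < r)%N.
Implicit Types (al : {ffun J -> 'I_r.+1}) (x : 'rV[R]_n).

Definition basis_factor (l : nat) (a : aff R n) : aff R n :=
  ((r%:R / l.+1%:R) *: a.1, (r%:R * a.2 - l%:R) / l.+1%:R).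

Lemma basis_factorE l a x : aff_eval (basis_factor l a) x = (r%:R * aff_eval a x - l%:R) / l.+1%:R.
Proof.
rewrite /aff_eval/= mulrDr -addrA [RHS]mulrDl; congr (_ + _).
rewrite mulr_sumr mulr_suml; apply: eq_bigr => i _; rewrite mxE; ring.
Qed.

Definition basis_factors al : seq (aff R n) :=
  flatten [seq [seq basis_factor l (lam j) | l <- iota 0 (al j)] | j <- enum J].

Lemma basis_factorsE al x : aff_prod (basis_factors al) x = mbin (fun j => r%:R * aff_eval (lam j) x) al.
Proof.
rewrite /aff_prod big_flatten/= big_map big_enum/=; apply: eq_bigr => j _.
rewrite big_map /bin_poly -[in LHS](subn0 (al j)) -/(index_iota 0 (al j)) big_mkord.
by apply: eq_bigr => l _; rewrite basis_factorE.
Qed.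

Lemma size_basis_factors al : size (basis_factors al) = msize al.
Proof.
rewrite size_flatten /shape -map_comp sumnE big_map big_enum/=.
by apply: eq_bigr => j _; rewrite /= size_map size_iota.
Qed.

Lemma basis_factorsP al a : a \in basis_factors al ->
  exists j (l : nat), (l < r)%N /\ a = basis_factor l (lam j).
Proof.
move=> /flattenP[s /mapP[j _ ->] /mapP[l]]; rewrite mem_iota add0n => /andP[_ lj] ->.
by exists j, l; split => //; apply: leq_trans lj _; rewrite -ltnS.
Qed.

Lemma basis_factor_le l a x : (l < r)%N -> 0 <= aff_eval a x <= 1 ->
  `|aff_eval (basis_factor l a) x| <= r%:R.
Proof.
move=> lr /andP[a0 a1]; rewrite basis_factorE normrM.
have l1 : (1 : R) <= l.+1%:R by rewrite ler1n.
rewrite (ger0_norm (x := l.+1%:R^-1)) ?invr_ge0// ler_pdivrMr ?ltr0n//.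
apply: (@le_trans _ _ (r%:R * 1)); last by rewrite ler_wpM2l.
have lr' : (l%:R : R) <= r%:R by rewrite ler_nat ltnW.
have l0 : (0 : R) <= l%:R by [].
rewrite mulr1 ler_norml; apply/andP; split; nra.
Qed.

Lemma basis_factor_grad l (a : aff R n) (G : R) i : `|a.1 0 i| <= G ->
  `|(basis_factor l a).1 0 i| <= r%:R * G.
Proof.
move=> aG; rewrite mxE normrM ler_pM// ger0_norm ?divr_ge0//.
by rewrite ler_pdivrMr ?ltr0n// ler_peMr// ler1n.
Qed.

Definition nodal_sp (d : {ffun J -> 'I_r.+1} -> R) : seq (R * seq (aff R n)) :=
  [seq (d al, basis_factors al) | al <- enum [pred al : {ffun J -> 'I_r.+1} | msize al == r]].

Lemma nodal_spE d x : sp_eval (nodal_sp d) x =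
  \sum_(al : {ffun J -> 'I_r.+1} | msize al == r) d al * mbin (fun j => r%:R * aff_eval (lam j) x) al.
Proof.
rewrite /sp_eval big_map big_enum/=; apply: eq_bigr => al _.
by rewrite basis_factorsE.
Qed.

Lemma nodal_sp_norm d : sp_norm (nodal_sp d) = \sum_(al : {ffun J -> 'I_r.+1} | msize al == r) `|d al|.
Proof. by rewrite /sp_norm big_map big_enum. Qed.

Lemma nodal_sp_all d (Q : aff R n -> Prop) :
  (forall j l, (l < r)%N -> Q (basis_factor l (lam j))) -> sp_all r Q (nodal_sp d).
Proof.
move=> QH q /mapP[al]; rewrite mem_enum inE => /eqP alr ->.
split; first by rewrite /= size_basis_factors alr.
by move=> a /= /basis_factorsP[j [l [lr ->]]]; exact: QH.
Qed.

Lemma poly_fun_nodal d : poly_fun r (sp_eval (nodal_sp d)).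
Proof.
have H : sp_all r (fun=> True) (nodal_sp d) by apply: nodal_sp_all.
exact: poly_fun_sp_eval H.
Qed.

Lemma nodal_derivs_le d (G : R) s x : 0 <= G -> (forall j i, `|(lam j).1 0 i| <= G) ->
  (forall j, 0 <= aff_eval (lam j) x <= 1) ->
  `|sp_eval (sp_derivs s (nodal_sp d)) x| <=
  (r%:R * (r%:R * G)) ^+ size s * (\sum_(al : {ffun J -> 'I_r.+1} | msize al == r) `|d al|) * r%:R ^+ r.
Proof.
move=> G0 lamG lamx.
pose Q (a : aff R n) := (forall i, `|a.1 0 i| <= r%:R * G) /\ `|aff_eval a x| <= r%:R.
have PQ : sp_all r Q (nodal_sp d).
  apply: nodal_sp_all => j l lr; split => [i|]; first exact: basis_factor_grad.
  exact: basis_factor_le.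
rewrite -nodal_sp_norm; move: (nodal_sp d) PQ => P PQ.
have [sQ sN] : sp_all r Q (sp_derivs s P) /\
    sp_norm (sp_derivs s P) <= (r%:R * (r%:R * G)) ^+ size s * sp_norm P.
  elim: s P PQ => [|i s IH] P PQ; first by rewrite /= expr0 mul1r.
  have [H1 H2] := IH _ (sp_deriv_all (i := i) PQ); split => //=.
  apply: le_trans H2 _; rewrite exprSr -[leRHS]mulrA ler_wpM2l ?exprn_ge0 ?mulr_ge0//.
  by apply: sp_deriv_norm PQ; [exact: mulr_ge0|move=> a []].
have r1 : (1 : R) <= r%:R by rewrite ler1n.
apply: le_trans (sp_eval_le r1 (fun a (H : Q a) => H.2) sQ) _.
by rewrite ler_wpM2r// exprn_ge0.
Qed.

Lemma nodal_lip d x y : (forall j i, `|(lam j).1 0 i| <= 1) ->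
  (forall j, 0 <= aff_eval (lam j) x <= 1) -> (forall j, 0 <= aff_eval (lam j) y <= 1) ->
  `|sp_eval (nodal_sp d) x - sp_eval (nodal_sp d) y| <=
  (\sum_(al : {ffun J -> 'I_r.+1} | msize al == r) `|d al|) *
  (r%:R * r%:R * r%:R ^+ r * \sum_i `|x 0 i - y 0 i|).
Proof.
move=> lam1 lamx lamy; rewrite !nodal_spE -sumrB.
apply: le_trans (ler_norm_sum _ _ _) _; rewrite mulr_suml; apply: ler_sum => al /eqP alr.
rewrite -mulrBr normrM ler_wpM2l// -!basis_factorsE.
have r1 : (1 : R) <= r%:R by rewrite ler1n.
have := @aff_prod_lip R n r%:R r%:R (basis_factors al) x y r1 (ler0n _ _).
rewrite size_basis_factors alr; apply => a /basis_factorsP[j [l [lr ->]]]; split.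
- by move=> i; have := basis_factor_grad l (lam1 j i); rewrite mulr1.
- exact: basis_factor_le.
- exact: basis_factor_le.
Qed.

End lagrange_basis.

(** * Nodal values against the $L^2$ norm on the reference face *)

Section reference.
Context (R : realType) (n r : nat).
Hypothesis r0 : (0 < r)%N.

Definition coord_aff (i : 'I_n.+1) : aff R n.+1 := (delta_mx 0 i, 0).

Lemma coord_affE i (w : 'rV[R]_n.+1) : aff_eval (coord_aff i) w = w 0 i.
Proof.
rewrite /aff_eval/= addr0 (bigD1 i)//= mxE !eqxx mul1r big1 ?addr0// => j /negbTE ji.
by rewrite mxE ji andbF mul0r.
Qed.

Definition weight_node (al : {ffun 'I_n.+1 -> 'I_r.+1}) : 'rV[R]_n.+1 :=
  \row_i ((al i : nat)%:R / r%:R).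

Definition ref_simplex : set (n.-tuple (measurableTypeR R)) :=
  [set t | forall i, 0 < chart_weight t 0 i].

Lemma measurable_chart_weight (D : set (n.-tuple (measurableTypeR R))) i :
  measurable_fun D (fun t => chart_weight t 0 i).
Proof.
case: (unliftP ord_max i) => [l ->|->].
  rewrite (_ : (fun _ => _) = fun t => tnth t l).
    by apply: measurable_funTS; exact: measurable_tnth.
  apply/funext => t; rewrite (_ : lift _ _ = widen_ord (leqnSn n) l) ?chart_weight_widen//.
  by apply: val_inj; rewrite /= /bump leqNgt ltn_ord.
rewrite (_ : (fun _ => _) = fun t => 1 - \sum_(l < n) tnth t l).
  apply: measurable_funB => //; apply: measurable_sum => l.
  by apply: measurable_funTS; exact: measurable_tnth.
by apply/funext => t; rewrite chart_weight_max.
Qed.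

Lemma measurable_ref_simplex : measurable ref_simplex.
Proof.
rewrite (_ : ref_simplex = \bigcap_(i in [set: 'I_n.+1]) [set t | 0 < chart_weight t 0 i]); last first.
  by apply/seteqP; split => [t H i _|t H i]; exact: H.
apply: fin_bigcap_measurable => [|i _]; first exact: finite_finset.
rewrite (_ : [set t | _] = (fun t => chart_weight t 0 i) @^-1` `]0, +oo[); last first.
  by apply/seteqP; split => t /=; rewrite in_itv/= andbT.
rewrite -[X in measurable X]setTI.
exact: (measurable_chart_weight i measurableT (measurable_itv _)).
Qed.

(** The last weight is 1 minus the others, so it accumulates their errors; this is the origin of the
    dimension factors. *)
Lemma chart_weight_near (wc : 'rV[R]_n.+1) (eta : R) t : 0 <= eta -> \sum_i wc 0 i = 1 ->
  (forall l : 'I_n, `|tnth t l - wc 0 (widen_ord (leqnSn n) l)| <= eta) ->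
  (forall i, `|chart_weight t 0 i - wc 0 i| <= n.+1%:R * eta) /\
  \sum_i `|chart_weight t 0 i - wc 0 i| <= 2 * n%:R * eta.
Proof.
move=> eta0 wc1 tw.
have E1 l : `|chart_weight t 0 (widen_ord (leqnSn n) l) - wc 0 (widen_ord (leqnSn n) l)| <= eta.
  by rewrite chart_weight_widen.
have S1 : \sum_(l < n) `|chart_weight t 0 (widen_ord (leqnSn n) l) - wc 0 (widen_ord (leqnSn n) l)| <= n%:R * eta.
  rewrite mulr_natl -[n in leRHS]card_ord -sumr_const; apply: ler_sum => l _; exact: E1.
have E2 : `|chart_weight t 0 ord_max - wc 0 ord_max| <= n%:R * eta.
  apply: le_trans S1.
  have -> : wc 0 ord_max = 1 - \sum_(l < n) wc 0 (widen_ord (leqnSn n) l).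
    by rewrite -wc1 big_ord_recr/= addrAC subrr add0r.
  rewrite chart_weight_max (_ : _ - _ - _ = \sum_(l < n) (wc 0 (widen_ord (leqnSn n) l) - tnth t l)); last first.
    by rewrite sumrB; ring.
  apply: le_trans (ler_norm_sum _ _ _) _; apply: ler_sum => l _.
  by rewrite chart_weight_widen distrC.
split; last by rewrite big_ord_recr/= -mulrA mulr_natl mulr2n lerD.
move=> i; case: (unliftP ord_max i) => [l ->|->].
  rewrite (_ : lift _ _ = widen_ord (leqnSn n) l); last first.
    by apply: val_inj; rewrite /= /bump leqNgt ltn_ord.
  by apply: le_trans (E1 l) _; rewrite ler_peMl// ler1n.
by apply: le_trans E2 _; rewrite ler_wpM2r// ler_nat.
Qed.

Lemma measurable_cube (c : 'I_n -> R) (e : R) :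
  measurable [set t : n.-tuple (measurableTypeR R) | forall l, `|tnth t l - c l| <= e].
Proof.
rewrite (_ : [set t | _] = \bigcap_(l in [set: 'I_n]) [set t | `|tnth t l - c l| <= e]); last first.
  by apply/seteqP; split => [t H i _|t H i]; exact: H.
apply: fin_bigcap_measurable => [|i _]; first exact: finite_finset.
rewrite (_ : [set t | _] = (fun t => `|tnth t i - c i|) @^-1` `]-oo, e]); last first.
  by apply/seteqP; split => t /=; rewrite in_itv.
rewrite -[X in measurable X]setTI; apply: (_ : measurable_fun setT _) => //.
apply: measurableT_comp => //; apply: measurable_funB => //; exact: measurable_tnth.
Qed.

(* q is Lipschitz with a constant controlled by its largest nodal value M, so
   |q| >= M / 2 near the node where M is attained. *)
Lemma reference_lower_bound : exists2 K : R, 0 < K &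
  forall q : 'rV[R]_n.+1 -> R,
  (forall w : 'rV[R]_n.+1, \sum_i w 0 i = 1 ->
     q w = sp_eval (nodal_sp coord_aff (fun al => q (weight_node al))) w) ->
  forall al0, msize al0 = r ->
  (((q (weight_node al0)) ^+ 2)%:E <=
   K%:E * \int[lebesgue_Rn R n]_(t in ref_simplex) ((q (chart_weight t)) ^+ 2)%:E)%E.
Proof.
pose N : R := #|{: {ffun 'I_n.+1 -> 'I_r.+1}}|%:R.
have N1 : 1 <= N by rewrite ler1n; apply/card_gt0P; exists [ffun=> ord0].
have r1 : (1 : R) <= r%:R by rewrite ler1n.
pose L : R := r%:R * r%:R * r%:R ^+ r.
have L1 : 1 <= L by rewrite /L !mulr_ege1// exprn_ege1.
pose k : R := n.+1%:R; have k1 : 1 <= k by rewrite ler1n.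
have k0 : 0 < k by rewrite ltr0n.
(* Chosen so that [q], whose Lipschitz constant is at most [N * M * L], varies by at most [M / 2]
   over the distance [k * de]; see [deE]. *)
pose de : R := (2 * (k * (L * N)))^-1.
have LN1 : 1 <= L * N by rewrite mulr_ege1.
have kLN1 : 1 <= k * (L * N) by rewrite mulr_ege1.
have de0 : 0 < de by rewrite invr_gt0; lra.
have deE : N * (L * (k * de)) = 2^-1.
  by rewrite /de; field; rewrite !gt_eqF//; lra.
have de1 : de <= 1 by rewrite /de invf_le1; lra.
(* A cube of half-side [eta] changes each weight by at most [k * eta], half of the margin
   [de / (2 * k)] that the weights of [wc] below have above 0. *)
pose eta : R := de / (4 * k ^+ 2).
have eta0 : 0 < eta by rewrite divr_gt0// mulr_gt0// exprn_gt0.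
have ketaE : k * eta = de / (4 * k) by rewrite /eta; field; rewrite gt_eqF.
exists (4 / (2 * eta) ^+ n) => [|q qE al0 al0r].
  by rewrite divr_gt0// exprn_gt0// mulr_gt0.
have [al1 /eqP al1r al1max] : exists2 al1 : {ffun 'I_n.+1 -> 'I_r.+1}, msize al1 == r &
    forall al, msize al == r -> `|q (weight_node al)| <= `|q (weight_node al1)|.
  have al0r' : msize al0 == r by apply/eqP.
  by case: (@Order.TotalTheory.arg_maxP _ _ _ al0 (fun al => msize al == r)
    (fun al => `|q (weight_node al)|) al0r') => al H1 H2; exists al.
pose w1 := weight_node al1; pose M : R := `|q w1|.
rewrite -/w1 -/M in al1max.
have M0 : 0 <= M by exact: normr_ge0.
have w1_01 i : 0 <= w1 0 i <= 1.
  rewrite mxE divr_ge0//= ler_pdivrMr ?mul1r ?ler_nat; last by rewrite ltr0n.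
  by rewrite -ltnS.
have node_sum al : msize al = r -> \sum_i weight_node al 0 i = 1.
  move=> alr; under eq_bigr do rewrite mxE.
  by rewrite -mulr_suml -natr_sum -/(msize al) alr divff// pnatr_eq0 -lt0n.
(* The node [w1] may lie on the boundary of the simplex. Pulling it slightly towards the barycentre
   leaves room for a whole cube of parameters. *)
pose wc : 'rV[R]_n.+1 := \row_i ((1 - de / 2) * w1 0 i + de / 2 * k^-1).
have wc1 : \sum_i wc 0 i = 1.
  under eq_bigr do rewrite mxE; rewrite big_split/= -mulr_sumr node_sum//.
  rewrite sumr_const card_ord -[X in _ + X]mulr_natr -mulrA mulVf ?mulr1 ?subrK//.
  by rewrite gt_eqF.
pose B := [set t : n.-tuple (measurableTypeR R) |
  forall l, `|tnth t l - (\row_l wc 0 (widen_ord (leqnSn n) l)) 0 l| <= eta].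
have kV : 0 < k^-1 <= 1 by rewrite invr_gt0 k0 invf_le1.
have Bw t : B t -> (forall i, 0 < chart_weight t 0 i) /\
    \sum_i `|chart_weight t 0 i - w1 0 i| <= k * de.
  move=> Bt; have [|H1 H2] := @chart_weight_near wc eta t (ltW eta0) wc1.
    by move=> l; have := Bt l; rewrite mxE.
  split => [i|].
    have := H1 i; rewrite -/k ketaE ler_norml => /andP[+ _]; rewrite lerBrDr.
    apply: lt_le_trans; rewrite mxE.
    have -> : de / 2 * k^-1 = 2 * (de / (4 * k)) by field; rewrite gt_eqF.
    have : 0 < de / (4 * k) by rewrite divr_gt0// mulr_gt0.
    have : 0 <= (1 - de / 2) * w1 0 i by rewrite mulr_ge0//; [lra|have /andP[] := w1_01 i].
    by move: ((1 - de / 2) * w1 0 i) (de / (4 * k)) => u v u_ge0 v_gt0; lra.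
  apply: (@le_trans _ _ (\sum_i (`|chart_weight t 0 i - wc 0 i| + de / 2))).
    apply: ler_sum => i _; rewrite -(subrKA (wc 0 i)).
    apply: le_trans (ler_normD _ _) _; rewrite lerD2l mxE.
    rewrite (_ : _ - w1 0 i = de / 2 * (k^-1 - w1 0 i)); last by ring.
    rewrite normrM gtr0_norm ?divr_gt0// ler_piMr ?divr_ge0 ?(ltW de0)//.
    move: (k^-1) (w1 0 i) kV (w1_01 i) => a b /andP[a0 a1] /andP[b0 b1].
    by rewrite ler_norml; apply/andP; split; lra.
  rewrite big_split/= sumr_const card_ord -[X in _ + X]mulr_natl -/k.
  apply: le_trans (lerD H2 (lexx _)) _.
  have nk : n%:R <= k by rewrite ler_nat.
  have E1 : n%:R * eta <= k * eta by rewrite ler_wpM2r// ltW.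
  have E2 : k * eta <= k * de / 4.
    rewrite ketaE (_ : de / (4 * k) = k^-1 * (de / 4)); last by field; rewrite gt_eqF.
    rewrite -mulrA ler_wpM2r ?divr_ge0 ?(ltW de0)//.
    by case/andP: kV => _ /le_trans; apply.
  move: E1 E2 => E1 E2; rewrite -mulrA.
  have E3 : k * (de / 2) = k * de / 2 by rewrite mulrA.
  have kde : 0 < k * de by rewrite mulr_gt0.
  by move: (n%:R * eta) (k * eta) (k * de) (k * (de / 2)) E1 E2 E3 kde => a b e f E1 E2 E3 kde; lra.
have qB t : B t -> M / 2 <= `|q (chart_weight t)|.
  move=> /Bw[wt0 wt1].
  have qw1 : q w1 = sp_eval (nodal_sp coord_aff (fun al => q (weight_node al))) w1.
    by apply: qE; exact: node_sum.
  have qwt := qE _ (chart_weight_sum t).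
  have H : `|q w1 - q (chart_weight t)| <= M / 2.
    rewrite qw1 qwt; apply: le_trans (nodal_lip r0 _ _ _ _) _.
    - by move=> j i; rewrite mxE; case: (_ && _); rewrite ?normr1 ?normr0.
    - by move=> j; rewrite coord_affE.
    - move=> j; rewrite coord_affE ltW//= -(chart_weight_sum t) (bigD1 j)//= lerDl.
      by apply: sumr_ge0 => i _; exact: ltW.
    have S1 : \sum_(al : {ffun 'I_n.+1 -> 'I_r.+1} | msize al == r) `|q (weight_node al)| <= N * M.
      apply: (@le_trans _ _ (\sum_(al : {ffun 'I_n.+1 -> 'I_r.+1} | msize al == r) M)).
        exact: ler_sum.
      rewrite sumr_const -[leLHS]mulr_natl ler_wpM2r// ler_nat; exact: max_card.
    rewrite (eq_bigr (fun i => `|chart_weight t 0 i - w1 0 i|)); last by move=> i _; rewrite distrC.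
    have S2 : L * \sum_i `|chart_weight t 0 i - w1 0 i| <= L * (k * de) by rewrite ler_wpM2l//; lra.
    rewrite (_ : M / 2 = N * M * (L * (k * de))); last by rewrite -deE; ring.
    apply: ler_pM S1 S2; first exact: sumr_ge0.
    by rewrite mulr_ge0 ?sumr_ge0//; lra.
  have := ler_normD (q (chart_weight t)) (q w1 - q (chart_weight t)).
  by rewrite subrKC -/M => H'; lra.
have mB : measurable B by exact: measurable_cube.
have muB : lebesgue_Rn R n B = ((2 * eta) ^+ n)%:E.
  exact: (@lebesgue_Rn_cube R n (\row_l wc 0 (widen_ord (leqnSn n) l)) eta (ltW eta0)).
have mq (D : set (n.-tuple (measurableTypeR R))) : measurable_fun D (fun t => ((q (chart_weight t)) ^+ 2)%:E).
  apply/measurable_EFinP; apply: measurable_funX.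
  rewrite (_ : (fun _ => _) = fun t =>
    sp_eval (nodal_sp coord_aff (fun al => q (weight_node al))) (chart_weight t)).
    by apply: measurable_sp_eval_comp => i; exact: measurable_chart_weight.
  by apply/funext => t; rewrite qE// chart_weight_sum.
have I1 : (((M / 2) ^+ 2 * (2 * eta) ^+ n)%:E <=
   \int[lebesgue_Rn R n]_(t in ref_simplex) ((q (chart_weight t)) ^+ 2)%:E)%E.
  apply: (@le_trans _ _ (\int[lebesgue_Rn R n]_(t in B) ((q (chart_weight t)) ^+ 2)%:E)%E); last first.
    apply: ge0_subset_integral => //; first exact: measurable_ref_simplex.
    - by move=> t _; rewrite lee_fin sqr_ge0.
    - by move=> t /Bw[].
  rewrite [leLHS]EFinM -muB -integral_cst//; apply: ge0_le_integral => //.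
  - by move=> t _; rewrite lee_fin sqr_ge0.
  - move=> t Bt; rewrite lee_fin -[leRHS]real_normK ?num_real//.
    by have := qB _ Bt => H; rewrite lerXn2r// nnegrE ?divr_ge0// (le_trans _ H)// divr_ge0.
apply: (@le_trans _ _ ((4 / (2 * eta) ^+ n)%:E * ((M / 2) ^+ 2 * (2 * eta) ^+ n)%:E)%E).
  rewrite -EFinM lee_fin [leRHS](_ : _ = M ^+ 2); last first.
    have : (2 * eta) ^+ n != 0 by rewrite expf_neq0// gt_eqF// mulr_gt0.
    by move: ((2 * eta) ^+ n) => u u0; field.
  rewrite -[leLHS]real_normK ?num_real// lerXn2r ?nnegrE//.
  by apply: al1max; apply/eqP.
by rewrite lee_wpmul2l// lee_fin divr_ge0// exprn_ge0// mulr_ge0// ltW.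
Qed.

End reference.

Section element_estimate.
Context (R : realType) (n r : nat) (A : 'M[R]_(n.+3, n.+2)).
Hypotheses (fA : affinely_independent A) (r0 : (0 < r)%N).
Variable sigma : R.
Hypotheses (sigma1 : 1 <= sigma) (chunkA : chunkiness (simplex A) <= sigma).

Let h := diam (simplex A).
Let h0 : 0 < h := diam_simplex_gt0 fA (ltn0Sn _).

Lemma bary_gradient_diam j i : `|(bary A j).1 0 i| <= 4 * sigma / h.
Proof.
have s0 : 0 < sigma by exact: lt_le_trans ltr01 sigma1.
have [c [rho [rho0 hrho cr]]] := inscribed_ball fA (ltn0Sn _) s0 chunkA.
apply: le_trans (bary_gradient_le fA rho0 cr j i) _.
rewrite ler_pdivrMr// mulrAC ler_pdivlMr//.
by move: hrho; rewrite -/h => H; lra.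
Qed.

Lemma osimplex_measure_le : (lebesgue_Rn R n.+2 (vec @^-1` osimplex A) <= ((2 * h) ^+ n.+2)%:E)%E.
Proof.
apply: (bounded_set_measure_le (c := row ord0 A)); first exact: ltW.
  by apply: open_measurable_vec; exact: osimplex_open.
move=> x /osimplex_simplex Ax i.
have -> : x 0 i - row ord0 A 0 i = (x - row ord0 A) 0 i by rewrite !mxE.
apply: le_trans (coord_enorm _ i) _.
exact: diam_ub (simplex_bounded A) Ax (simplex_row A ord0).
Qed.

(** Each derivative costs [4 * sigma / h] up to constants and the volume gives [h ^+ n.+2], so the
    weight leaves the power [h ^+ n] whatever [m] is. The condition [m <= r] makes the constant
    uniform in [m]. *)
Lemma seminorm_upper (d : {ffun 'I_n.+3 -> 'I_r.+1} -> R) u (m : nat) : (m <= r)%N ->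
  (forall x, osimplex A x -> u x = sp_eval (nodal_sp (bary A) d) x) ->
  ((h ^ (2 * m%:Z - 2))%:E * sobolev_seminorm2 m (osimplex A) u <=
   ((r.+1 ^ n.+2)%:R * ((r%:R * (r%:R * (4 * sigma))) ^+ r * r%:R ^+ r) ^+ 2 * 2 ^+ n.+2 *
     h ^+ n * (\sum_(al : {ffun 'I_n.+3 -> 'I_r.+1} | msize al == r) `|d al|) ^+ 2)%:E)%E.
Proof.
move=> mr ud; pose S : R := \sum_(al : {ffun 'I_n.+3 -> 'I_r.+1} | msize al == r) `|d al|.
rewrite -/S.
have S0 : 0 <= S by exact: sumr_ge0.
have r1 : (1 : R) <= r%:R by rewrite ler1n.
have s0 : 0 < sigma by exact: lt_le_trans ltr01 sigma1.
pose a : R := r%:R * (r%:R * (4 * sigma)).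
have a1 : 1 <= a by rewrite /a !mulr_ege1//; lra.
have bo : bounded_set (osimplex A).
  have [N [Nr NA]] := simplex_bounded A; exists N; split => // X NX x /osimplex_simplex.
  exact: NA.
pose M := (r%:R * (r%:R * (4 * sigma / h))) ^+ m * S * r%:R ^+ r.
have H := @sobolev_seminorm2_le R n.+2 m (osimplex A) u (nodal_sp (bary A) d) M ((2 * h) ^+ n.+2)
  (osimplex_open fA) bo ud _ osimplex_measure_le.
have {}H : (sobolev_seminorm2 m (osimplex A) u <= ((m.+1 ^ n.+2)%:R * (M ^+ 2 * (2 * h) ^+ n.+2))%:E)%E.
  apply: H => s x sm /osimplex_simplex Ax; rewrite /M -sm; apply: nodal_derivs_le => //.
  - by rewrite divr_ge0 ?mulr_ge0 ?ltW.
  - by move=> j i; exact: bary_gradient_diam.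
  - by move=> j; rewrite bary_le1// (simplexP fA x).1.
have hz : h ^ (2 * m%:Z - 2) = h ^+ (2 * m) / h ^+ 2.
  by rewrite expfzDr ?gt_eqF// -PoszM -exprnN -exprnP.
apply: (@le_trans _ _ ((h ^ (2 * m%:Z - 2))%:E * ((m.+1 ^ n.+2)%:R * (M ^+ 2 * (2 * h) ^+ n.+2))%:E)%E).
  by rewrite lee_wpmul2l// lee_fin exprz_ge0// ltW.
rewrite -EFinM lee_fin hz.
have ME : M = a ^+ m * S * r%:R ^+ r / h ^+ m.
  by rewrite /M !mulrA -/a exprMn exprVn /a !mulrA; ring.
rewrite [leLHS](_ : _ = (m.+1 ^ n.+2)%:R * (a ^+ m * r%:R ^+ r) ^+ 2 * 2 ^+ n.+2 * h ^+ n * S ^+ 2); last first.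
  have E1 : h ^+ (2 * m) = (h ^+ m) ^+ 2 by rewrite mulnC exprM.
  have E2 : (2 * h) ^+ n.+2 = 2 ^+ n.+2 * (h ^+ n * h ^+ 2) by rewrite exprMn -exprD addn2.
  rewrite ME E1 E2.
  have hm : h ^+ m != 0 by rewrite expf_neq0// gt_eqF.
  have hh : h != 0 by rewrite gt_eqF.
  move: (h ^+ m) (h ^+ n) ((m.+1 ^ n.+2)%:R : R) (a ^+ m) (r%:R ^+ r : R) (2 ^+ n.+2 : R) hm.
  move=> hm hn ma am rr tt hm0.
  by field; rewrite hm0 hh.
have am : (a ^+ m * r%:R ^+ r) ^+ 2 <= (a ^+ r * r%:R ^+ r) ^+ 2.
  by rewrite lerXn2r ?nnegrE ?mulr_ge0 ?exprn_ge0//; [lra|lra|rewrite ler_wpM2r ?exprn_ge0// ler_weXn2l].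
rewrite -/a; apply: ler_wpM2r; first exact: exprn_ge0.
apply: ler_wpM2r; first by rewrite exprn_ge0// ltW.
apply: ler_wpM2r; first exact: exprn_ge0.
apply: ler_pM => //; rewrite ?exprn_ge0//; last by rewrite ler_nat leq_exp2r.
by rewrite mulr_ge0 ?exprn_ge0//; lra.
Qed.

End element_estimate.

Lemma chart_osimplex (R : realType) n (A : 'M[R]_(n.+2, n.+1)) j : affinely_independent A ->
  chart (row' j A) @^-1` osimplex (row' j A) = ref_simplex (R := R) (n := n).
Proof.
move=> fA; apply/seteqP; split => [t|t H].
  move=> /(osimplex_faceP fA)[_ H] i.
  have [_ <-] := bary_face fA j (chart_weight_sum t).
  by apply: H; rewrite eq_sym; exact: neq_lift.
exists (chart_weight t); split => //; exact: chart_weight_sum.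
Qed.

(** The surface integral is the Jacobian times an integral over the reference simplex, to which
    [reference_lower_bound] applies. By [jacobian_ge] and [diam <= 2 * sigma * rho], the Jacobian is
    at least a constant times [diam ^+ n], hence the factor [(4 * sigma) ^+ n.+1]. *)
Lemma face_lower (R : realType) (n r : nat) (sigma : R) : (0 < r)%N -> 0 < sigma ->
  exists2 C : R, 0 < C & forall (A : 'M[R]_(n.+2, n.+1)) j f p z,
    affinely_independent A -> chunkiness (simplex A) <= sigma ->
    poly_fun r p -> (forall x, osimplex (row' j A) x -> f x = p x) ->
    is_node (fun i => row i (row' j A)) r z ->
    (((p z) ^+ 2 * diam (simplex A) ^+ n)%:E <=
      C%:E * surface_L2norm2 (row' j A) (osimplex (row' j A)) f)%E.
Proof.
move=> r0 sigma0; have [K K0 HK] := @reference_lower_bound R n r r0.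
exists (K * (n.+1`!%:R * (4 * sigma) ^+ n.+1)).
  by rewrite !mulr_gt0 ?exprn_gt0 ?mulr_gt0// ltr0n fact_gt0.
move=> A j f p z fA chunkA pr fp [al alr ->]; set h := diam _; set F := row' j A.
have h0 : 0 < h := diam_simplex_gt0 fA (ltn0Sn _).
have [c [rho [rho0 hrho cr]]] := inscribed_ball fA (ltn0Sn _) sigma0 chunkA.
have HJ := jacobian_ge j fA rho0 cr; rewrite -/h in hrho HJ.
pose q (w : 'rV[R]_n.+1) := p (w *m F).
have qE (w : 'rV[R]_n.+1) : \sum_i w 0 i = 1 ->
    q w = sp_eval (nodal_sp (@coord_aff R n) (fun al => q (@weight_node R n r al))) w.
  move=> w1; rewrite /q mulmx_sum_row (lagrange_interp _ (r := r) r0 pr)// nodal_spE.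
  apply: eq_bigr => b _; congr (_ * _).
    congr p; rewrite mulmx_sum_row /node; apply: eq_bigr => i _; by rewrite mxE.
  by congr mbin; apply/funext => i; rewrite coord_affE.
have := HK q qE al alr.
set I1 := (\int[_]_(t in _) _)%E => HI.
have I1E : I1 = (\int[lebesgue_Rn R n]_(t in chart F @^-1` osimplex F) ((f (chart F t)) ^+ 2)%:E)%E.
  rewrite chart_osimplex//; apply: eq_integral => t /set_mem Ht; rewrite fp//.
  by have : (chart F @^-1` osimplex F) t by rewrite chart_osimplex.
have I10 : (0 <= I1)%E by apply: integral_ge0 => t _; rewrite lee_fin sqr_ge0.
rewrite /surface_L2norm2 -I1E muleA -EFinM.
have -> : node (fun i => row i F) al = weight_node R al *m F.
  by rewrite mulmx_sum_row /node; apply: eq_bigr => i _; rewrite mxE.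
apply: (@le_trans _ _ ((K * h ^+ n)%:E * I1)%E).
  rewrite [in leLHS]mulrC [in leRHS]mulrC !EFinM -muleA lee_wpmul2l// lee_fin exprn_ge0// ltW//.
apply: lee_wpmul2r => //; rewrite lee_fin -[leRHS]mulrA; apply: ler_wpM2l; first exact: ltW.
have f0 : 0 < n.+1`!%:R :> R by rewrite ltr0n fact_gt0.
apply: le_trans (ler_wpM2l _ HJ); last by rewrite mulr_ge0 ?exprn_ge0 ?mulr_ge0// ltW.
have -> : n.+1`!%:R * (4 * sigma) ^+ n.+1 * ((rho / 2) ^+ n.+1 / (n.+1`!%:R * h)) =
    (4 * sigma * (rho / 2)) ^+ n.+1 / h.
  rewrite [in RHS]exprMn; move: ((4 * sigma) ^+ n.+1) ((rho / 2) ^+ n.+1) => a b.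
  by move: (n.+1`!%:R : R) f0 => k k0; field; rewrite !gt_eqF.
rewrite ler_pdivlMr// -exprSr lerXn2r ?nnegrE//; first exact: ltW.
  by apply: ltW; rewrite !mulr_gt0.
by lra.
Qed.

(** * The interface is covered by the faces on it *)

Section generic_point.
Context (R : realType) (n : nat).
Implicit Types (U : set 'rV[R]_n) (l : aff R n) (x y : 'rV[R]_n).

Lemma continuous_segment x y : continuous (fun s : R => s *: x + (1 - s) *: y).
Proof.
move=> s; apply: cvgD; apply: cvgZr_tmp; first exact: cvg_id.
by apply: cvgB; [exact: cvg_cst|exact: cvg_id].
Qed.

Lemma segment_nearby U x y : open U -> U x ->
  exists2 s : R, 0 < s <= 1 & U (s *: y + (1 - s) *: x).
Proof.
move=> oU Ux; have c := @continuous_segment y x 0.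
have : nbhs (0 : R) [set s | U (s *: y + (1 - s) *: x)].
  apply: c; rewrite scale0r subr0 scale1r add0r; exact: open_nbhs_nbhs.
move=> /nbhs_ballP[e /= e0 eU]; exists (Num.min (e / 2) 1).
  by rewrite lt_min divr_gt0// ltr01 ge_min lexx orbT.
apply: eU; rewrite /ball/= sub0r normrN ger0_norm; last by rewrite le_min divr_ge0 ?ltW// ler01.
by rewrite gt_min; apply/orP; left; lra.
Qed.

Lemma aff_eval_sub (a b : R) l l' x :
  aff_eval (a *: l.1 - b *: l'.1, a * l.2 - b * l'.2) x = a * aff_eval l x - b * aff_eval l' x.
Proof.
rewrite /aff_eval /= !mulrDr !mulr_sumr opprD addrACA -sumrB; congr (_ + _).
by apply: eq_bigr => i _; rewrite !mxE; ring.
Qed.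

Lemma ball_segment x (e : R) y z (s : R) : ball x e y -> ball x e z -> 0 <= s <= 1 ->
  ball x e (s *: z + (1 - s) *: y).
Proof.
move=> [e0 xy] [_ xz] /andP[s0 s1]; split => // i j.
have := xz i j; have := xy i j; rewrite /ball/= !mxE.
set a := x i j; set b := y i j; set c := z i j.
have -> : a - (s * c + (1 - s) * b) = s * (a - c) + (1 - s) * (a - b) by ring.
move=> H1 H2; apply: le_lt_trans (ler_normD _ _) _; rewrite !normrM.
rewrite (ger0_norm s0) (@ger0_norm _ (1 - s)) ?subr_ge0//.
have aux (u v : R) : v < e -> u < e -> s * v + (1 - s) * u < e.
  move=> ve ue; have [->|s00] := eqVneq s 0; first by rewrite mul0r subr0 mul1r add0r.
  have : s * v < s * e by rewrite ltr_pM2l// lt0r s00.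
  have : (1 - s) * u <= (1 - s) * e by rewrite ler_wpM2l ?subr_ge0// ltW.
  by have : s * e + (1 - s) * e = e by [ring]; lra.
exact: aux.
Qed.

(** Finitely many hyperplanes have empty interior: from a zero of [l], any move towards a point
    where [l] does not vanish leaves the hyperplane at once. *)
Lemma generic_point (t : seq (aff R n)) U : open U -> U !=set0 ->
  (forall l, l \in t -> exists y, aff_eval l y != 0) ->
  exists2 x, U x & forall l, l \in t -> aff_eval l x != 0.
Proof.
elim: t U => [|l t IH] U oU [u Uu] tl; first by exists u.
have [y ly] := tl l (mem_head _ _).
have [||l' l't|x [Ux lx] xt] := IH (U `&` [set x | aff_eval l x != 0]).
- apply: openI => //; apply: (@open_comp _ _ (aff_eval l) [set z | z != 0]); last exact: open_neq.
  by move=> z _; exact: aff_eval_continuous.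
- have [l0|l0] := eqVneq (aff_eval l u) 0; last by exists u.
  have [s /andP[s0 s1] Us] := segment_nearby y oU Uu.
  exists (s *: y + (1 - s) *: u); split => //=.
  by rewrite aff_eval_conv l0 mulr0 addr0 mulf_neq0// gt_eqF.
- by apply: tl; rewrite inE l't orbT.
by exists x => // l'; rewrite inE => /predU1P[->//|/xt].
Qed.

End generic_point.

Section interface.
Context (R : realType) (n : nat).
Variables (D K1 : set 'rV[R]_n) (Th TH : mesh R n).
Hypotheses (oD : open D) (K1D : K1 `<=` D).
Hypotheses (trh : triangulates Th K1) (trH : triangulates TH (D `\` K1)).
Let Gamma := boundary K1 `\` boundary D.

Lemma mesh_cover_closed (T : mesh R n) : closed (mesh_cover T).
Proof.
apply: closed_bigcup => [|i _]; first exact: finite_finset.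
exact/simplex_closed/mesh_nondegenerate.
Qed.

Lemma face_closed (T : mesh R n) (f : face T) : closed (simplex (face_vert f)).
Proof.
have fA := @mesh_nondegenerate _ _ T f.1.
rewrite (_ : simplex _ = [set y | aff_eval (bary (T f.1) f.2) y = 0] `&` simplex (T f.1)).
  apply: closedI; last exact: simplex_closed.
  apply: (@closed_comp _ _ (aff_eval (bary (T f.1) f.2)) [set x | x = 0]); last exact: closed_eq.
  by move=> y _; exact: aff_eval_continuous.
by apply/seteqP; split => y /(simplex_faceP fA).
Qed.

Lemma osimplex_cover_disjoint (T T' : mesh R n) i x :
  (forall j, osimplex (T i) `&` osimplex (T' j) = set0) ->
  osimplex (T i) x -> ~ mesh_cover T' x.
Proof.
move=> TT' Ti [j _ T'j].
have /nbhs_ballP[e /= e0 eT] : nbhs x (osimplex (T i)).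
  apply: open_nbhs_nbhs; split => //; apply: osimplex_open; exact: mesh_nondegenerate.
have [y yj xy] := simplex_approx (mesh_nondegenerate j) T'j e0.
by have : set0 y by rewrite -(TT' j); split => //; exact: eT.
Qed.

Lemma osimplex_meshes_disjoint i j : osimplex (Th i) `&` osimplex (TH j) = set0.
Proof.
by apply/seteqP; split => // x [/trh.1 K1x /trH.1 []].
Qed.

(** Each closed element is approximated from its open part, which lies on one side only, so a point
    of both meshes is a limit of both sides. Conversely both covers are closed, and away from [K1]
    the points of [D] belong to [TH]. *)
Lemma interfaceP x : Gamma x <-> [/\ D x, mesh_cover Th x & mesh_cover TH x].
Proof.
split => [[[cx ix] bx]|[Dx hx Hx]].
  have Dx : D x.
    apply: contrapT => nDx; apply: bx; split; last by rewrite (interior_id _).1.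
    exact: closure_subset K1D _ cx.
  split => //.
    apply: (mesh_cover_closed (T := Th)); exact: closure_subset trh.2 _ cx.
  apply: (mesh_cover_closed (T := TH)) => B Bx; apply: contrapT => H; apply: ix.
  have : nbhs x (B `&` D) by apply: filterI => //; exact: open_nbhs_nbhs.
  rewrite /interior; apply: filterS => y [By Dy]; apply: contrapT => nK; apply: H.
  by exists y; split => //; apply: trH.2.
split; last by move=> [_]; rewrite (interior_id _).1.
split.
  move=> B /nbhs_ballP[e /= e0 eB]; have [i _ ix] := hx.
  have [y yi xy] := simplex_approx (mesh_nondegenerate i) ix e0.
  by exists y; split; [exact: trh.1 yi|exact: eB].
move=> /nbhs_ballP[e /= e0 eK]; have [i _ ix] := Hx.
have [y yi xy] := simplex_approx (mesh_nondegenerate i) ix e0.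
by have [_] := trH.1 _ _ yi; apply; exact: eK.
Qed.

(* Near x, join an element of Th to an element of TH by a segment that avoids
   all the faces of codimension 2: it leaves the mesh Th through the relative
   interior of a facet, at a point of Gamma. *)
Lemma interface_faces x : Gamma x ->
  exists2 f : face Th, face_on Gamma f & simplex (face_vert f) x.
Proof.
move=> Gx; have /interfaceP[Dx [i0 _ ix] [k0 _ kx]] := Gx.
(* Inside this ball every closed face that is met contains [x], so it suffices to find a face on the
   interface anywhere in the ball. *)
have : nbhs x (D `&` ~` \bigcup_(f in [set f : face Th | ~ simplex (face_vert f) x]) simplex (face_vert f)).
  apply: open_nbhs_nbhs; split; last by split => // -[f].
  apply: openI => //; rewrite openC; apply: closed_bigcup => [|f _]; [exact: finite_finset|exact: face_closed].
move=> /nbhs_ballP[e /= e0 eB].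
pose B := ball x e; have oB : open B by exact: ball_open.
pose nz (ia : 'I_(mesh_size Th) * 'I_n.+1) := bary (Th ia.1) ia.2.
have [|||y [By yi] ynz] := @generic_point R n [seq nz ia | ia <- enum {: 'I_(mesh_size Th) * 'I_n.+1}] (B `&` osimplex (Th i0)).
- by apply: openI => //; apply: osimplex_open; exact: mesh_nondegenerate.
- by have [y yi xy] := simplex_approx (mesh_nondegenerate i0) ix e0; exists y.
- move=> _ /mapP[[i a] _ ->]; exists (row a (Th i)).
  by rewrite bary_row ?eqxx ?oner_eq0//; exact: mesh_nondegenerate.
have {}ynz i a : aff_eval (bary (Th i) a) y != 0.
  by apply: ynz; apply/mapP; exists (i, a) => //; rewrite mem_enum.
(* The zero set is the hyperplane through [y] and the codimension 2 plane where the coordinates [a]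
   and [b] vanish. With [z] off it, the segment from [y] to [z] misses that plane. *)
pose w i a b : aff R n := (aff_eval (bary (Th i) a) y *: (bary (Th i) b).1 - aff_eval (bary (Th i) b) y *: (bary (Th i) a).1,
  aff_eval (bary (Th i) a) y * (bary (Th i) b).2 - aff_eval (bary (Th i) b) y * (bary (Th i) a).2).
have wE i a b z : aff_eval (w i a b) z = aff_eval (bary (Th i) a) y * aff_eval (bary (Th i) b) z
    - aff_eval (bary (Th i) b) y * aff_eval (bary (Th i) a) z.
  exact: aff_eval_sub.
have [|||z [Bz zk] znz] := @generic_point R n [seq w iab.1.1 iab.1.2 iab.2 |
    iab <- enum [pred iab : 'I_(mesh_size Th) * 'I_n.+1 * 'I_n.+1 | iab.1.2 != iab.2]] (B `&` osimplex (TH k0)).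
- by apply: openI => //; apply: osimplex_open; exact: mesh_nondegenerate.
- by have [z zk xz] := simplex_approx (mesh_nondegenerate k0) kx e0; exists z.
- move=> l /mapP[[[i a] b]]; rewrite mem_enum inE/= => ab ->; exists (row b (Th i)).
  have fA := @mesh_nondegenerate _ _ Th i.
  by rewrite wE !bary_row// eqxx [b == a]eq_sym (negbTE ab) mulr0 mulr1 subr0.
have {}znz i a b : a != b -> aff_eval (w i a b) z != 0.
  by move=> ab; apply: znz; apply/mapP; exists (i, a, b) => //; rewrite mem_enum inE.
pose g (s : R) := s *: z + (1 - s) *: y.
have cg : continuous g by exact: continuous_segment.
have Bg s : 0 <= s <= 1 -> B (g s) by exact: ball_segment.
pose Q := [set s | 0 <= s <= 1 /\ mesh_cover Th (g s)].
have Q0 : Q 0.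
  split; first by rewrite lexx ler01.
  by rewrite /g scale0r subr0 scale1r add0r; exists i0 => //; exact: osimplex_simplex.
have supQ : has_sup Q by split; [exists 0|exists 1 => s [/andP[]]].
have cQ : closed Q.
  rewrite (_ : Q = (g @^-1` mesh_cover Th) `&` ([set s | 0 <= s] `&` [set s | s <= 1])); last first.
    by apply/seteqP; split => [s [/andP[? ?] ?]//|s [? [? ?]]]; split => //; apply/andP.
  apply: closedI; last by apply: closedI; [exact: closed_ge|exact: closed_le].
  by apply: closed_comp => [s _|]; [exact: cg|exact: mesh_cover_closed].
(* The last parameter at which the segment is in [Th]. Just beyond it the points are in [D] and not
   in [K1], hence in [TH], which is closed; so [g s] lies in both meshes. *)
pose s := sup Q; have [s01 hs] : Q s by exact: closed_sup.
have zh : ~ mesh_cover Th z.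
  apply: (osimplex_cover_disjoint (i := k0)) zk => j; rewrite setIC; exact: osimplex_meshes_disjoint.
have s1 : s < 1.
  rewrite lt_neqAle; case/andP: s01 => _ ->; rewrite andbT; apply/negP => /eqP s1.
  by move: hs; rewrite /g s1 subrr scale0r addr0 scale1r.
have Hs : mesh_cover TH (g s).
  have := mesh_cover_closed (T := TH); move=> /closed_approx; apply => d d0.
  have := cg s; move=> /cvg_ballP/(_ _ d0) /nbhs_ballP[c /= c0 cB].
  pose s' := Num.min (s + c / 2) 1.
  have ss' : s < s' by rewrite lt_min s1 ltrDl divr_gt0.
  have s'1 : 0 <= s' <= 1.
    by rewrite ge_min lexx orbT andbT ltW//; apply: le_lt_trans ss'; case/andP: s01.
  exists (g s'); last first.
    apply: cB; rewrite /ball/= ltr_distlC.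
    have : s' <= s + c / 2 by rewrite ge_min lexx.
    by move: c0 ss'; clearbody s'; lra.
  have Dg : D (g s') by have [] := eB _ (Bg _ s'1).
  apply: trH.2; split => // /trh.2 hg.
  by have := ub_le_sup supQ.2 (conj s'1 hg); rewrite leNgt ss'.
have Gg : Gamma (g s) by apply/interfaceP; split => //; have [] := eB _ (Bg _ s01).
case: (hs) => i _ gi; have fA := @mesh_nondegenerate _ _ Th i.
have gi' := (simplexP fA _).1 gi.
have /existsNP[a /negP] : ~ forall a, 0 < aff_eval (bary (Th i) a) (g s).
  move=> /osimplexP - /(_ fA) gio.
  by apply: (osimplex_cover_disjoint (i := i)) gio Hs; exact: osimplex_meshes_disjoint.
rewrite -leNgt => ga; have {}ga : aff_eval (bary (Th i) a) (g s) = 0.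
  by apply/eqP; rewrite eq_le ga gi'.
have fo : face_on Gamma ((i, a) : face Th).
  exists (g s); split => //; apply/osimplex_faceP => //; split => // b ba.
  rewrite lt0r gi' andbT; apply/negP => /eqP gb.
  have ab : a != b by rewrite eq_sym.
  move: (znz i a b ab); rewrite wE; move: (ynz i a) (ynz i b) s01 ga gb.
  rewrite /g !aff_eval_conv.
  move: (aff_eval _ y) (aff_eval _ y) (aff_eval _ z) (aff_eval _ z) => ya yb za zb.
  move=> ya0 _ _ ga gb; have [s0|s0] := eqVneq s 0.
    by move: ga ya0; rewrite s0 mul0r add0r subr0 mul1r => ->; rewrite eqxx.
  have : s * (yb * za - ya * zb) = 0.
    have -> : s * (yb * za - ya * zb) =
      yb * (s * za + (1 - s) * ya) - ya * (s * zb + (1 - s) * yb) by ring.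
    by rewrite ga gb !mulr0 subr0.
  by move=> /eqP; rewrite mulf_eq0 (negbTE s0)/= => ->.
exists (i, a) => //; apply: contrapT => nx.
have [_] := eB _ (Bg _ s01); apply; exists (i, a) => //.
exact/simplex_faceP.
Qed.

End interface.

(** * The extension operator *)

Section mesh_interpolation.
Context (R : realType) (n r : nat).
Hypothesis r0 : (0 < r)%N.
Implicit Types (T : mesh R n) (vals v : 'rV[R]_n -> R) (x z : 'rV[R]_n).

(** Distinct multi-indices of the same size have an entry with [al j < be j], and the factor number
    [al j] of the corresponding [bin_poly] vanishes. *)
Lemma mbin_node (J : finType) (al be : {ffun J -> 'I_r.+1}) : msize al = r -> msize be = r ->
  mbin (fun j => (al j : nat)%:R : R) be = (be == al)%:R.
Proof.
move=> alr ber; have [->|ba] := eqVneq be al.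
  apply: big1 => j _; elim: (al j : nat) => [|k IH]; first by rewrite /bin_poly big_ord0.
  apply: (@mulfI _ (k.+1%:R : R)); first by rewrite pnatr_eq0.
  by rewrite mul_bin_poly mulr1 -[X in X - 1]natr1 addrK IH mulr1.
have /existsP[j jab] : [exists j, (al j < be j)%N].
  apply: contraNT ba => /existsPn H; apply/eqP/ffunP => j; apply/val_inj/eqP.
  have le_j k : (be k <= al k)%N by rewrite leqNgt; exact: H.
  have := @leqif_sum _ predT (fun k => be k == al k :> nat) (fun k => be k : nat) (fun k => al k : nat) (fun k _ => conj (le_j k) erefl).
  by rewrite -/(msize al) -/(msize be) alr ber => -[_]; rewrite eqxx => /esym/forallP/(_ j).
rewrite /mbin (bigD1 j)//= /bin_poly (bigD1 (Ordinal jab))//= subrr.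
by rewrite !mul0r.
Qed.

Definition interp_sp T vals (i : 'I_(mesh_size T)) : seq (R * seq (aff R n)) :=
  nodal_sp (bary (T i)) (fun al : {ffun 'I_n.+1 -> 'I_r.+1} => vals (node (fun j => row j (T i)) al)).

Lemma node_simplex k (A : 'M[R]_(k, n)) z : is_node (fun j => row j A) r z -> simplex A z.
Proof.
move=> [al alr ->]; exists (\row_j ((al j : nat)%:R / r%:R)); split.
- by move=> i; rewrite mxE divr_ge0.
- under eq_bigr do rewrite mxE; rewrite -mulr_suml -natr_sum -/(msize al) alr.
  by rewrite divff// pnatr_eq0 -lt0n.
- by rewrite mulmx_sum_row; apply: eq_bigr => j _; rewrite mxE.
Qed.

Lemma interp_node T vals i z : is_node (fun j => row j (T i)) r z ->
  sp_eval (interp_sp vals i) z = vals z.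
Proof.
move=> [al alr ->]; have fA := @mesh_nondegenerate _ _ T i.
have lamE j : r%:R * aff_eval (bary (T i) j) (node (fun j => row j (T i)) al) = (al j : nat)%:R.
  rewrite (_ : node _ _ = (\row_j ((al j : nat)%:R / r%:R)) *m T i); last first.
    by rewrite mulmx_sum_row; apply: eq_bigr => k _; rewrite mxE.
  have rn : r%:R != 0 :> R by rewrite pnatr_eq0 -lt0n.
  rewrite bary_comb ?mxE//; first by rewrite mulrC divfK.
  under eq_bigr do rewrite mxE.
  by rewrite -mulr_suml -natr_sum -/(msize al) alr divff.
rewrite nodal_spE (bigD1 al) ?alr//= [X in _ + X]big1 => [|be /andP[/eqP ber ba]].
  rewrite -[RHS]mulr1 addr0 -[X in _ = _ * X]/(true%:R) -(eqxx al) -(mbin_node alr alr).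
  by congr (_ * mbin _ _); apply/funext => j; exact: lamE.
rewrite (_ : (fun j => _) = fun j => (al j : nat)%:R) ?mbin_node// ?(negbTE ba) ?mulr0//.
by apply/funext => j; exact: lamE.
Qed.

Lemma interp_poly_fun T vals (i : 'I_(mesh_size T)) : poly_fun r (sp_eval (interp_sp vals i)).
Proof. exact: poly_fun_nodal. Qed.

(** By conformity [x] is a combination of vertices shared by both elements. The nodes on these
    vertices belong to both, the two polynomials take the values [vals] there, and unisolvence
    concludes. *)
Lemma interp_eq T vals i k x : simplex (T i) x -> simplex (T k) x ->
  sp_eval (interp_sp vals i) x = sp_eval (interp_sp vals k) x.
Proof.
move=> ix kx; have : common_face (T i) (T k) x by rewrite -mesh_conforming.
move=> [w [w0 w1 xE wk]]; pose J := {j in [pred j : 'I_n.+1 | w 0 j != 0]}.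
have /choice[t tE] : forall j : J, exists l, row (val j) (T i) = row l (T k).
  by move=> [j jw]; exact: wk.
have sumJ (V : zmodType) (F : 'I_n.+1 -> V) : (forall j, w 0 j = 0 -> F j = 0) ->
    \sum_j F j = \sum_(j : J) F (val j).
  move=> F0; rewrite -[RHS](big_sub _ F) [RHS]big_mkcond; apply: eq_bigr => j _.
  by rewrite inE; case: eqP => // /F0.
have -> : x = \sum_(j : J) w 0 (val j) *: row (val j) (T i).
  by rewrite xE mulmx_sum_row sumJ// => j ->; rewrite scale0r.
apply: (eq_poly_fun_on_nodes (r := r)) => //; [exact: interp_poly_fun|exact: interp_poly_fun|by rewrite -sumJ|].
move=> z zJ; rewrite !interp_node//.
  apply: is_node_sub zJ => j; exact: tE.
exact: (is_node_sub (s := val)) zJ.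
Qed.

(** Which element is picked is immaterial by [interp_eq]; the value 0 off the mesh is the one
    [lagrange_space] demands. *)
Definition interp_fun T vals x : R :=
  if [pick i | `[< simplex (T i) x >]] is Some i then sp_eval (interp_sp vals i) x else 0.

Lemma interp_funE T vals i x : simplex (T i) x -> interp_fun T vals x = sp_eval (interp_sp vals i) x.
Proof.
move=> ix; rewrite /interp_fun; case: pickP => [k /asboolP kx|/(_ i)]; first exact: interp_eq.
by move=> /asboolP.
Qed.

Lemma interp_fun_linear T (c : R) u v w :
  (forall x, w x = c * u x + v x) ->
  forall x, interp_fun T w x = c * interp_fun T u x + interp_fun T v x.
Proof.
move=> wE x; rewrite /interp_fun; case: pickP => [i _|_]; last by rewrite mulr0 addr0.
rewrite !nodal_spE mulr_sumr -big_split/=; apply: eq_bigr => al _.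
by rewrite wE mulrDl mulrA.
Qed.

Lemma continuous_within_bigcup (I : finType) (S : I -> set 'rV[R]_n) (f : 'rV[R]_n -> R^o) :
  (forall i, closed (S i)) -> (forall i, {within S i, continuous f}) ->
  {within \bigcup_i S i, continuous f}.
Proof.
move=> cS fS.
have H (s : seq I) : closed (\bigcup_(i in [set` s]) S i) /\ {within \bigcup_(i in [set` s]) S i, continuous f}.
  elim: s => [|i s [cs fs]].
    rewrite set_nil bigcup_set0; split; [exact: closed0|exact: continuous_subspace0].
  have -> : \bigcup_(k in [set` i :: s]) S k = S i `|` \bigcup_(k in [set` s]) S k.
    apply/seteqP; split => [x [k /=]|x [ix|[k ks kx]]].
    - by rewrite inE => /predU1P[->|ks kx]; [left|right; exists k].
    - by exists i => //=; rewrite mem_head.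
    - by exists k => //=; rewrite inE ks orbT.
  split; first exact: closedU.
  exact: withinU_continuous.
have [_] := H (index_enum I); congr ({within _, continuous f}).
by apply/seteqP; split => x [i _ ix]; exists i => //=; rewrite mem_index_enum.
Qed.

Lemma interp_lagrange_space T vals : lagrange_space r T (interp_fun T vals).
Proof.
split=> [|i|x nx].
- apply: continuous_within_bigcup => [i|i].
    exact/simplex_closed/mesh_nondegenerate.
  apply: (@subspace_eq_continuous _ _ _ (sp_eval (interp_sp vals i))).
    by move=> x /set_mem ix; rewrite /from_subspace (interp_funE _ ix).
  apply: continuous_subspaceT; exact: sp_eval_continuous.
- exists (sp_eval (interp_sp vals i)); first exact: interp_poly_fun.
  by move=> x /set_mem ix; exact: interp_funE.
rewrite /interp_fun; case: pickP => // i /asboolP ix.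
by case: nx; exists i.
Qed.

(** On an element [v] is its own interpolant, so the difference only sees the nodes where [vals]
    departs from [v]. *)
Lemma lagrange_interp_sub T v vals i x : lagrange_space r T v -> simplex (T i) x ->
  v x - interp_fun T vals x = sp_eval (interp_sp (fun z => v z - vals z) i) x.
Proof.
move=> [_ /(_ i)[p pr vp] _] ix; rewrite (interp_funE _ ix) !nodal_spE.
have fA := @mesh_nondegenerate _ _ T i.
have -> : v x = p x by apply: vp; exact/mem_set.
have xE : x = \sum_j aff_eval (bary (T i) j) x *: row j (T i).
  by rewrite -[LHS](bary_combE fA) mulmx_sum_row; apply: eq_bigr => j _; rewrite mxE.
rewrite [X in p X]xE (lagrange_interp _ r0 pr) ?(bary_sum fA)// -sumrB.
apply: eq_bigr => al /eqP alr; rewrite mulrBl vp//.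
by apply/mem_set/node_simplex; exists al.
Qed.

End mesh_interpolation.

(** * Faces of a conforming mesh *)

Section faces.
Context (R : realType) (n : nat).
Implicit Types (T : mesh R n.+1) (x z : 'rV[R]_n.+1).

Lemma row_face_vert T (f : face T) i : row i (face_vert f) = row (lift f.2 i) (T f.1).
Proof. by apply/rowP => k; rewrite !mxE. Qed.

Lemma face_subset T (f : face T) : simplex (face_vert f) `<=` simplex (T f.1).
Proof.
by move=> x /(simplex_faceP (@mesh_nondegenerate _ _ T f.1) _ _).1 [].
Qed.

Lemma oface_center T (f : face T) : oface f (\sum_i n.+1%:R^-1 *: row i (face_vert f)).
Proof.
exists (const_mx n.+1%:R^-1); split.
- by move=> i; rewrite mxE invr_gt0 ltr0n.
- by under eq_bigr do rewrite mxE; rewrite sumr_const card_ord -[LHS]mulr_natl divff// pnatr_eq0.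
- by rewrite mulmx_sum_row; apply: eq_bigr => i _; rewrite mxE.
Qed.

Lemma face_toward T (f : face T) x y (s : R) : oface f y -> simplex (face_vert f) x -> 0 < s <= 1 ->
  oface f (s *: y + (1 - s) *: x).
Proof.
move=> [w [w0 w1 ->]] [v [v0 v1 ->]] /andP[s0 s1]; exists (s *: w + (1 - s) *: v); split.
- by move=> i; rewrite !mxE ltr_pwDl ?mulr_gt0// mulr_ge0// subr_ge0.
- by under eq_bigr do rewrite !mxE; rewrite big_split/= -!mulr_sumr w1 v1; ring.
- by rewrite mulmxDl -!scalemxAl.
Qed.

Lemma face_closure T (f : face T) (S : set 'rV[R]_n.+1) : closed S -> oface f `<=` S ->
  simplex (face_vert f) `<=` S.
Proof.
move=> cS fS x fx; apply: contrapT => nS.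
have oS : open (~` S) by rewrite openC.
have [s s01 H] := segment_nearby (\sum_i n.+1%:R^-1 *: row i (face_vert f)) oS nS.
by apply: H; apply: fS; apply: face_toward => //; exact: oface_center.
Qed.

(** The grids compare faces as sets; this recovers the vertices. Conformity at the barycentre of [f]
    makes every vertex of [f] a vertex of the element of [f'], and none is the vertex opposite [f'],
    whose coordinate vanishes at that barycentre. *)
Lemma oface_subset_rows T (f f' : face T) : oface f `<=` oface f' ->
  exists2 t : 'I_n.+1 -> 'I_n.+1, injective t &
    forall i, row i (face_vert f) = row (t i) (face_vert f').
Proof.
move=> ff'; set c := \sum_i n.+1%:R^-1 *: row i (face_vert f).
have fc : oface f c by exact: oface_center.
have fA := @mesh_nondegenerate _ _ T f.1; have fA' := @mesh_nondegenerate _ _ T f'.1.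
have [c0 c1] := (osimplex_faceP fA' _ _).1 (ff' _ fc).
have [d0 d1] := (osimplex_faceP fA _ _).1 fc.
have cf : simplex (T f.1) c by apply/face_subset/osimplex_simplex.
have cf' : simplex (T f'.1) c by apply/face_subset/osimplex_simplex/ff'.
have : common_face (T f.1) (T f'.1) c by rewrite -mesh_conforming.
move=> [w [w0 w1 cE wk]].
have /choice[s sE] : forall i, exists j, row i (face_vert f) = row j (T f'.1).
  move=> i; rewrite row_face_vert; apply: wk; rewrite -(bary_comb _ fA w1) -cE.
  by rewrite gt_eqF// d1// eq_sym neq_lift.
pose W : 'rV[R]_n.+2 := \row_a \sum_(k < n.+1) (n.+1%:R^-1 * (s k == a)%:R).
have W1 : \sum_a W 0 a = 1.
  under eq_bigr do rewrite mxE.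
  rewrite exchange_big/= (eq_bigr (fun=> n.+1%:R^-1)); last first.
    move=> k _; rewrite (bigD1 (s k))//= eqxx mulr1 big1 ?addr0// => a /negbTE ask.
    by rewrite eq_sym ask mulr0.
  by rewrite sumr_const card_ord -[LHS]mulr_natl divff// pnatr_eq0.
have sf' i : f'.2 != s i.
  apply/negP => /eqP si; move: c0; rewrite /c (_ : \sum_i _ = (const_mx n.+1%:R^-1 : 'rV_n.+1) *m face_vert f); last first.
    by rewrite mulmx_sum_row; apply: eq_bigr => k _; rewrite mxE.
  rewrite (_ : _ *m _ = W *m T f'.1) ?bary_comb//; last first.
    rewrite !mulmx_sum_row; under [RHS]eq_bigr do rewrite mxE scaler_suml.
    rewrite exchange_big/=; apply: eq_bigr => k _.
    rewrite (bigD1 (s k))//= eqxx mulr1 mxE sE big1 ?addr0// => a /negbTE ask.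
    by rewrite eq_sym ask mulr0 scale0r.
  rewrite mxE (bigD1 i)//= si eqxx mulr1 => /eqP; apply/negP; rewrite gt_eqF// ltr_pwDl ?invr_gt0//.
  by apply: sumr_ge0 => k _; rewrite mulr_ge0// invr_ge0.
have /choice[t tE] : forall i, exists j, s i = lift f'.2 j.
  by move=> i; have [j sj _] := unlift_some (sf' i); exists j.
exists t => [i j tij|i]; last by rewrite sE tE row_face_vert.
have : row i (face_vert f) = row j (face_vert f) by rewrite !sE !tE tij.
rewrite !row_face_vert => E; apply: (@lift_inj _ f.2); apply/eqP.
have := bary_row (lift f.2 i) (lift f.2 j) fA; rewrite E bary_row// eqxx => /esym/eqP.
by rewrite pnatr_eq1 eqb1.
Qed.

Lemma oface_subset_eq T (f f' : face T) : oface f `<=` oface f' -> oface f = oface f'.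
Proof.
move=> ff'; apply/seteqP; split => // x [w [w0 w1 ->]].
have [t ti tE] := oface_subset_rows ff'.
exists (\row_i w 0 (t i)); split.
- by move=> i; rewrite mxE.
- by under eq_bigr do rewrite mxE; rewrite -(reindex_inj ti (P := predT) (F := fun i => w 0 i)).
- rewrite !mulmx_sum_row (reindex_inj ti); apply: eq_bigr => i _.
  by rewrite mxE tE.
Qed.

End faces.

Section extension.
Context (R : realType) (n r : nat).
Hypothesis r0 : (0 < r)%N.
Variables (D K1 : set 'rV[R]_n.+1) (Th TH : mesh R n.+1).
Hypotheses (oD : open D) (K1D : K1 `<=` D).
Hypotheses (trh : triangulates Th K1) (trH : triangulates TH (D `\` K1)).
Let Gamma := boundary K1 `\` boundary D.
Hypothesis capE : cap_grid Th TH Gamma = iface_grid Th Gamma.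

Definition matched (p : face Th * face TH) := cap_on Gamma p /\ cap_face p = oface p.1.

Definition face_node (f : face Th) z := is_node (fun j => row j (face_vert f)) r z.

(** The hypothesis on the grids equates families of sets, so the pair it yields may carry another
    index than [f] for the fine face. Its face contains that of [f], hence equals it, with
    corresponding vertices. *)
Lemma matched_face (f : face Th) : face_on Gamma f -> exists2 p, matched p &
  oface p.1 = oface f /\ exists t : 'I_n.+1 -> 'I_n.+1, forall i, row i (face_vert f) = row (t i) (face_vert p.1).
Proof.
move=> fG; have : iface_grid Th Gamma (oface f) by exists f.
rewrite -capE => -[p pon pE].
have ff' : oface f `<=` oface p.1 by rewrite -pE => x [].
have E := oface_subset_eq ff'; have [t _ tE] := oface_subset_rows ff'.
by exists p; [split => //; rewrite pE|split => //; exists t].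
Qed.

(** Testing membership on matched pairs attaches to each changed node a term of the jump energy; by
    [matched_face] no face on the interface is forgotten. *)
Definition extension_val (v : fe_pair R n.+1) z : R :=
  if `[< exists2 p, matched p & face_node p.1 z >] then v.2 z else v.1 z.

Definition extension v : fe_pair R n.+1 := (interp_fun r Th (extension_val v), v.2).

Lemma extension_linear (c : R) u v : extension (c *: u + v) = c *: extension u + extension v.
Proof.
rewrite /extension; congr pair; apply/funext => x; apply: interp_fun_linear => z.
by rewrite /extension_val; case: asboolP.
Qed.

Lemma matched_poly p (v : fe_pair R n.+1) : matched p -> lagrange_space r TH v.2 ->
  exists2 q, poly_fun r q & forall x, simplex (face_vert p.1) x -> v.2 x = q x.
Proof.
move=> [_ pE] [_ /(_ p.2.1)[q qr vq] _]; exists q => // x px; apply/vq/mem_set.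
apply: face_closure px; first exact/simplex_closed/mesh_nondegenerate.
by rewrite -pE => y [_ /osimplex_simplex/face_subset].
Qed.

Lemma extension_face (f : face Th) v x : fe_space r Th TH v -> face_on Gamma f -> simplex (face_vert f) x ->
  interp_fun r Th (extension_val v) x = v.2 x.
Proof.
move=> [_ vH] /matched_face[p pm [pf [t tE]]].
have [q qr vq] := matched_poly pm vH.
move=> [w [w0 w1 xE]].
have fp : simplex (face_vert f) `<=` simplex (face_vert p.1).
  apply: face_closure; first exact: face_closed.
  by rewrite -pf; exact: osimplex_simplex.
have fx : simplex (face_vert f) x by exists w.
rewrite (interp_funE r0 _ (face_subset fx)) vq; last exact: fp.
rewrite xE mulmx_sum_row; apply: (eq_poly_fun_on_nodes (r := r)) => //; first exact: interp_poly_fun.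
move=> z zf; have zp : face_node p.1 z by exact: is_node_sub zf.
rewrite interp_node//; last by apply: is_node_sub zf => i; exact: row_face_vert.
rewrite /extension_val asboolT; last by exists p.
exact/vq/(node_simplex r0 zp).
Qed.

Lemma extension_interface v x : fe_space r Th TH v -> Gamma x ->
  interp_fun r Th (extension_val v) x = v.2 x.
Proof.
move=> vF Gx; have [f fG fx] := interface_faces oD K1D trh trH Gx.
exact: extension_face fx.
Qed.

Lemma extension_fe_space v : fe_space r Th TH v -> fe_space r Th TH (extension v).
Proof. by move=> [_ vH]; split => //; exact: interp_lagrange_space. Qed.

(** The pieces are the closed elements of both meshes. A point of [D] in a fine and a coarse piece
    is on the interface, where the two components agree, so it does not matter to which side [K1]
    assigns it. *)
Lemma extension_sobolev v : bounded_set D -> fe_space r Th TH v ->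
  sobolev 1 D (glue_fun K1 (extension v)).
Proof.
move=> bD vF; have /choice[Q QE] : forall k : 'I_(mesh_size TH), exists P : seq (R * seq (aff R n.+1)),
    {in simplex (TH k), v.2 =1 sp_eval P}.
  move=> k; have [_ /(_ k)[q /poly_fun_sp[P qP _] vq] _] := vF.2.
  by exists P => x kx; rewrite vq// qP.
pose S (k : 'I_(mesh_size Th) + 'I_(mesh_size TH)) := match k with
  | inl i => simplex (Th i) | inr i => simplex (TH i) end.
pose P (k : 'I_(mesh_size Th) + 'I_(mesh_size TH)) := match k with
  | inl i => interp_sp r (extension_val v) i | inr i => Q i end.
apply: (@sobolev_glue R n.+1 _ D _ S P) => //.
- by case=> i; exact/simplex_closed/mesh_nondegenerate.
- by case=> i x y s; exact: simplex_convex.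
- move=> x Dx; have [/trh.2[i _ ix]|nK] := pselect (K1 x); first by exists (inl i).
  by have [i _ ix] := trH.2 _ (conj Dx nK); exists (inr i).
case=> i x Dx ix; rewrite /glue_fun /=.
- rewrite -(interp_funE r0 _ ix); case: ifPn => // /negP nK.
  have {}nK : ~ K1 x by move=> K1x; apply: nK; exact/mem_set.
  rewrite extension_interface//; apply/(interfaceP oD K1D trh trH); split => //; first by exists i.
  exact: trH.2.
- case: ifPn => [/set_mem K1x|_]; last by apply: QE; exact/mem_set.
  rewrite extension_interface//; first by apply: QE; exact/mem_set.
  apply/(interfaceP oD K1D trh trH); split => //; first exact: trh.2.
  by exists i.
Qed.

End extension.

(** * The estimate *)

Section packing.
Context (R : realType) (n : nat).

(* Elements containing a ball of radius rho near x0 inject into a grid of step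
   proportional to rho: each contains a grid point in its interior. *)
Lemma packing (T : mesh R n) (P : pred 'I_(mesh_size T)) (x0 : 'rV[R]_n) (L rho : R) :
  (0 < n)%N -> 0 < rho -> 0 <= L ->
  (forall i, P i -> exists2 c, forall y, enorm (y - c) < rho -> simplex (T i) y &
     forall a, `|c 0 a - x0 0 a| <= L) ->
  (#|P| <= (Num.truncn (2 * L * (2 * n%:R + 1) / rho)).+1 ^ n)%N.
Proof.
(* As [2 * n * d < rho], a grid point within [d] of [c] in each coordinate keeps a ball of radius
   [d] inside that of radius [rho], and [osimplex_center] puts it in the open element. *)
move=> n0 rho0 L0 PT; pose d := rho / (2 * n%:R + 1).
have n1 : (1 : R) <= n%:R by rewrite ler1n.
have d0 : 0 < d by rewrite divr_gt0// ltr_pwDr// mulr_ge0.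
pose K := Num.truncn (2 * L * (2 * n%:R + 1) / rho).
pose pt (g : {ffun 'I_n -> 'I_K.+1}) : 'rV[R]_n := \row_a (x0 0 a - L + d * (g a : nat)%:R).
have /choice[G GP] : forall i, exists g, P i -> osimplex (T i) (pt g).
  move=> i; have [Pi|_] := boolP (P i); last by exists [ffun=> ord0].
  have [c cr cL] := PT i Pi.
  pose q a := (c 0 a - x0 0 a + L) / d.
  have q0 a : 0 <= q a by apply: divr_ge0; [have := cL a; rewrite ler_norml; lra|exact: ltW].
  have qK a : (Num.truncn (q a) < K.+1)%N.
    rewrite ltnS /K; apply: le_truncn.
    rewrite (_ : 2 * L * _ / rho = 2 * L / d); last first.
      by rewrite /d; field; rewrite !gt_eqF//; lra.
    by rewrite ler_pM2r ?invr_gt0//; have := cL a; rewrite ler_norml; lra.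
  exists [ffun a => Ordinal (qK a)] => _; set g := [ffun a => _].
  have cg a : `|pt g 0 a - c 0 a| <= d.
    rewrite mxE ffunE/=; have /andP[] := truncn_itv (q0 a).
    rewrite -natr1; set m := _%:R => m1 m2.
    have qd : q a * d = c 0 a - x0 0 a + L by rewrite divfK// gt_eqF.
    have : m * d <= q a * d by rewrite ler_pM2r.
    have : q a * d < (m + 1) * d by rewrite ltr_pM2r.
    by rewrite qd ler_norml; clearbody d; lra.
  apply: (osimplex_center (mesh_nondegenerate i) n0 d0) => y yg; apply: cr.
  apply: le_lt_trans (enorm_le_sum _) _.
  apply: (@le_lt_trans _ _ (\sum_(a < n) (d + d))).
    apply: ler_sum => a _; rewrite !mxE -(subrKA (pt g 0 a)).
    apply: le_trans (ler_normD _ _) _; rewrite lerD//.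
    by have := coord_enorm (y - pt g) a; rewrite [(y - _) 0 a]mxE [(- pt g) 0 a]mxE => H; exact: le_trans H (ltW yg).
  rewrite sumr_const card_ord -[ltLHS]mulr_natl /d.
  rewrite -mulrDl mulrA ltr_pdivrMr; last by lra.
  by rewrite (_ : rho * _ = n%:R * (rho + rho) + rho) ?ltrDl//; ring.
rewrite -[X in (_ <= X ^ _)%N](card_ord K.+1) -[X in (_ <= _ ^ X)%N](card_ord n) -card_ffun.
apply: (@leq_card_in _ _ G) => // i j Pi Pj Gij; apply/eqP/negPn/negP => ij.
have : set0 (pt (G i)) by rewrite -(mesh_disjoint ij); split; [exact: GP|rewrite Gij; exact: GP].
by [].
Qed.

End packing.

Section sums.
Context (R : realType) (I : finType).

Lemma sqr_sum_le (P : pred I) (x : I -> R) :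
  (\sum_(i | P i) x i) ^+ 2 <= #|I|%:R * \sum_(i | P i) x i ^+ 2.
Proof.
pose S := \sum_(i | P i) x i ^+ 2; have S0 : 0 <= S by apply: sumr_ge0 => i _; exact: sqr_ge0.
apply: (@le_trans _ _ (#|P|%:R * S)); last by rewrite ler_wpM2r// ler_nat max_card.
rewrite expr2 mulr_suml.
apply: (@le_trans _ _ (\sum_(i | P i) \sum_(j | P j) (x i ^+ 2 + x j ^+ 2) / 2)).
  apply: ler_sum => i _; rewrite mulr_sumr; apply: ler_sum => j _.
  by have := sqr_ge0 (x i - x j); rewrite sqrrB ler_pdivlMr//; lra.
have E (k : R) : \sum_(i | P i) k = #|P|%:R * k by rewrite sumr_const mulr_natl.
under eq_bigr do rewrite -mulr_suml big_split/= E -/S.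
by rewrite -mulr_suml big_split/= E -mulr_sumr -/S ler_pdivrMr// mulr_natr mulr2n.
Qed.

Lemma sume_const_le (P : pred I) (x : \bar R) (N : R) : (0 <= x)%E -> #|P|%:R <= N ->
  (\sum_(i | P i) x <= N%:E * x)%E.
Proof.
move=> x0 PN; rewrite (eq_bigr (fun=> 1%:E * x)%E); last by move=> i _; rewrite mul1e.
rewrite -ge0_sume_distrl; last by move=> i _; rewrite lee_fin.
by apply: lee_wpmul2r => //; rewrite sumEFin lee_fin sumr_const.
Qed.

Lemma lee_sum_term (P : pred I) (x : I -> \bar R) i : (forall j, 0 <= x j)%E -> P i ->
  (x i <= \sum_(j | P j) x j)%E.
Proof. by move=> x0 Pi; rewrite (bigD1 i)//= leeDl// sume_ge0. Qed.

End sums.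

Section nonnegativity.
Context (R : realType) (n : nat).

Lemma elt_diam_gt0 (T : mesh R n.+1) (i : 'I_(mesh_size T)) : 0 < elt_diam i.
Proof. by apply: diam_simplex_gt0 => //; exact: mesh_nondegenerate. Qed.

Lemma jump_term_ge0 (T1 T2 : mesh R n.+1) (v : fe_pair R n.+1) (p : face T1 * face T2) :
  (0 <= (elt_diam p.1.1)^-1%:E * surface_L2norm2 (face_vert p.1) (cap_face p) (jump v))%E.
Proof.
apply: mule_ge0; first by rewrite lee_fin invr_ge0 ltW// elt_diam_gt0.
apply: mule_ge0; first by rewrite lee_fin sqrtr_ge0.
by apply: integral_ge0 => t _; rewrite lee_fin sqr_ge0.
Qed.

Lemma weighted_seminorm2_0 (T : mesh R n.+1) G m : (weighted_seminorm2 T G m (cst 0%R) <= 0)%E.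
Proof.
apply: sume_le0 => i _; apply: mule_ge0_le0.
  by rewrite lee_fin exprz_ge0// ltW// elt_diam_gt0.
have fA := @mesh_nondegenerate _ _ T i.
apply: sobolev_seminorm2_0 => //; first exact: osimplex_open.
have [N [Nr NA]] := simplex_bounded (T i); exists N; split => // X NX x /osimplex_simplex.
exact: NA.
Qed.

End nonnegativity.

Section estimate.
Context (R : realType) (n r : nat) (sigma nu : R).
Hypotheses (r0 : (0 < r)%N) (sigma1 : 1 <= sigma) (nu0 : 0 < nu).
Variables (D K1 : set 'rV[R]_n.+2) (Th TH : mesh R n.+2).
Let Gamma := boundary K1 `\` boundary D.
Hypotheses (srh : shape_regular sigma Th) (quh : quasi_uniform_at nu Th Gamma).
Variable v : fe_pair R n.+2.
Hypothesis vF : fe_space r Th TH v.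

Let h := iface_diam Th Gamma.
Let sigma0 : 0 < sigma := lt_le_trans ltr01 sigma1.

Let X (p : face Th * face TH) : \bar R := ((elt_diam p.1.1)^-1%:E *
  surface_L2norm2 (face_vert p.1) (cap_face p) (jump v))%E.

Let adj i (p : face Th * face TH) := `[< simplex (Th i) `&` simplex (Th p.1.1) !=set0 >].

Lemma face_on_touches (T : mesh R n.+2) G (f : face T) : face_on G f -> touches G f.1.
Proof. by move=> [x [/osimplex_simplex/face_subset fx Gx]]; exists x. Qed.

Lemma elt_diam_le i : touches (T := Th) Gamma i -> elt_diam i <= h.
Proof. by move=> ti; apply: le_bigmax_cond; exact/asboolP. Qed.

Let X_ge0 p : (0 <= X p)%E := jump_term_ge0 v p.

Lemma packing_touching k : touches (T := Th) Gamma k ->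
  (#|[pred i | `[< touches (T := Th) Gamma i >] &&
       `[< simplex (Th i) `&` simplex (Th k) !=set0 >]]| <=
   (Num.truncn (8 * sigma * (2 * n.+2%:R + 1) / nu)).+1 ^ n.+2)%N.
Proof.
move=> tk; have h0 : 0 < h by apply: lt_le_trans (elt_diam_gt0 k) _; exact: elt_diam_le.
(* The diameter is at least [nu * h], and [inscribed_ball] loses a factor [2 * sigma]. The distance
   [2 * h] is one diameter from the centre to a common point and one more to a vertex of the [k]-th
   element, so the ratio is free of [h]. *)
pose rho := nu * h / (2 * sigma).
have rho0 : 0 < rho by rewrite !mulr_gt0// invr_gt0 mulr_gt0.
have := @packing R n.+2 Th [pred i | `[< touches (T := Th) Gamma i >] &&
       `[< simplex (Th i) `&` simplex (Th k) !=set0 >]] (row ord0 (Th k)) (2 * h) rho.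
rewrite (_ : 2 * (2 * h) * _ / rho = 8 * sigma * (2 * n.+2%:R + 1) / nu); last first.
  by rewrite /rho; field; rewrite !gt_eqF.
apply => //; first by rewrite mulr_ge0// ltW.
move=> i /andP[/asboolP ti /asboolP[q [qi qk]]].
have [c [s [s0 hs cs]]] := inscribed_ball (mesh_nondegenerate i) (ltn0Sn _) sigma0 (srh i).
exists c => [y yc|a].
  apply: cs; apply: lt_le_trans yc _; rewrite /rho ler_pdivrMr ?mulr_gt0// [s * _]mulrC.
  by apply: le_trans hs; exact: quh.
have ci : simplex (Th i) c by apply/osimplex_simplex/(osimplex_center (mesh_nondegenerate i) _ s0 cs).
rewrite -(subrKA (q 0 a)); apply: le_trans (ler_normD _ _) _.
rewrite (_ : 2 * h = h + h); last by ring.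
rewrite lerD//.
  have -> : c 0 a - q 0 a = (c - q) 0 a by rewrite !mxE.
  apply: le_trans (coord_enorm _ _) _; apply: le_trans (elt_diam_le ti).
  exact: diam_ub (simplex_bounded _) ci qi.
have -> : q 0 a - row ord0 (Th k) 0 a = (q - row ord0 (Th k)) 0 a by rewrite !mxE.
apply: le_trans (coord_enorm _ _) _; apply: le_trans (elt_diam_le tk).
exact: diam_ub (simplex_bounded _) qk (simplex_row _ _).
Qed.

Let ext := extension_val r D K1 Th TH v.
Let w := v - extension r D K1 Th TH v.

Section node_estimate.
Variable C : R.
Hypothesis C0 : 0 < C.
Hypothesis faceC : forall (A : 'M[R]_(n.+3, n.+2)) j f p z,
    affinely_independent A -> chunkiness (simplex A) <= sigma ->
    poly_fun r p -> (forall x, osimplex (row' j A) x -> f x = p x) ->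
    is_node (fun i => row i (row' j A)) r z ->
    (((p z) ^+ 2 * diam (simplex A) ^+ n.+1)%:E <=
      C%:E * surface_L2norm2 (row' j A) (osimplex (row' j A)) f)%E.

(** A changed node of element [i] may come from a face of another element, since [i] may touch the
    interface in a vertex only. The sum therefore runs over the pairs adjacent to [i], and
    quasi-uniformity exchanges the two diameters at the price of [nu ^+ n]. *)
Lemma node_estimate i z : touches (T := Th) Gamma i -> is_node (fun j => row j (Th i)) r z ->
  (((v.1 z - ext z) ^+ 2 * elt_diam i ^+ n)%:E <=
   (C / nu ^+ n)%:E * \sum_(p | `[< cap_on Gamma p >] && adj i p) X p)%E.
Proof.
move=> ti zi; have CN : 0 < C / nu ^+ n by rewrite divr_gt0 ?exprn_gt0.
rewrite /ext /extension_val; case: asboolP => [[p pm zp]|_]; last first.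
  rewrite subrr expr0n mul0r; apply: mule_ge0; first by rewrite lee_fin ltW.
  by apply: sume_ge0 => p _; exact: X_ge0.
have [q qr vq] := matched_poly pm vF.2; have [pon pE] := pm.
have [_ /(_ p.1.1)[q1 q1r vq1] _] := vF.1.
have fA := @mesh_nondegenerate _ _ Th p.1.1.
have {vq1} vq1 x : simplex (face_vert p.1) x -> v.1 x = q1 x.
  by move=> /face_subset px; apply: vq1; exact/mem_set.
have zp' : simplex (face_vert p.1) z by exact: node_simplex zp.
have := @faceC (Th p.1.1) p.1.2 (jump v) (fun x => q1 x + (-1) * q x) z fA (srh _)
  (poly_funD q1r (poly_funZ (-1) qr)) _ zp.
rewrite -/(face_vert p.1) -/(oface p.1) -pE -vq1// -vq// mulN1r => H.
apply: (@le_trans _ _ ((C / nu ^+ n)%:E * X p)%E); last first.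
  apply: lee_wpmul2l; first by rewrite lee_fin ltW.
  apply: lee_sum_term => //.
  rewrite asboolT//=; apply/asboolP; exists z; split; first exact: node_simplex zi.
  exact: face_subset.
have {}H := H _; rewrite /X.
have hp : 0 < elt_diam p.1.1 by exact: elt_diam_gt0.
have tp : touches Gamma p.1.1 by apply: face_on_touches; case: pon.
have hi : elt_diam i <= elt_diam p.1.1 / nu.
  rewrite ler_pdivlMr// mulrC; apply: le_trans (quh tp); rewrite ler_pM2l//; exact: elt_diam_le.
apply: (@le_trans _ _ ((elt_diam p.1.1)^-1 / nu ^+ n * ((v.1 z - v.2 z) ^+ 2 * elt_diam p.1.1 ^+ n.+1))%:E).
  rewrite lee_fin mulrCA; apply: ler_wpM2l; first exact: sqr_ge0.
  rewrite [leRHS](_ : _ = (elt_diam p.1.1 / nu) ^+ n); last first.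
    by rewrite expr_div_n exprS -mulrA mulrCA mulKf ?gt_eqF// mulrC.
  by rewrite lerXn2r// nnegrE ltW ?divr_gt0 ?elt_diam_gt0.
rewrite EFinM; apply: le_trans (lee_wpmul2l _ (H _)) _.
- by rewrite lee_fin ltW// divr_gt0 ?invr_gt0 ?exprn_gt0.
- by move=> x [/osimplex_simplex px _]; rewrite /jump mulN1r -vq1// -vq.
set S := surface_L2norm2 _ _ _; rewrite !muleA -!EFinM.
by rewrite (_ : (elt_diam p.1.1)^-1 / nu ^+ n * C = C / nu ^+ n / elt_diam p.1.1)//; ring.
Qed.

Let N : R := #|{: {ffun 'I_n.+3 -> 'I_r.+1}}|%:R.
Let C1 : R := (r.+1 ^ n.+2)%:R * ((r%:R * (r%:R * (4 * sigma))) ^+ r * r%:R ^+ r) ^+ 2 * 2 ^+ n.+2.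
Let P : R := ((Num.truncn (8 * sigma * (2 * n.+2%:R + 1) / nu)).+1 ^ n.+2)%:R.

Let C1_ge0 : 0 <= C1.
Proof. by rewrite /C1 mulr_ge0 ?exprn_ge0// mulr_ge0// exprn_ge0// mulr_ge0 ?exprn_ge0// !mulr_ge0// ltW. Qed.

(** One factor [N] comes from squaring the sum of the nodal differences, the other from bounding
    each node by the same sum of jumps. *)
Lemma element_estimate i m : (m <= r)%N -> touches (T := Th) Gamma i ->
  ((elt_diam i ^ (2 * m%:Z - 2))%:E *
    sobolev_seminorm2 m (osimplex (Th i)) w.1 <=
   (C1 * N * N * (C / nu ^+ n))%:E * \sum_(p | `[< cap_on Gamma p >] && adj i p) X p)%E.
Proof.
move=> mr ti; have hi := elt_diam_gt0 i.
pose d (al : {ffun 'I_n.+3 -> 'I_r.+1}) :=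
  let z := node (fun j => row j (Th i)) al in v.1 z - ext z.
have S0 : (0 <= \sum_(p | `[< cap_on Gamma p >] && adj i p) X p)%E by exact: sume_ge0.
have := @seminorm_upper _ _ r _ (mesh_nondegenerate i) r0 _ sigma1 (srh i) d
  w.1 m mr.
rewrite -/(elt_diam i) -/C1; move: (C1) C1_ge0 => c c0 H; apply: le_trans (H _) _.
  move=> x /osimplex_simplex ix.
  exact: (lagrange_interp_sub r0 ext vF.1 ix).
set S := (\sum_(p | _) _)%E in S0 *.
apply: (@le_trans _ _ ((c * N)%:E * \sum_(al : {ffun 'I_n.+3 -> 'I_r.+1} | msize al == r)
    (d al ^+ 2 * elt_diam i ^+ n)%:E)%E).
  rewrite sumEFin -EFinM lee_fin -!mulrA; apply: ler_wpM2l => //.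
  rewrite -mulr_suml [leRHS]mulrA [leRHS]mulrC.
  apply: ler_wpM2l; first by rewrite exprn_ge0// ltW.
  apply: le_trans (sqr_sum_le _ _) _; rewrite ler_wpM2l//.
  by apply: ler_sum => al _; rewrite real_normK ?num_real.
have CN : 0 <= C / nu ^+ n by rewrite divr_ge0 ?exprn_ge0// ltW.
apply: (@le_trans _ _ ((c * N)%:E * \sum_(al : {ffun 'I_n.+3 -> 'I_r.+1} | msize al == r)
    ((C / nu ^+ n)%:E * S))%E).
  apply: lee_wpmul2l; first by rewrite lee_fin mulr_ge0.
  by apply: lee_sum => al /eqP alr; apply: node_estimate => //; exists al.
rewrite -[c * N * N * _]mulrA (EFinM (c * N)) -muleA; apply: lee_wpmul2l; first by rewrite lee_fin mulr_ge0.
rewrite (EFinM N) -muleA; apply: sume_const_le; first by rewrite mule_ge0.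
by rewrite ler_nat max_card.
Qed.

Lemma interface_estimate m : (m <= r)%N ->
  (weighted_seminorm2 Th Gamma m w.1 <=
   (C1 * N * N * (C / nu ^+ n) * P)%:E * jump_energy Th TH Gamma v)%E.
Proof.
move=> mr; rewrite /weighted_seminorm2.
have CN : 0 <= C1 * N * N * (C / nu ^+ n).
  apply: mulr_ge0; first by do 2 apply: mulr_ge0 => //.
  by apply: divr_ge0; [exact: ltW|rewrite exprn_ge0// ltW].
apply: (@le_trans _ _ (\sum_(i | `[< touches (T := Th) Gamma i >])
   ((C1 * N * N * (C / nu ^+ n))%:E * \sum_(p | `[< cap_on Gamma p >] && adj i p) X p))%E).
  by apply: lee_sum => i /asboolP ti; exact: element_estimate.
rewrite -ge0_sume_distrr; last by move=> i _; apply: sume_ge0.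
move: (C1 * N * N * (C / nu ^+ n)) CN => c c0.
rewrite (EFinM c) -muleA; apply: lee_wpmul2l; first by rewrite lee_fin.
(* After the exchange, a pair is counted once for each touching element that meets its fine element,
   hence at most [P] times. *)
rewrite (exchange_big_dep (fun p => `[< cap_on Gamma p >]))/=; last by move=> i p _ /andP[].
rewrite /jump_energy ge0_sume_distrr; last by move=> p _; exact: X_ge0.
apply: lee_sum => p /asboolP pc; have [pon _ _] := pc.
rewrite (eq_bigl (fun i => `[< touches (T := Th) Gamma i >] && adj i p)); last first.
  by move=> i; rewrite (asboolT pc).
apply: sume_const_le => //; rewrite ler_nat.
exact/packing_touching/face_on_touches.
Qed.

End node_estimate.

End estimate.

Theorem lemma4p1 (R : realType) (n r : nat) (sigma nu : R) :
  n = 2%N \/ n = 3%N -> (0 < r)%N -> 0 < nu ->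
  exists C : R, 0 < C /\
  forall (D K1 : set 'rV[R]_n) (Th TH : mesh R n),
  let K2 := D `\` K1 in
  let Gamma := boundary K1 `\` boundary D in
  domain D -> bounded_set D -> K1 `<=` D ->
  triangulates Th K1 -> triangulates TH K2 ->
  shape_regular sigma Th -> shape_regular sigma TH ->
  quasi_uniform_at nu Th Gamma ->
  cap_grid Th TH Gamma = iface_grid Th Gamma ->
  exists E : fe_pair R n -> fe_pair R n,
  [/\ forall (c : R) u v, fe_space r Th TH u -> fe_space r Th TH v ->
        E (c *: u + v) = c *: E u + E v,
      forall v, fe_space r Th TH v ->
        fe_space r Th TH (E v) /\ sobolev 1 D (glue_fun K1 (E v)) &
      forall v, fe_space r Th TH v -> forall m, (m <= r)%N ->
        let w := v - E v in
        (weighted_seminorm2 Th Gamma m w.1 + weighted_seminorm2 TH Gamma m w.2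
         <= C%:E * jump_energy Th TH Gamma v)%E].
Proof.
move=> n23 r0 nu0; have [n' ->] : exists n', n = n'.+2.
  by case: n23 => ->; [exists 0%N|exists 1%N].
(* The element estimates ask for a shape constant of at least 1; enlarging [sigma] keeps the mesh
   shape-regular. *)
pose s := Num.max sigma 1; have s1 : 1 <= s by rewrite le_max lexx orbT.
have s0 : 0 < s by exact: lt_le_trans ltr01 s1.
have [C C0 faceC] := @face_lower R n'.+1 r s r0 s0.
have := fun D K1 Th TH hs hq v vF =>
  @interface_estimate R n' r s nu r0 s1 nu0 D K1 Th TH hs hq v vF C C0 faceC.
(* The constant is read off from the estimate before any mesh is introduced, so it depends on [n],
   [r], [sigma] and [nu] only; [|M| + 1] makes it visibly positive. *)
set M := (_ * (_ ^ _)%:R); move: M => M H; exists (`|M| + 1); split; first by rewrite ltr_wpDl.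
move=> D K1 Th TH K2 Gamma [oD _ _] bD K1D trh trH srh srH quh capE.
have srs : shape_regular s Th by move=> i; rewrite le_max srh.
exists (extension r D K1 Th TH); split.
- by move=> c u v _ _; exact: extension_linear.
- by move=> v vF; split; [exact: extension_fe_space|exact: extension_sobolev].
move=> v vF m mr; cbv zeta; set w := v - _.
have X0 : (0 <= jump_energy Th TH Gamma v)%E by apply: sume_ge0 => p _; exact: jump_term_ge0.
have -> : w.2 = cst 0 by apply/funext => x; exact: subrr.
apply: le_trans (leeD2l _ (weighted_seminorm2_0 _ _ _)) _; rewrite adde0.
apply: le_trans (H _ _ _ _ srs quh _ vF _ mr) _; apply: lee_wpmul2r => //.
by rewrite lee_fin (le_trans (ler_norm M))// lerDl.
Qed.
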